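(* There exist a compact separable metric space $\mathcal{S}$ and a time-homogeneous strong Markov process $X=(X(t):t\ge 0)$ on $\mathcal{S}$, with right-continuous paths having left limits, such that $X$ is Harris recurrent but, for every initial state $x\in\mathcal{S}$, $X$ under $P_x$ is not wide-sense regenerative.
   Context: $\mathcal{S}$ is endowed with its Borel $\sigma$-algebra. $P_x$ denotes the law of $X$ when $X(0)=x$. For $t\ge 0$, $\Theta_tX=(X(t+s):s\ge 0)$ denotes the process shifted by $t$; for a finite random time $R$, $\Theta_RX=(X(R+s):s\ge 0)$. Harris recurrence: $X$ is Harris recurrent if there exists a non-trivial $\sigma$-finite measure $\eta$ on $\mathcal{S}$ such that, for every Borel $A\subset\mathcal{S}$, $\eta(A)>0$ implies $\int_0^\infty I(X(t)\in A)\,dt=\infty$ $P_x$-almost surely, for each $x\in\mathcal{S}$. Wide-sense regeneration: $X$ (under $P_x$) is wide-sense regenerative if there exist randomized stopping times $0\le R_0<R_1<\cdots<\infty$ such that (i) for each $n\ge 0$, $\Theta_{R_n}X$ is independent of $R_n$; and (ii) the distribution of $\Theta_{R_n}X$ does not depend on $n$. Randomized stopping time: a random time $R$ defined on some probability space carrying $X$ with law $P_x$ together with possible additional randomness (an extension preserving the law of $X$), such that for every $t\ge 0$ the event $\{R\le t\}$ is conditionally independent of the future $(X(s):s\ge t)$ given the past $\sigma(X(s):0\le s\le t)$. The times $R_0,R_1,\dots$ are all defined on one common extension. *)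

(* Defs.v *)
From HB Require Import structures.
From mathcomp Require Export all_boot all_order all_algebra.
From mathcomp Require Export all_classical all_reals all_analysis.

Set Implicit Arguments.
Unset Strict Implicit.
Unset Printing Implicit Defensive.

Import Order.TTheory GRing.Theory Num.Theory.
Import numFieldNormedType.Exports.

Local Open Scope classical_set_scope.
Local Open Scope ring_scope.

(* The library's measurable types are pointed, hence the metric state space
   has to be pointed too. *)
#[short(type="pmetricType")]
HB.structure Definition PointedMetric (K : numDomainType) :=
  {M of Metric K M & Pointed M}.

Definition separable (T : topologicalType) :=
  exists2 D : set T, countable D & dense D.

Notation borel S := (g_sigma_algebraType (@open S)).

Section Processes.
Context {R : realType} {S : pmetricType R}.

(* Time is [0, +oo[: a path is a function on R whose values at negative times
   are neither constrained nor observed. *)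
Definition cadlag (p : R -> S) := forall t, 0 <= t ->
  p s @[s --> t^'+] --> p t /\
  (0 < t -> exists l : S, p s @[s --> t^'-] --> l).

(* The sigma-algebra generated by X s, s \in I. *)
Definition sigma_process {Omega : Type} (X : R -> Omega -> S) (I : set R) :
    set (set Omega) :=
  <<s \bigcup_(s in I) preimage_set_system setT (X s) <<s @open S >> >>.

Definition past {Omega : Type} (X : R -> Omega -> S) (t : R) :=
  sigma_process X `[0, t].

Definition future {Omega : Type} (X : R -> Omega -> S) (t : R) :=
  sigma_process X `[t, +oo[.

(* The product sigma-algebra on the path space; laws of processes are compared
   on it. *)
Definition path_event : set (set (R -> S)) :=
  sigma_process (fun t (p : R -> S) => p t) `[0, +oo[.

Definition path_of {Omega : Type} (X : R -> Omega -> S) (w : Omega) : R -> S :=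
  fun s => X s w.

(* The shifted process Theta_T X for a finite random time T. *)
Definition shift_by {Omega : Type} (T : Omega -> R) (X : R -> Omega -> S)
    (w : Omega) : R -> S :=
  fun s => X (T w + s) w.

Definition cadlag_process {d} {Omega : measurableType d}
    (X : R -> Omega -> S) :=
  (forall t, 0 <= t -> measurable_fun setT (X t : Omega -> borel S)) /\
  (forall w, cadlag (path_of X w)).

(* f is a version of the conditional probability Q(A | G), for a
   sub-sigma-algebra G of measurable sets. *)
Definition cond_prob {d} {Omega : measurableType d}
    (Q : {measure set Omega -> \bar R}) (G : set (set Omega)) (A : set Omega)
    (f : Omega -> R) :=
  [/\ forall Y : set R, measurable Y -> G (f @^-1` Y),
      Q.-integrable setT (EFin \o f) &
      forall C, G C -> (\int[Q]_(w in C) (f w)%:E = Q (A `&` C))%E].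

(* The event A and the sigma-algebra H are conditionally independent given G. *)
Definition cond_indep {d} {Omega : measurableType d}
    (Q : {measure set Omega -> \bar R}) (A : set Omega)
    (H G : set (set Omega)) :=
  forall B, H B -> exists f g : Omega -> R,
    [/\ cond_prob Q G A f, cond_prob Q G B g &
        cond_prob Q G (A `&` B) (f \* g)].

(* T is a stopping time of the right-continuous filtration (past X t+)_t. *)
Definition optional_time {Omega : Type} (X : R -> Omega -> S)
    (T : Omega -> \bar R) :=
  (forall w, (0 <= T w)%E) /\
  (forall t, 0 <= t -> past X t [set w | (T w < t%:E)%E]).

(* The sigma-algebra F_{T+} of an optional time T. *)
Definition past_optional {Omega : Type} (X : R -> Omega -> S)
    (T : Omega -> \bar R) : set (set Omega) :=
  [set A | future X 0 A /\
           forall t, 0 <= t -> past X t (A `&` [set w | (T w < t%:E)%E])].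

(* X is a process on Omega with law P x when started at x; the last clause reads
     P_x(T < oo, Theta_T X \in B | F_{T+}) = 1_{T < oo} P_{X(T)}(X \in B),
   and includes time-homogeneity and the simple Markov property (T constant).
   Optional times comprise all stopping times of the raw filtration. *)
Definition strong_markov {d} {Omega : measurableType d}
    (P : R.-pker (borel S) ~> Omega) (X : R -> Omega -> S) :=
  [/\ cadlag_process X,
      forall x : S, P x [set w | X 0 w = x] = 1%E &
      forall (x : S) (T : Omega -> \bar R) (B : set (R -> S)),
        optional_time X T -> path_event B ->
        cond_prob (P x) (past_optional X T)
          ([set w | (T w < +oo)%E] `&` shift_by (fine \o T) X @^-1` B)
          (fun w => if (T w < +oo)%E
                    then fine (P (X (fine (T w)) w) (path_of X @^-1` B))
                    else 0)].

Definition harris_recurrent {d} {Omega : measurableType d}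
    (P : R.-pker (borel S) ~> Omega) (X : R -> Omega -> S) :=
  exists eta : {sigma_finite_measure set (borel S) -> \bar R},
    eta setT != 0%E /\
    forall A : set (borel S), measurable A -> (0 < eta A)%E ->
    forall x : S, {ae P x, forall w,
      (\int[lebesgue_measure]_(t in `[0%R, +oo[) (\1_A (X t w))%:E = +oo)%E}.

(* T is a randomized stopping time of the process X on the (possibly enlarged)
   probability space (Omega, Q). *)
Definition randomized_stopping_time {d} {Omega : measurableType d}
    (Q : probability Omega R) (X : R -> Omega -> S) (T : Omega -> R) :=
  [/\ measurable_fun setT T,
      forall w, 0 <= T w &
      forall t, 0 <= t ->
        cond_indep Q [set w | T w <= t] (future X t) (past X t)].

(* X under P x is wide-sense regenerative: some probability space (Omega', Q)
   carries a copy X' of X with the law of X under P x, together with the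
   times T 0 < T 1 < ... *)
Definition wide_sense_regenerative {d} {Omega : measurableType d}
    (P : R.-pker (borel S) ~> Omega) (X : R -> Omega -> S) (x : S) :=
  exists (d' : measure_display) (Omega' : measurableType d')
         (Q : probability Omega' R) (X' : R -> Omega' -> S)
         (T : nat -> Omega' -> R),
  [/\ cadlag_process X' /\
      (forall B, path_event B ->
         Q (path_of X' @^-1` B) = P x (path_of X @^-1` B)),
      forall n, randomized_stopping_time Q X' (T n),
      forall n w, T n w < T n.+1 w,
      forall n (B : set (R -> S)) (C : set R), path_event B -> measurable C ->
        Q (shift_by (T n) X' @^-1` B `&` T n @^-1` C) =
        (Q (shift_by (T n) X' @^-1` B) * Q (T n @^-1` C))%E &
      forall m n (B : set (R -> S)), path_event B ->
        Q (shift_by (T m) X' @^-1` B) = Q (shift_by (T n) X' @^-1` B)].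

End Processes.

(* Main.v *)
(** A state is a triple (y, y', th) on the torus: y is the current vertex, y' the
    next one, and th runs from 0 to 1 during a time g(y, y') >= 1, whereupon the
    state jumps to (y', u, 0) with u a fresh uniform vertex. Fresh vertices bring
    each set that is charged by the law of (uniform, uniform, uniform) back
    infinitely often, for at least a fixed time, which gives Harris recurrence;
    independence of the past and future vertices gives the strong Markov property.

    The function g is chosen such that the sum of g over the edges of a finite walk
    without repetition determines, and measurably so, that walk as a unit flow from
    its origin to its end: each g(y, y') is a factorial-base expansion whose digits,
    0 or 1, list the dyadic cells of (y, y'). Started at x, at every time t the
    time of the next jump is, up to a constant, such a sum, for a walk from nxt x to
    nxt (X t). Let T and T' be the first two regeneration times and
    s, s' the states at these times, where (T', s') is taken from an independent
    copy of the process. By independence and equality in law, the pairs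
    (T', s) and (T, s') almost surely also have the form of such sums. The two
    true walks share only their origin, as fresh vertices have no atoms; so the
    sum of the two exchanged times, which is the sum of the two true ones, splits
    in only one way, whence T = T' almost surely. Thus both regeneration times are
    equal to the same constant, although the second exceeds the first. *)

From HB Require Import structures.
From mathcomp Require Import ring lra zify measurable_realfun.
Require Import Defs.

Set Implicit Arguments.
Unset Strict Implicit.
Unset Printing Implicit Defensive.

Import Order.TTheory GRing.Theory Num.Theory.
Import numFieldNormedType.Exports.

Local Open Scope classical_set_scope.
Local Open Scope ring_scope.

(** * Fair coin tossing *)

(** The copy of the process is known only through the probabilities of path events, and regeneration
    is exploited only through the joint law of one time and one state. Both facts shape the proof.
    Whatever is used of a trajectory must have a countable description: vertices recorded at integer
    times, comparisons at rational times. And the existence of a walk must be weakened to a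
    measurable relation between a time and a state, [balanced], that survives the exchange. The
    factorial base serves because its radices grow: digits 0 and 1, summed over finitely many edges,
    are eventually too small to carry. The digits of an exchanged time are non-negative and
    dominated by those of the two walks together, hence live on their edges; conservation of flow
    then leaves no choice. Durations of at least 1 keep jumps from accumulating and put an integer
    time into every cycle. The time left until the next jump depends on the state alone, so that
    exchanging states only moves terms between two times and preserves their sum. *)

Definition image_measure d d' (T1 : measurableType d) (T2 : measurableType d')
    (R : realType) (m : {measure set T1 -> \bar R}) (f : T1 -> T2)
    (mf : measurable_fun setT f) : {measure set T2 -> \bar R} :=
  measure_function_pushforward__canonical__measure_function_Measure m mf.

Definition cylinder (n : nat) (w : nat -> bool) : set (nat -> bool) :=
  [set v | forall i, (i < n)%N -> v i = w i].

(** With the empty set the family is stable under intersection, so that measures can be compared on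
    it. *)
Definition cylinders : set (set (nat -> bool)) :=
  [set A | A = set0 \/ exists n w, A = cylinder n w].

Notation coins := (g_sigma_algebraType cylinders).

Lemma measurable_cylinder n w : measurable (cylinder n w : set coins).
Proof. by apply: sub_sigma_algebra; right; exists n, w. Qed.

Lemma measurable_coin i : measurable [set v : coins | v i].
Proof.
rewrite [X in measurable X](_ : _ = \bigcup_(t in [set: i.+1.-tuple bool])
  if nth false t i then cylinder i.+1 (nth false t) else set0).
  apply: countable_bigcupT_measurable => [|t].
    exact: countableP.
  by case: ifP => _; [exact: measurable_cylinder|exact: measurable0].
apply/seteqP; split=> [v vi|v [t _]] /=.
  exists (mktuple (fun j : 'I_i.+1 => v j)) => //.
  have E j : (j < i.+1)%N -> nth false (mktuple (fun j : 'I_i.+1 => v j)) j = v j.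
    by move=> ji; rewrite (_ : j = Ordinal ji) // nth_mktuple.
  by rewrite E // vi => j ji; rewrite E.
by case: ifP => // ti /(_ i) ->.
Qed.

Lemma measurable_fun_coins d (T : measurableType d) (f : T -> coins) :
  (forall i, measurable [set x | f x i]) -> measurable_fun setT f.
Proof.
move=> mf; apply: (@measurability _ _ _ coins _ _ cylinders) => //.
move=> _ [_ [->|[n [w ->]]] <-]; first by rewrite preimage_set0 setI0.
rewrite setTI (_ : _ @^-1` _ = \bigcap_(i in `I_n) [set x | f x i = w i]) //.
apply: fin_bigcap_measurable; first exact: finite_II.
move=> i _; case: (w i) => /=; first exact: mf.
rewrite (_ : [set _ | _] = ~` [set x | f x i]); first exact: measurableC.
by apply/seteqP; split => x /=; [move=> ->|move=> /negP/negbTE].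
Qed.

Lemma setI_closed_cylinders : setI_closed cylinders.
Proof.
have sub n w m w' : (n <= m)%N ->
    cylinders (cylinder n w `&` cylinder m w').
  move=> nm; have [e|ne] := pselect (forall i, (i < n)%N -> w i = w' i).
    right; exists m, w'; apply/seteqP; split => v; first by case.
    by move=> vw; split => // i ilt; rewrite vw ?e //; exact: leq_trans nm.
  left; rewrite -subset0 => v [vw vw']; apply: ne => i ilt.
  by rewrite -vw // vw' //; exact: leq_trans nm.
move=> A B [->|[n [w ->]]]; first by rewrite set0I; left.
case=> [->|[m [w' ->]]]; first by rewrite setI0; left.
by case: (leqP n m) => [|/ltnW] nm; [|rewrite setIC]; exact: sub.
Qed.

(** * Fair coins as binary digits of a uniform number *)

Section coin_measure.
Context {R : realType}.
Local Notation mu := (@lebesgue_measure R).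

Definition binary_digit (x : R) : coins :=
  fun n => odd (Num.truncn (2 ^+ n.+1 * x)).

Fixpoint binary_value (w : nat -> bool) (n : nat) : nat :=
  if n is m.+1 then ((binary_value w m).*2 + w m)%N else 0%N.

Lemma truncn_double (x : R) : 0 <= x ->
  (Num.truncn (2 * x))./2 = Num.truncn x.
Proof.
move=> x0; have /andP[l u] := truncn_itv x0.
have /andP[l2 u2] : ((Num.truncn x).*2%:R <= 2 * x < (Num.truncn x).+1.*2%:R).
  by rewrite -!muln2 !natrM; apply/andP; split; lra.
have x2 : 0 <= 2 * x by lra.
move: l2 u2; rewrite -truncn_ge_nat // -truncn_lt_nat //.
by move=> l2 u2; lia.
Qed.

Lemma cylinder_binary_digit n w (x : R) : 0 <= x < 1 ->
  cylinder n w (binary_digit x) <->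
  Num.truncn (2 ^+ n * x) = binary_value w n.
Proof.
move=> /andP[x0 x1]; elim: n => [|n IH].
  split=> // _; rewrite expr0 mul1r; apply/eqP.
  by rewrite truncn_eq // x0.
have E : (Num.truncn (2 ^+ n.+1 * x))./2 = Num.truncn (2 ^+ n * x).
  by rewrite exprS -mulrA truncn_double // mulr_ge0 // exprn_ge0.
split=> [xw|/= xw].
  have /IH xn : cylinder n w (binary_digit x).
    by move=> i ilt; apply: xw; exact: ltnW.
  rewrite /= -xn -(xw n) // /binary_digit -E addnC.
  by rewrite odd_double_half.
move=> i; rewrite ltnS leq_eqVlt => /predU1P[->|].
  by rewrite /binary_digit xw oddD odd_double /= oddb.
move: i; apply/IH; rewrite -E xw.
by rewrite halfD odd_double /= doubleK add0n; case: (w n); rewrite addn0.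
Qed.

Lemma measurable_truncn : measurable_fun [set: R] (@Num.truncn R).
Proof.
move=> _ Y _; rewrite setTI [X in measurable X](_ : _ =
    \bigcup_(n in Y) [set x : R | Num.truncn x = n]); last first.
  by apply/seteqP; split => [x Yx|x [n Yn /= nx]]; [exists (Num.truncn x)|rewrite /preimage /= nx].
apply: bigcup_measurable => -[|n] _.
  rewrite (_ : [set _ | _] = `]-oo, 1[%classic); first exact: measurable_itv.
  apply/seteqP; split => x /=; rewrite in_itv /=.
    by move=> /truncn0Pn; rewrite -ltNge.
  by rewrite ltNge => /truncn0Pn.
rewrite (_ : [set _ | _] = `[n.+1%:R, n.+2%:R[%classic).
  exact: measurable_itv.
apply/seteqP; split => x /=; rewrite in_itv /= => H.
  rewrite -truncn_eq ?H ?eqxx //; apply: ltW.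
  by rewrite (lt_le_trans ltr01) // -truncn_gt0 H.
by apply/eqP; rewrite truncn_eq // (le_trans (ler0n _ n.+1)) //; case/andP: H.
Qed.

Lemma measurable_binary_digit : measurable_fun [set: R] binary_digit.
Proof.
apply: measurable_fun_coins => i.
have : measurable_fun [set: R] (fun x : R => Num.truncn (2 ^+ i.+1 * x)).
  by apply: measurableT_comp measurable_truncn _; exact: mulrl_measurable.
by move=> /(_ measurableT [set n | odd n] I); rewrite setTI.
Qed.

Let mI : measurable (`[0, 1[%classic : set R). Proof. exact: measurable_itv. Qed.

(** The infinite product of fair coins, obtained as the image of Lebesgue measure on [[0, 1[] under
    binary expansion. *)
Definition coin_measure : set coins -> \bar R :=
  pushforward (mrestr mu mI) binary_digit.

Let mbits (A : set coins) : measurable A -> measurable (binary_digit @^-1` A).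
Proof. by move=> mA; rewrite -[X in measurable X]setTI; exact: measurable_binary_digit. Qed.

Let coin_measure0 : coin_measure set0 = 0%E.
Proof. by rewrite /coin_measure /pushforward preimage_set0 measure0. Qed.

Let coin_measure_ge0 A : (0 <= coin_measure A)%E.
Proof. exact: (measure_ge0 (mrestr mu mI)). Qed.

Let coin_measure_sigma_additive : semi_sigma_additive coin_measure.
Proof.
move=> F mF tF mUF; rewrite /coin_measure /pushforward preimage_bigcup.
apply: (@measure_semi_sigma_additive _ _ _ (mrestr mu mI)).
- by move=> n; exact: mbits.
- apply/trivIsetP => /= i j _ _ ij; rewrite -preimage_setI.
  by move/trivIsetP : tF => /(_ _ _ _ _ ij) ->//; rewrite preimage_set0.
- by rewrite -preimage_bigcup; exact: mbits.
Qed.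

HB.instance Definition _ := isMeasure.Build _ _ _ coin_measure
  coin_measure0 coin_measure_ge0 coin_measure_sigma_additive.

Lemma coin_measureT : coin_measure setT = 1%E.
Proof.
rewrite /coin_measure /pushforward preimage_setT /mrestr setTI.
by rewrite lebesgue_measure_itv /= lte01 oppr0 adde0.
Qed.

HB.instance Definition _ :=
  Measure_isProbability.Build _ _ _ coin_measure coin_measureT.

Lemma binary_value_lt w n : (binary_value w n < 2 ^ n)%N.
Proof.
elim: n => //= n IH; rewrite expnS mul2n.
by case: (w n) => /=; rewrite -!muln2; lia.
Qed.

Lemma coin_measure_cylinder n w : coin_measure (cylinder n w) = ((2 ^- n)%:E)%E.
Proof.
rewrite /coin_measure /pushforward /mrestr.
set k := binary_value w n.
have k2 : (k.+1%:R <= 2 ^+ n :> R) by rewrite -natrX ler_nat binary_value_lt.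
have p2 : (0 < 2 ^+ n :> R) by rewrite exprn_gt0.
rewrite (_ : _ `&` _ = `[k%:R / 2 ^+ n, k.+1%:R / 2 ^+ n[%classic).
  rewrite lebesgue_measure_itv /= lte_fin ltr_pM2r ?invr_gt0 // ltr_nat ltnSn.
  by rewrite -EFinB -mulrBl -natrB // subSnn mul1r.
apply/seteqP; split => x /=; rewrite !in_itv /=.
  case=> xw x01; move/(cylinder_binary_digit _ _ x01): xw => /eqP.
  case/andP: x01 => x0 x1.
  have nx : 0 <= 2 ^+ n * x by rewrite mulr_ge0 // ltW.
  rewrite (truncn_eq _ nx) mulrC => xk.
  by rewrite ler_pdivrMr // ltr_pdivlMr.
move=> /andP[l u].
have x0 : 0 <= x by apply: le_trans l; rewrite divr_ge0 // ltW.
have x1 : x < 1 by apply: lt_le_trans u _; rewrite ler_pdivrMr // mul1r.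
split; last by rewrite x0.
apply/cylinder_binary_digit; first by rewrite x0.
have nx : 0 <= 2 ^+ n * x by rewrite mulr_ge0 // ltW.
by apply/eqP; rewrite (truncn_eq _ nx) mulrC -ler_pdivrMr // -ltr_pdivlMr // l.
Qed.


(* Any left inverse of the digit map on [0, 1[ will do; this one has a uniform law. *)
Definition real_of_coins (v : coins) : R :=
  let x : R := limn (fun n => (binary_value v n)%:R / 2 ^+ n : R) in
  if (0 <= x < 1) then x else 0.

Lemma real_of_coins_itv v : 0 <= real_of_coins v < 1.
Proof. by rewrite /real_of_coins; case: ifP => // _; rewrite lexx ltr01. Qed.

Lemma cvg_binary_value (x : R) : 0 <= x < 1 ->
  (binary_value (binary_digit x) n)%:R / 2 ^+ n @[n --> \oo] --> x.
Proof.
move=> x01; have x0 : 0 <= x by case/andP: x01.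
have B n : x - 2 ^- n <= (binary_value (binary_digit x) n)%:R / 2 ^+ n <= x.
  have <- := iffLR (cylinder_binary_digit n (binary_digit x) x01) (fun _ _ => erefl).
  have p2 : (0 < 2 ^+ n :> R) by rewrite exprn_gt0.
  have /truncn_itv/andP[l u] : 0 <= 2 ^+ n * x by rewrite mulr_ge0 // ltW.
  rewrite ler_pdivrMr // [x * _]mulrC l andbT lerBlDr.
  rewrite [leRHS](_ : _ = (Num.truncn (2 ^+ n * x)).+1%:R / 2 ^+ n).
    by rewrite ler_pdivlMr // mulrC ltW.
  by rewrite -[X in _ = X / _]natr1 mulrDl mul1r.
apply: (squeeze_cvgr (nearW _ B)); last exact: cvg_cst.
rewrite -[X in _ --> X]subr0; apply: cvgB; first exact: cvg_cst.
under eq_fun do rewrite -exprVn; apply: cvg_expr.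
by rewrite gtr0_norm ?invr_gt0 // invf_lt1 // ltr1n.
Qed.

Lemma real_of_binary_digit (x : R) : 0 <= x < 1 ->
  real_of_coins (binary_digit x) = x.
Proof.
by move=> x01; rewrite /real_of_coins (cvg_lim _ (cvg_binary_value x01)) ?x01.
Qed.

Lemma measurable_binary_value n :
  measurable_fun [set: coins] (fun v => (binary_value v n)%:R : R).
Proof.
elim: n => /= [|n IH]; first exact: measurable_cst.
rewrite (_ : (fun _ => _) = fun v : coins =>
    2 * (binary_value v n)%:R + \1_[set v : coins | v n] v); last first.
  apply/funext => v; rewrite natrD -mul2n natrM indicE; congr (_ + _%:R).
  by apply/esym; case: (boolP (v n)) => vn; [rewrite mem_set|rewrite memNset //; apply/negP].
apply: measurable_funD; first exact: measurable_funM.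
by apply: measurable_indic; exact: measurable_coin.
Qed.

Lemma measurable_real_of_coins : measurable_fun [set: coins] real_of_coins.
Proof.
pose h n (v : coins) : R := (binary_value v n)%:R / 2 ^+ n.
have hc (v : coins) : cvgn (h ^~ v).
  apply: nondecreasing_is_cvgn.
    apply/nondecreasing_seqP => n; rewrite /h ler_pdivlMr ?exprn_gt0 //.
    rewrite exprS mulrCA divfK ?lt0r_neq0 ?exprn_gt0 //=.
    by rewrite -natrM ler_nat mul2n leq_addr.
  exists 1 => _ [n _ <-]; rewrite /h ler_pdivrMr ?exprn_gt0 // mul1r.
  by rewrite -natrX ler_nat ltnW // binary_value_lt.
have ml : measurable_fun [set: coins] (fun v => limn (h ^~ v)).
  apply: (measurable_fun_cvg (h := h)) => [n|v _]; last exact: hc.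
  by apply: measurable_funM => //; exact: measurable_binary_value.
apply: measurable_fun_if => //.
- by apply: measurable_and; apply: measurable_fun_ler || apply: measurable_fun_ltr.
- exact: measurable_funS ml.
Qed.

(** Pulled back to [[0, 1[] by the binary digits, the event contains at most the point [c]. *)
Lemma coin_measure_real_of_coins (c : R) :
  coin_measure [set v | real_of_coins v = c] = 0%E.
Proof.
rewrite /coin_measure /pushforward /mrestr.
apply/eqP; rewrite -measure_le0 /=.
apply: (@le_trans _ _ (mu [set c])); last by rewrite lebesgue_measure_set1.
apply: le_measure; rewrite ?inE //.
  apply: measurableI => //; apply: mbits.
  have := measurable_real_of_coins measurableT (measurable_set1 c).
  by rewrite setTI.
by move=> x /= [xc]; rewrite in_itv /= => x01; rewrite -xc real_of_binary_digit.
Qed.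

End coin_measure.

Lemma measurable_preimageT d d' (T1 : measurableType d) (T2 : measurableType d')
    (f : T1 -> T2) (A : set T2) :
  measurable_fun setT f -> measurable A -> measurable (f @^-1` A).
Proof. by move=> mf mA; rewrite -[X in measurable X]setTI; exact: mf. Qed.

(** Iterating this parity splitting cuts one coin sequence into infinitely many independent ones:
    block [k] is [even_coins (iter k odd_coins v)]. *)
Definition even_coins (v : coins) : coins := fun i => v i.*2.
Definition odd_coins (v : coins) : coins := fun i => v i.*2.+1.
Definition interleave (u w : coins) : coins :=
  fun i => if odd i then w i./2 else u i./2.

Lemma even_interleave u w : even_coins (interleave u w) = u.
Proof. by apply/funext => i; rewrite /even_coins /interleave odd_double doubleK. Qed.

Lemma odd_interleave u w : odd_coins (interleave u w) = w.
Proof.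
apply/funext => i; rewrite /odd_coins /interleave /= odd_double /=.
by rewrite uphalf_double.
Qed.

Lemma interleaveK v : interleave (even_coins v) (odd_coins v) = v.
Proof.
apply/funext => i; rewrite /interleave /even_coins /odd_coins.
by rewrite -[in RHS](odd_double_half i); case: (odd i).
Qed.

(** Keeps the first [n] blocks of [v] and takes all later coins from [v']. Conditioning on the first
    [n] blocks thus becomes an integral over an independent [v']. *)
Fixpoint splice n (v v' : coins) : coins :=
  if n is m.+1 then interleave (even_coins v) (splice m (odd_coins v) v')
  else v'.

Lemma iter_odd_splice n v v' : iter n odd_coins (splice n v v') = v'.
Proof.
by elim: n v => // n IH v; rewrite iterSr /= odd_interleave IH.
Qed.

Lemma even_iter_splice n v v' k : (k < n)%N ->
  even_coins (iter k odd_coins (splice n v v')) =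
  even_coins (iter k odd_coins v).
Proof.
elim: n v k => // n IH v [|k] kn; first by rewrite /= even_interleave.
by rewrite !iterSr /= odd_interleave IH.
Qed.

Lemma measurable_even_coins : measurable_fun [set: coins] even_coins.
Proof. by apply: measurable_fun_coins => i; exact: measurable_coin. Qed.

Lemma measurable_odd_coins : measurable_fun [set: coins] odd_coins.
Proof. by apply: measurable_fun_coins => i; exact: measurable_coin. Qed.

Lemma measurable_coin_comp d (T : measurableType d) (f : T -> coins) i :
  measurable_fun setT f -> measurable [set x | f x i].
Proof. by move=> mf; rewrite -[X in measurable X]setTI; apply: (mf _ [set v : coins | v i]) => //; exact: measurable_coin. Qed.

Lemma measurable_interleave d (T : measurableType d) (f g : T -> coins) :
  measurable_fun setT f -> measurable_fun setT g ->
  measurable_fun setT (fun x => interleave (f x) (g x)).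
Proof.
move=> mf mg; apply: measurable_fun_coins => i; rewrite /interleave.
by case: (odd i); exact: measurable_coin_comp.
Qed.

Lemma measurable_splice n d (T : measurableType d) (f g : T -> coins) :
  measurable_fun setT f -> measurable_fun setT g ->
  measurable_fun setT (fun x => splice n (f x) (g x)).
Proof.
elim: n f => // n IH f mf mg; apply: measurable_interleave.
  exact: measurableT_comp measurable_even_coins mf.
by apply: IH => //; exact: measurableT_comp measurable_odd_coins mf.
Qed.

Lemma measurable_iter_odd n : measurable_fun [set: coins] (fun v : coins => iter n odd_coins v : coins).
Proof.
elim: n => [|n IH]; first exact: measurable_id.
exact: (measurableT_comp measurable_odd_coins IH).
Qed.

(** * Resampling of blocks, independent uniform draws *)

Section coin_laws.
Context {R : realType}.
Local Notation mu := (@coin_measure R).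
Local Open Scope ereal_scope.

Lemma interleave_cylinder m w u v : cylinder m w (interleave u v) <->
  cylinder (uphalf m) (even_coins w) u /\ cylinder m./2 (odd_coins w) v.
Proof.
split=> [H|[Hu Hv] i im].
  split=> i im; [rewrite -(even_interleave u v)|rewrite -(odd_interleave u v)].
    by rewrite /even_coins H //; lia.
  by rewrite /odd_coins H //; lia.
rewrite -[i]odd_double_half /interleave; case: (boolP (odd i)) => oi /=.
  by rewrite odd_double /= uphalf_double Hv //; lia.
by rewrite add0n odd_double doubleK Hu //; lia.
Qed.

(** A cylinder of length [n] is a product of cylinders of lengths [uphalf n] and [n./2], whose sum
    is [n]; agreement on cylinders is enough. *)
Lemma interleave_law (D : set coins) : measurable D ->
  (mu \x mu) [set z | D (interleave z.1 z.2)] = mu D.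
Proof.
move=> mD; pose c (z : coins * coins) := interleave z.1 z.2.
have mc : measurable_fun setT c.
  by apply: measurable_interleave; [exact: measurable_fst|exact: measurable_snd].
apply/esym; apply: (@measure_unique _ _ coins cylinders (fun=> setT)
  _ _ _ _ mu (image_measure (mu \x mu) mc)) => //.
- exact: setI_closed_cylinders.
- by move=> _; right; exists 0%N, xpredT; apply/seteqP; split.
- by rewrite bigcup_const.
- move=> A [->|[n [w ->]]]; first by rewrite !measure0.
  rewrite [LHS]coin_measure_cylinder /image_measure /= /pushforward.
  rewrite (_ : c @^-1` _ =
    cylinder (uphalf n) (even_coins w) `*` cylinder n./2 (odd_coins w)); last first.
    by apply/seteqP; split => z /interleave_cylinder.
  rewrite product_measure1E; [|exact: measurable_cylinder|exact: measurable_cylinder].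
  rewrite /= !coin_measure_cylinder -EFinM -invfM -exprD.
  by rewrite uphalf_half -addnA addnn odd_double_half.
- by move=> k; rewrite /= coin_measureT ltry.
Qed.

Lemma ge0_integral_interleave (f : coins -> \bar R) :
  measurable_fun setT f -> (forall v, 0 <= f v) ->
  \int[mu]_v f v = \int[mu]_u \int[mu]_w f (interleave u w).
Proof.
move=> mf f0.
have mc : measurable_fun setT (fun z : coins * coins => interleave z.1 z.2).
  by apply: measurable_interleave; [exact: measurable_fst|exact: measurable_snd].
transitivity (\int[image_measure (mu \x mu) mc]_v f v).
  by apply: eq_measure_integral => D mD _; rewrite -[LHS]interleave_law.
rewrite (ge0_integral_pushforward mc) //.
by rewrite (fubini_tonelli1 (f \o _)) // => [|z]; [exact: measurableT_comp mf mc|exact: f0].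
Qed.

Lemma ge0_integral_split (F : coins * coins -> \bar R) :
  measurable_fun setT F -> (forall z, 0 <= F z) ->
  \int[mu]_v F (even_coins v, odd_coins v) = \int[mu]_u \int[mu]_w F (u, w).
Proof.
move=> mF F0; rewrite ge0_integral_interleave => [||v]; last exact: F0.
  apply: eq_integral => u _; apply: eq_integral => w _.
  by rewrite even_interleave odd_interleave.
apply: (measurableT_comp mF); apply/measurable_fun_pairP; split.
  exact: measurable_even_coins.
exact: measurable_odd_coins.
Qed.

(** Given the first [n] blocks, the remaining coins are a fresh fair sequence. The induction peels
    off one block by [interleave_law] and resamples inside the odd half. *)
Lemma ge0_integral_splice n (f : coins -> \bar R) :
  measurable_fun setT f -> (forall v, 0 <= f v) ->
  \int[mu]_v f v = \int[mu]_v \int[mu]_w f (splice n v w).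
Proof.
elim: n f => [|n IH] f mf f0.
  rewrite [RHS](_ : _ = \int[mu]_v cst (\int[mu]_w f w) v) //.
  by rewrite integral_cst ?measurableT //= coin_measureT mule1.
pose F (z : coins * coins) := \int[mu]_w f (interleave z.1 (splice n z.2 w)).
have mF : measurable_fun setT F.
  apply: (@measurable_fun_fubini_tonelli_F _ _ (coins * coins)%type coins R mu
    (fun p => f (interleave p.1.1 (splice n p.1.2 p.2)))) => [|p]; last exact: f0.
  apply: (measurableT_comp mf); apply: measurable_interleave.
    exact: measurableT_comp measurable_fst measurable_fst.
  apply: measurable_splice; last exact: measurable_snd.
  exact: measurableT_comp measurable_snd measurable_fst.
transitivity (\int[mu]_v F (even_coins v, odd_coins v)) => [|//].
rewrite ge0_integral_split // => [|z]; last by apply: integral_ge0 => w _; exact: f0.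
rewrite ge0_integral_interleave //; apply: eq_integral => u _.
rewrite (IH (fun w => f (interleave u w))); [by []| |by move=> v; exact: f0].
have mi : measurable_fun [set: coins] (fun w : coins => interleave u w).
  apply: (@measurable_interleave _ coins (fun=> u) id).
    exact: measurable_cst.
  exact: measurable_id.
exact: (measurableT_comp mf mi).
Qed.

Lemma coin_measure_splice n (D : set coins) : measurable D ->
  mu D = \int[mu]_v mu [set w | D (splice n v w)].
Proof.
move=> mD; transitivity (\int[mu]_v (\1_D v)%:E).
  by rewrite integral_indic // setIT.
rewrite (ge0_integral_splice n) => [||v]; last by rewrite lee_fin.
  apply: eq_integral => v _.
  rewrite (eq_integral (fun w => (\1_[set w | D (splice n v w)] w)%:E)) => [|w _].
    rewrite integral_indic // ?setIT //.
    have mv : measurable_fun [set: coins] (fun _ : coins => v) by exact: measurable_cst.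
    exact: (measurable_preimageT (measurable_splice n mv (@measurable_id _ coins setT)) mD).
  by rewrite !indicE.
by apply/measurable_EFinP; exact: measurable_indic.
Qed.

Lemma coin_measure_even (D : set coins) : measurable D ->
  mu (even_coins @^-1` D) = mu D.
Proof.
move=> mD; have mE : measurable (even_coins @^-1` D).
  by rewrite -[X in measurable X]setTI; exact: measurable_even_coins.
rewrite -interleave_law // (_ : [set _ | _] = D `*` setT).
  by rewrite product_measure1E //= coin_measureT mule1.
apply/seteqP; split => -[u w] /=; rewrite /preimage /= even_interleave //.
by case.
Qed.

Lemma coin_measure_odd (D : set coins) : measurable D ->
  mu (odd_coins @^-1` D) = mu D.
Proof.
move=> mD; have mE : measurable (odd_coins @^-1` D).
  by rewrite -[X in measurable X]setTI; exact: measurable_odd_coins.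
rewrite -interleave_law // (_ : [set _ | _] = setT `*` D).
  by rewrite product_measure1E //= coin_measureT mul1e.
apply/seteqP; split => -[u w] /=; rewrite /preimage /= odd_interleave //.
by case.
Qed.

Lemma coin_measure_iter_odd n (D : set coins) : measurable D ->
  mu (iter n odd_coins @^-1` D) = mu D.
Proof.
move=> mD; elim: n => [//|n IH].
rewrite (_ : _ @^-1` D = iter n odd_coins @^-1` (odd_coins @^-1` D)) //.
have mE k : measurable (iter k odd_coins @^-1` D).
  by rewrite -[X in measurable X]setTI; exact: measurable_iter_odd.
rewrite -IH -(coin_measure_odd (mE n)); congr (mu _).
by apply/seteqP; split => v; rewrite /preimage /= -iterS -iterSr.
Qed.

Definition draw k (v : coins) : R := real_of_coins (even_coins (iter k odd_coins v)).

Lemma draw_itv k v : (0 <= draw k v < 1)%R.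
Proof. exact: real_of_coins_itv. Qed.

Lemma measurable_draw k : measurable_fun [set: coins] (draw k).
Proof.
apply: measurableT_comp measurable_real_of_coins _.
exact: measurableT_comp measurable_even_coins (measurable_iter_odd k).
Qed.

Lemma draw_iter k n v : draw k (iter n odd_coins v) = draw (n + k) v.
Proof. by rewrite /draw -iterD addnC. Qed.

Lemma draw_splice n v w k : draw k (splice n v w) =
  if (k < n)%N then draw k v else draw (k - n) w.
Proof.
case: ltnP => kn; first by rewrite /draw even_iter_splice.
by rewrite -(subnKC kn) -draw_iter iter_odd_splice addKn.
Qed.

Lemma coin_measure_draw k (c : R) : mu [set v | draw k v = c] = 0.
Proof.
have mc : measurable [set v : coins | real_of_coins v = c].
  have := measurable_real_of_coins measurableT (measurable_set1 c).
  by rewrite setTI.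
rewrite -(coin_measure_real_of_coins c) -(coin_measure_even mc).
by rewrite -(coin_measure_iter_odd k (measurable_preimageT measurable_even_coins mc)).
Qed.

(** Once the first [j.+1] blocks are frozen, [draw j] is a constant, and the fresh [draw k] has no
    atom. *)
Lemma coin_measure_draw_eq j k : (j < k)%N -> mu [set v | draw j v = draw k v] = 0.
Proof.
move=> jk; rewrite (coin_measure_splice j.+1); last first.
  rewrite -[X in measurable X]setTI.
  have := measurable_fun_eqr (measurable_draw j) (measurable_draw k).
  move=> /(_ measurableT [set true] I).
  by congr measurable; apply/seteqP; split => v /= [_ /eqP].
rewrite integral0_eq // => v _.
rewrite (_ : [set _ | _] = [set w | draw (k - j.+1) w = draw j v]).
  exact: coin_measure_draw.
have E w : draw j (splice j.+1 v w) = draw k (splice j.+1 v w) <-> draw (k - j.+1) w = draw j v.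
  by rewrite !draw_splice ltnSn ltnNge jk /=; split.
by apply/seteqP; split => w /=; rewrite E.
Qed.

End coin_laws.

(** * The torus, represented by [0, 1[^3 *)

Section circle_distance.
Context {R : realFieldType}.
Implicit Types a b c : R.

(** The arc distance on the circle of circumference 1, for representatives in [[0, 1[]. *)
Definition carc a b := Num.min `|a - b| (1 - `|a - b|).

Lemma carcxx a : carc a a = 0.
Proof. by rewrite /carc subrr normr0 subr0 /Num.min ltr01. Qed.

Lemma carcC a b : carc a b = carc b a.
Proof. by rewrite /carc distrC. Qed.

Lemma carc_le a b : carc a b <= `|a - b|.
Proof. by rewrite /carc ge_min lexx. Qed.

Lemma carc_ge0 a b : 0 <= a < 1 -> 0 <= b < 1 -> 0 <= carc a b.
Proof.
move=> /andP[a0 a1] /andP[b0 b1]; rewrite /carc le_min normr_ge0 /=.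
by rewrite subr_ge0 ler_norml; apply/andP; split; lra.
Qed.

Lemma carc_eq0 a b : 0 <= a < 1 -> 0 <= b < 1 -> carc a b = 0 -> a = b.
Proof.
move=> /andP[a0 a1] /andP[b0 b1]; rewrite /carc.
by case: (ger0P (a - b)) => ?; case: ltrP => *; lra.
Qed.

Lemma carc_triangle b a c : 0 <= a < 1 -> 0 <= b < 1 -> 0 <= c < 1 ->
  carc a c <= carc a b + carc b c.
Proof.
move=> /andP[a0 a1] /andP[b0 b1] /andP[c0 c1]; rewrite /carc.
have h1 := ler_distD b a c; have h2 := ler_distD c a b.
have h3 := ler_distD a b c; rewrite (distrC c b) in h2; rewrite (distrC b a) in h3.
(* The perimeter of three points of the unit interval is at most 2; this settles the case where both
   arcs ending at [b] pass through the cut. *)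
have h4 : `|a - b| + `|b - c| + `|a - c| <= 2.
  case: (ger0P (a - b)) => ?; case: (ger0P (b - c)) => ?;
  by case: (ger0P (a - c)) => ?; lra.
move: h1 h2 h3 h4; move: `|a - b| `|b - c| `|a - c| => p q r h1 h2 h3 h4.
by rewrite ge_min; case: (leP p (1 - p)) => ?; case: (leP q (1 - q)) => ?;
  apply/orP; solve [left; lra | right; lra].
Qed.

(* The two sides of the cut at [0] are far from [a]. *)
Lemma carc_gt x a b : 0 <= x -> 0 <= a < 1 -> 0 <= b < 1 -> x < a ->
  carc a b < a - x -> carc a b < 1 - a -> x < b.
Proof.
move=> x0 /andP[a0 a1] /andP[b0 b1]; rewrite /carc.
by case: (leP `|a - b| (1 - `|a - b|)); case: (ger0P (a - b)) => *; lra.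
Qed.

Lemma carc_wrap a : 0 <= a < 1 -> carc a 0 <= 1 - a.
Proof.
by move=> /andP[a0 a1]; rewrite /carc subr0 (ger0_norm a0) ge_min lexx orbT.
Qed.

End circle_distance.

Definition box (R : realType) (p : R * R * R) :=
  [&& 0 <= p.1.1 < 1, 0 <= p.1.2 < 1 & 0 <= p.2 < 1].

Definition state (R : realType) := {p : R * R * R | box p}.

HB.instance Definition _ (R : realType) :=
  SubChoice.copy (state R) {p : R * R * R | box p}.

(** * Metric and Borel structure of the torus *)

Section state_space.
Context {R : realType}.
Local Notation S := (state R).

Lemma box0 : box ((0, 0, 0) : R * R * R).
Proof. by rewrite /box lexx ltr01. Qed.

Definition mk (p : R * R * R) : S := insubd (Sub (0, 0, 0) box0 : S) p.

Lemma mkK p : box p -> val (mk p) = p.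
Proof. by move=> bp; rewrite /mk insubdK. Qed.

Definition cur (s : S) : R := (val s).1.1.
Definition nxt (s : S) : R := (val s).1.2.
Definition phase (s : S) : R := (val s).2.

Lemma cur_itv s : 0 <= cur s < 1. Proof. by case/and3P: (valP s). Qed.
Lemma nxt_itv s : 0 <= nxt s < 1. Proof. by case/and3P: (valP s). Qed.
Lemma phase_itv s : 0 <= phase s < 1. Proof. by case/and3P: (valP s). Qed.

Definition tdist (s t : S) : R :=
  carc (cur s) (cur t) + carc (nxt s) (nxt t) + carc (phase s) (phase t).

Let tdistxx s : tdist s s = 0.
Proof. by rewrite /tdist !carcxx !addr0. Qed.

Let c0 s t := carc_ge0 (cur_itv s) (cur_itv t).
Let n0 s t := carc_ge0 (nxt_itv s) (nxt_itv t).
Let p0 s t := carc_ge0 (phase_itv s) (phase_itv t).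

Let tdist_positivity s t : tdist s t = 0 -> s = t.
Proof.
have := c0 s t; have := n0 s t; have := p0 s t; rewrite /tdist => P N C E.
apply: val_inj; rewrite [LHS]surjective_pairing [RHS]surjective_pairing.
rewrite [(val s).1]surjective_pairing [(val t).1]surjective_pairing.
congr (_, _, _).
- by apply: carc_eq0 (cur_itv s) (cur_itv t) _; lra.
- by apply: carc_eq0 (nxt_itv s) (nxt_itv t) _; lra.
- by apply: carc_eq0 (phase_itv s) (phase_itv t) _; lra.
Qed.

Lemma tdist_sym s t : tdist s t = tdist t s.
Proof. by rewrite /tdist; congr (_ + _ + _); exact: carcC. Qed.

Lemma tdist_triangle t s u : tdist s u <= tdist s t + tdist t u.
Proof.
have := carc_triangle (cur_itv s) (cur_itv t) (cur_itv u).
have := carc_triangle (nxt_itv s) (nxt_itv t) (nxt_itv u).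
have := carc_triangle (phase_itv s) (phase_itv t) (phase_itv u).
by rewrite /tdist => *; lra.
Qed.

HB.instance Definition _ := isMetric.Build R S
  tdistxx tdist_positivity tdist_sym tdist_triangle.
HB.instance Definition _ := isPointed.Build S (mk (0, 0, 0)).

Lemma ballE_tdist (s t : S) e : ball s e t <-> tdist s t < e.
Proof. by rewrite ballEmdist. Qed.

Lemma open_ballP (U : set S) :
  open U <-> forall s, U s -> exists2 e, 0 < e & forall t, tdist s t < e -> U t.
Proof.
rewrite openE; split=> H s /H.
  by move=> /nbhs_ballP[e e0 eU]; exists e => // t st; apply: eU; apply/ballE_tdist.
by case=> e e0 eU; apply/nbhs_ballP; exists e => // t /ballE_tdist; exact: eU.
Qed.

Lemma cvg_tdistP (T : Type) (F : set_system T) {FF : Filter F} (f : T -> S) (l : S) :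
  f @ F --> l <-> forall e, 0 < e -> \forall t \near F, tdist l (f t) < e.
Proof.
split=> [fl e e0|H].
  have : nbhs l (ball l e) by exact: nbhsx_ballx.
  by move=> /fl; apply: (@filterS _ F) => t /ballE_tdist.
move=> A /nbhs_ballP[e e0 eA]; apply: filterS (H _ e0) => t lt.
by apply: eA; apply/ballE_tdist.
Qed.

Let w (x : R) := if x < 1 then x else 0.

Let w_itv x : 0 <= x <= 1 -> 0 <= w x < 1.
Proof. by rewrite /w => /andP[? ?]; case: ltrP; lra. Qed.

Let carc_w x y : 0 <= x <= 1 -> 0 <= y < 1 -> carc (w x) y <= `|x - y|.
Proof.
move=> /andP[x0 x1] /andP[y0 y1]; rewrite /w; case: ltrP => x1'.
  exact: carc_le.
have -> : x = 1 by lra.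
rewrite carcC (le_trans (carc_wrap _)) ?y0 //.
by rewrite ler_norm.
Qed.

(** A cluster point exists in the closed cube. Wrapping its coordinates 1 to 0 does not increase the
    distance to points of the torus, by [carc_w], so the wrapped point is a cluster point there. *)
Lemma compact_state : compact [set: S].
Proof.
pose K := (`[0, 1]%classic `*` `[0, 1]%classic `*` `[0, 1]%classic : set (R * R * R)).
have cK : compact K.
  by apply: compact_setX; [apply: compact_setX|]; exact: segment_compact.
move=> F PF _; pose v (s : S) := val s.
have GK : (v @ F) K.
  have : F setT by exact: filterT.
  apply: (@filterS _ F) => s _; rewrite /K /v /=.
  have /andP[a1 a2] := cur_itv s; have /andP[b1 b2] := nxt_itv s.
  have /andP[c1 c2] := phase_itv s.
  by split; [split|]; rewrite /= in_itv /=; apply/andP; split => //; exact: ltW.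
have [q [Kq qF]] := cK _ _ GK.
case: q Kq qF => [[q1 q2] q3]; rewrite /K /= !in_itv /= => -[[k1 k2] k3] qF.
pose s := mk (w q1, w q2, w q3).
have vs : val s = (w q1, w q2, w q3) by rewrite mkK // /box /= !w_itv.
exists s; split => // A B FA /nbhs_ballP[e e0 eB].
have e3 : 0 < e / 3 by rewrite divr_gt0.
have [||_ [[t At <-]]] := qF (v @` A) (ball (q1, q2, q3) (e / 3)).
- by move: FA; apply: (@filterS _ F) => t At; exists t.
- exact: nbhsx_ballx.
case=> -[/= b1 b2] b3; exists t; split=> //; apply: eB; apply/ballE_tdist.
have := carc_w k1 (cur_itv t); have := carc_w k2 (nxt_itv t).
have := carc_w k3 (phase_itv t).
rewrite /ball /= in b1 b2 b3.
by rewrite /tdist /cur /nxt /phase vs /= -/(v t) => *; lra.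
Qed.

Definition rational_state (q : rat * rat * rat) : S :=
  mk (ratr q.1.1, ratr q.1.2, ratr q.2).

Let rat_near (x e : R) : 0 <= x < 1 -> 0 < e ->
  exists q : rat, 0 <= (ratr q : R) < 1 /\ `|x - ratr q| < e.
Proof.
move=> /andP[x0 x1] e0.
have : x < Num.min 1 (x + e) by rewrite lt_min x1 ltrDl.
move=> /rat_in_itvoo[q]; rewrite in_itv /= lt_min => /andP[xq /andP[q1 qe]].
exists q; split; first by rewrite q1 (le_trans x0) // ltW.
by rewrite ltr_norml; apply/andP; split; lra.
Qed.

Lemma rational_state_dense (s : S) e : 0 < e ->
  exists q, tdist s (rational_state q) < e.
Proof.
move=> e0; have e3 : 0 < e / 3 by rewrite divr_gt0.
have [q1 [b1 d1]] := rat_near (cur_itv s) e3.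
have [q2 [b2 d2]] := rat_near (nxt_itv s) e3.
have [q3 [b3 d3]] := rat_near (phase_itv s) e3.
exists (q1, q2, q3); rewrite /tdist {2}/cur {2}/nxt {2}/phase /rational_state.
rewrite mkK /=; last by rewrite /box /= b1 b2 b3.
have := carc_le (cur s) (ratr q1); have := carc_le (nxt s) (ratr q2).
by have := carc_le (phase s) (ratr q3); lra.
Qed.

Lemma separable_state : separable S.
Proof.
exists (range rational_state).
  exact: sub_countable (card_image_le _ _) (countableP _).
move=> U [s Us] /open_ballP/(_ _ Us)[e e0 eU].
have [q qs] := rational_state_dense s e0.
by exists (rational_state q); split; [exact: eU|exists q].
Qed.

Local Notation BS := (borel S).

(** Coordinates are discontinuous at the cut, but lower semicontinuous: they only drop to 0 where
    the circle is cut, as the least value. So [x < c s] is an open condition on [s]. *)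
Lemma measurable_coordinate (c : S -> R) :
  (forall s, 0 <= c s < 1) -> (forall s t, carc (c s) (c t) <= tdist s t) ->
  measurable_fun [set: BS] (c : BS -> R).
Proof.
move=> c01 cd; apply: (measurability _ (RGenOInfty.measurableE R)).
move=> _ [_ [x ->] <-]; rewrite setTI; apply: sub_sigma_algebra.
have [x0|x0] := leP 0 x; last first.
  rewrite (_ : _ @^-1` _ = setT); first exact: openT.
  apply/seteqP; split => // s _; rewrite /preimage /= in_itv /= andbT.
  by apply: lt_le_trans x0 _; case/andP: (c01 s).
apply/open_ballP => s; rewrite /preimage /= in_itv /= andbT => xs.
exists (Num.min (c s - x) (1 - c s)).
  by rewrite lt_min !subr_gt0 xs; case/andP: (c01 s).
move=> t; rewrite lt_min => /andP[d1 d2]; rewrite /preimage /= in_itv /= andbT.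
by apply: (@carc_gt _ x (c s)) => //; exact: le_lt_trans (cd s t) _.
Qed.

Lemma measurable_cur : measurable_fun [set: BS] (cur : BS -> R).
Proof.
apply: measurable_coordinate cur_itv _ => s t; rewrite /tdist.
by have := n0 s t; have := p0 s t; lra.
Qed.

Lemma measurable_nxt : measurable_fun [set: BS] (nxt : BS -> R).
Proof.
apply: measurable_coordinate nxt_itv _ => s t; rewrite /tdist.
by have := c0 s t; have := p0 s t; lra.
Qed.

Lemma measurable_phase : measurable_fun [set: BS] (phase : BS -> R).
Proof.
apply: measurable_coordinate phase_itv _ => s t; rewrite /tdist.
by have := c0 s t; have := n0 s t; lra.
Qed.

Lemma measurable_carc d (T : measurableType d) (f : T -> R) (a : R) :
  measurable_fun setT f -> measurable_fun setT (fun x => carc a (f x)).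
Proof.
move=> mf.
have mn : measurable_fun setT (fun x => `|a - f x|).
  by apply: measurableT_comp; [exact: normr_measurable|exact: measurable_funB].
by apply: measurable_minr => //; exact: measurable_funB.
Qed.

(** By separability an open set is the countable union of the balls with rational centre and radius
    that it contains; the [if] selects these balls. *)
Lemma measurable_fun_tdist d (T : measurableType d) (f : T -> BS) :
  (forall s, measurable_fun setT (fun x => tdist s (f x))) ->
  measurable_fun setT f.
Proof.
move=> md; apply: (@measurability _ _ _ BS _ _ (@open S)) => // _ [U oU <-].
rewrite setTI (_ : f @^-1` U = \bigcup_(q in [set: rat * rat * rat * rat])
  if `[< forall t, tdist (rational_state q.1) t < ratr q.2 -> U t >] then
    [set x | tdist (rational_state q.1) (f x) < ratr q.2] else set0).
  apply: countable_bigcupT_measurable => [|q]; first exact: countableP.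
  case: ifP => _; last exact: measurable0.
  rewrite -[X in measurable X]setTI.
  have := measurable_fun_ltr (md (rational_state q.1)) (measurable_cst (ratr q.2 : R)).
  by move=> /(_ measurableT [set true] I).
apply/seteqP; split => [x Ux|x [q _]]; last by case: asboolP => // + ?; exact.
move/open_ballP: oU => /(_ _ Ux)[e e0 eU].
have [r rlt] : exists r : rat, 0 < (ratr r : R) < e / 2.
  have /rat_in_itvoo[r] : 0 < e / 2 by rewrite divr_gt0.
  by rewrite in_itv; exists r.
move: rlt => /andP[r0 re].
have [q qs] := rational_state_dense (f x) r0.
exists (q, r) => //=; case: asboolP; first by move=> _; rewrite /= tdist_sym.
case=> t qt; apply: eU; apply: le_lt_trans (tdist_triangle (rational_state q) _ _) _.
by lra.
Qed.

Lemma measurable_fun_state d (T : measurableType d) (f : T -> BS) :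
  measurable_fun setT (fun x => cur (f x)) ->
  measurable_fun setT (fun x => nxt (f x)) ->
  measurable_fun setT (fun x => phase (f x)) ->
  measurable_fun setT f.
Proof.
move=> m1 m2 m3; apply: measurable_fun_tdist => s.
by do 2?apply: measurable_funD; exact: measurable_carc.
Qed.

Lemma measurable_tdist s : measurable_fun [set: BS] (tdist s : BS -> R).
Proof.
do 2?apply: measurable_funD; apply: measurable_carc.
- exact: measurable_cur.
- exact: measurable_nxt.
- exact: measurable_phase.
Qed.

End state_space.

(** * Factorial expansions and walks *)

Section factorial_series.
Context {R : realType}.
Implicit Types (h : nat -> bool) (x y : R).

Definition fact_sum h n : R := \sum_(j < n) (h j)%:R / (j.+1)`!%:R.
Definition fact_series h : R := limn (fact_sum h).

Lemma fact_sumS h n : fact_sum h n.+1 = fact_sum h n + (h n)%:R / (n.+1)`!%:R.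
Proof. by rewrite /fact_sum big_ord_recr. Qed.

Lemma fact_sum_nondecreasing h : nondecreasing_seq (fact_sum h).
Proof.
apply/nondecreasing_seqP => n; rewrite fact_sumS lerDl divr_ge0 //.
Qed.

(* Telescoping [1/(j+1)! <= 2/(j+1)! - 2/(j+2)!]. *)
Lemma fact_sum_tail h i n : (i <= n)%N ->
  fact_sum h n <= fact_sum h i + 2 / (i.+1)`!%:R - 2 / (n.+1)`!%:R.
Proof.
elim: n => [|n IH]; first by rewrite leqn0 => /eqP ->; lra.
rewrite leq_eqVlt => /predU1P[->|]; first by lra.
rewrite ltnS => /IH; rewrite fact_sumS.
set u := (n.+1)`!%:R^-1 : R.
have u0 : 0 < u by rewrite invr_gt0.
have -> : (n.+2)`!%:R^-1 = u / n.+2%:R :> R.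
  by rewrite factS natrM invfM mulrC.
have : u / n.+2%:R <= u / 2.
  by rewrite ler_pM2l // lef_pV2 ?posrE ?ltr0n // ler_nat.
have : (h n)%:R * u <= u by case: (h n); rewrite ?mul1r ?mul0r // ltW.
move: (_ * u) => a; move: (u / _) => b; lra.
Qed.

Lemma cvg_fact_sum h : cvgn (fact_sum h).
Proof.
apply: nondecreasing_is_cvgn; first exact: fact_sum_nondecreasing.
exists (fact_sum h 0 + 2 / 1`!%:R) => _ [n _ <-].
have := fact_sum_tail h (leq0n n); have : 0 <= 2 / (n.+1)`!%:R :> R.
  by rewrite divr_ge0.
lra.
Qed.

Lemma fact_series_ge h i : fact_sum h i <= fact_series h.
Proof.
apply: nondecreasing_cvgn_le; [exact: fact_sum_nondecreasing|exact: cvg_fact_sum].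
Qed.

Lemma fact_series_le h i : fact_series h <= fact_sum h i + 2 / (i.+1)`!%:R.
Proof.
apply: limr_le; first exact: cvg_fact_sum.
near=> n; have ni : (i <= n)%N by near: n; exact: nbhs_infty_ge.
have := fact_sum_tail h ni; have : 0 <= 2 / (n.+1)`!%:R :> R by rewrite divr_ge0.
lra.
Unshelve. all: by end_near. Qed.

(** Horner's scheme for the integer numerator of the partial sum over the denominator [n!]. *)
Fixpoint fact_num h n : nat :=
  if n is m.+1 then (n * fact_num h m + h m)%N else 0%N.

Lemma fact_numE h n : n`!%:R * fact_sum h n = (fact_num h n)%:R.
Proof.
elim: n => [|n IH]; first by rewrite /fact_sum big_ord0 mulr0.
rewrite fact_sumS mulrDr mulrCA divff ?lt0r_neq0 // mulr1.
by rewrite factS natrM -mulrA IH /= natrD natrM.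
Qed.

(** The digit of weight [1 / (i.+1)!] in the factorial (Cantor) expansion, kept as a real number so
    that it can serve as the value of a flow. *)
Definition digit (i : nat) x : R :=
  (Num.floor ((i.+1)`!%:R * x))%:~R - i.+1%:R * (Num.floor (i`!%:R * x))%:~R.

Lemma digit_ge0 i x : 0 <= digit i x.
Proof.
rewrite /digit subr_ge0 pmulrn -intrM ler_int floor_ge_int_tmp factS natrM rmorphM /= -mulrA.
by rewrite ler_pM2l ?ltr0n // floor_le_tmp.
Qed.

Definition frac i x : R := i`!%:R * x - (Num.floor (i`!%:R * x))%:~R.

Lemma frac_itv i x : 0 <= frac i x < 1.
Proof.
have /andP[l u] := floor_itv (i`!%:R * x).
by rewrite /frac; move: l u; rewrite intrD /=; move: (_%:~R) => f *; lra.
Qed.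

(** Digits become negligible compared with their radix; this is what excludes carries in sums. *)
Definition lacunary x := frac n x @[n --> \oo] --> 0.

(** As soon as both fractional parts are below 1/2, integer parts add; a digit compares the integer
    parts at two consecutive indices. *)
Lemma lacunaryD x y : lacunary x -> lacunary y ->
  lacunary (x + y) /\ \forall i \near \oo, digit i (x + y) = digit i x + digit i y.
Proof.
move=> lx ly.
have E : \forall i \near \oo, Num.floor (i`!%:R * (x + y)) =
    Num.floor (i`!%:R * x) + Num.floor (i`!%:R * y).
  near=> i; have fx : frac i x < 1 / 2.
    by near: i; apply: cvgr_lt lx _ _; lra.
  have fy : frac i y < 1 / 2.
    by near: i; apply: cvgr_lt ly _ _; lra.
  apply/eqP; rewrite floor_eq // mulrDr !intrD.
  have := frac_itv i x; have := frac_itv i y; move: fx fy; rewrite /frac.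
  move: (_%:~R) (_%:~R) => a b *; apply/andP; split; lra.
split.
  have : frac n x + frac n y @[n --> \oo] --> (0 + 0 : R) by exact: cvgD.
  rewrite addr0; apply: cvg_trans; apply: near_eq_cvg; near=> i.
  have -> // : frac i (x + y) = frac i x + frac i y.
  rewrite /frac (near E i) // intrD mulrDr; lra.
have [N _ NE] := E; near=> i; have iN : (N <= i)%N by near: i; exact: nbhs_infty_ge.
rewrite /digit (NE i) // (NE i.+1) //; last exact: leqW.
by rewrite !intrD mulrDr opprD addrACA.
Unshelve. all: by end_near. Qed.

Lemma fact_series_frac h i : (2 <= i)%N ->
  Num.floor (i`!%:R * (1 + fact_series h)) = (i`! + fact_num h i)%N%:Z /\
  frac i (1 + fact_series h) <= 2 / i.+1%:R.
Proof.
move=> i2.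
have B : (i`! + fact_num h i)%N%:R <= i`!%:R * (1 + fact_series h) <=
    (i`! + fact_num h i)%N%:R + 2 / i.+1%:R.
  rewrite natrD -fact_numE mulrDr mulr1 -addrA !lerD2l.
  rewrite ler_pM2l // fact_series_ge /=.
  have -> : 2 / i.+1%:R = i`!%:R * (2 / (i.+1)`!%:R) :> R.
    rewrite factS natrM invfM mulrCA; congr (2 * _).
    by rewrite mulrC divfK // lt0r_neq0.
  by rewrite -mulrDr ler_pM2l // fact_series_le.
(* This is where index 2 comes from: from there on the tail is below 1 and cannot affect the
   floor. *)
have L : 2 / i.+1%:R < 1 :> R by rewrite ltr_pdivrMr ?ltr0n // mul1r ltr_nat.
have E : Num.floor (i`!%:R * (1 + fact_series h)) = (i`! + fact_num h i)%N%:Z.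
  apply/eqP; rewrite floor_eq // intrD; move: B L.
  move: (2 / _) (_ * _) => a b /andP[B1 B2] L; apply/andP; split; rewrite -?pmulrn //.
  lra.
by split=> //; rewrite /frac E -pmulrn lerBlDl; case/andP: B.
Qed.

Lemma lacunary_fact_series h : lacunary (1 + fact_series h) /\
  forall i, (2 <= i)%N -> digit i (1 + fact_series h) = (h i : nat)%:R.
Proof.
split; last first.
  move=> i i2; rewrite /digit (fact_series_frac h i2).1.
  rewrite (fact_series_frac h (leqW i2)).1 -!pmulrn /= factS !natrD !natrM; ring.
apply: (@squeeze_cvgr _ _ _ _ (fun=> 0) (fun n => 2 / n.+1%:R)).
- near=> i; rewrite (fact_series_frac h _).2 ?andbT; last first.
    by near: i; exact: nbhs_infty_ge.
  by case/andP: (frac_itv i (1 + fact_series h)).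
- exact: cvg_cst.
- rewrite -(mulr0 2); apply: cvgMr; exact: cvg_harmonic.
Unshelve. all: by end_near. Qed.

End factorial_series.

(** * Walks without repetition and unit flows *)

Section walks.
Context {T : eqType}.
Implicit Types (x u v : T) (p a b A : seq T).

Fixpoint edges x p : seq (T * T) :=
  if p is y :: q then (x, y) :: edges y q else [::].

Lemma edges_cat x a v b :
  edges x (a ++ v :: b) = edges x a ++ (last x a, v) :: edges v b.
Proof. by elim: a x => //= y a IH x; rewrite IH. Qed.

Lemma mem_edges x p e : e \in edges x p -> (e.1 \in x :: p) && (e.2 \in p).
Proof.
elim: p x => //= y p IH x; rewrite inE => /predU1P[->|/IH/andP[h1 h2]] /=.
  by rewrite eqxx mem_head.
by rewrite h1 orbT in_cons h2 orbT.
Qed.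

Lemma edgesP x p e : e \in edges x p ->
  exists a b, p = a ++ e.2 :: b /\ e.1 = last x a.
Proof.
elim: p x => //= y p IH x; rewrite inE => /predU1P[->|/IH[a [b [-> ->]]]].
  by exists [::], p.
by exists (y :: a), b.
Qed.

Lemma snd_edges x p : map snd (edges x p) = p.
Proof. by elim: p x => //= y p IH x; rewrite IH. Qed.

Lemma sum_edges_telescope (V : zmodType) (f : T -> V) x p :
  \sum_(e <- edges x p) (f e.2 - f e.1) = f (last x p) - f x.
Proof.
elim: p x => [|y p IH] x /=; first by rewrite big_nil subrr.
by rewrite big_cons IH /= addrC addrA subrK.
Qed.

End walks.

Lemma map_edges (T T' : eqType) (f : T -> T') x p :
  edges (f x) (map f p) = map (fun e => (f e.1, f e.2)) (edges x p).
Proof. by elim: p x => //= y p IH x; rewrite IH. Qed.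

Definition grid (n : nat) : seq (nat * nat) :=
  [seq (k, l) | k <- iota 0 n, l <- iota 0 n].

Lemma mem_grid n e : (e \in grid n) = (e.1 < n)%N && (e.2 < n)%N.
Proof.
apply/allpairsP/andP => [[[k l] /= [+ + ->]]|[e1 e2]].
  by rewrite !mem_iota !add0n.
by exists e; rewrite !mem_iota !add0n e1 e2; case: e {e1 e2}.
Qed.

Lemma uniq_grid n : uniq (grid n).
Proof. by apply: allpairs_uniq; rewrite ?iota_uniq // => -[a b] [c d] _ _. Qed.

Lemma sum_grid (V : nmodType) n (E : seq (nat * nat)) (F : nat * nat -> V) :
  uniq E -> (forall e, e \in E -> e \in grid n) ->
  (forall e, e \notin E -> F e = 0) ->
  \sum_(e <- grid n) F e = \sum_(e <- E) F e.
Proof.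
move=> uE Eg F0; rewrite (bigID (mem E)) /= [X in _ + X]big1 ?addr0 //.
rewrite -big_filter; apply: perm_big; apply: uniq_perm => //.
  by rewrite filter_uniq // uniq_grid.
move=> e; rewrite mem_filter /=; case: (boolP (e \in E)) => //= /Eg //.
Qed.

(** Test function of a flow. Vertex sets are given by sequences, hence are countably many, which
    keeps conditions on all of them measurable. *)
Definition indic_seq (V : nzRingType) (A : seq nat) (v : nat) : V :=
  ((v \in A) : nat)%:R.

(* A unit flow from x to (last x p) carried by two walks that only share x
   must be the indicator function of the first one. *)
Lemma flow_on_walks (V : numDomainType) n x (p q : seq nat) (d : nat * nat -> V) :
  uniq (x :: p ++ q) -> (forall v, v \in x :: p ++ q -> (v < n)%N) ->
  (forall e, 0 <= d e) ->
  (forall e, e \notin edges x p ++ edges x q -> d e = 0) ->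
  (forall A, \sum_(e <- grid n) d e * (indic_seq V A e.2 - indic_seq V A e.1) =
             indic_seq V A (last x p) - indic_seq V A x) ->
  forall e, d e = ((e \in edges x p) : nat)%:R.
Proof.
move=> U lt_n d0 dE flow.
have [xp xq] : x \notin p /\ x \notin q.
  by move: U; rewrite /= mem_cat negb_or => /andP[/andP[]].
have [Up Uq pq] : [/\ uniq p, uniq q & forall v, v \in p -> v \notin q].
  move: U; rewrite /= cat_uniq => /andP[_ /and3P[-> /hasPn H ->]]; split => // v vp.
  by apply/negP => /H /=; rewrite vp.
pose E := edges x p ++ edges x q.
have UE : uniq E.
  apply: (@map_uniq _ _ snd); rewrite map_cat !snd_edges.
  by case/andP: U.
have Eg e : e \in E -> e \in grid n.
  rewrite mem_cat mem_grid => /orP[] /mem_edges/andP[]; rewrite inE.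
    by case/predU1P=> [->|h1] h2; rewrite !lt_n // !inE ?eqxx // mem_cat ?h1 ?h2 ?orbT.
  by case/predU1P=> [->|h1] h2; rewrite !lt_n // !inE ?eqxx // mem_cat ?h1 ?h2 ?orbT.
have S A : \sum_(e <- edges x p) d e * (indic_seq V A e.2 - indic_seq V A e.1) +
    \sum_(e <- edges x q) d e * (indic_seq V A e.2 - indic_seq V A e.1) =
    indic_seq V A (last x p) - indic_seq V A x.
  rewrite -flow -big_cat /=; apply/esym; apply: sum_grid => // e eE.
  by rewrite dE // mul0r.
(* Test the flow against the part of a walk after one of its edges: this edge is the only one of
   both walks that crosses into that part, so its value is the net inflow. The inflow is 1 if the
   part contains the end of [p], and 0 along [q]. *)
have tail y (r r' : seq nat) a v b : r = a ++ v :: b -> uniq r -> y \notin r ->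
    (forall w, w \in r' -> w \notin r) ->
    (\sum_(e <- edges y r') d e * (indic_seq V (v :: b) e.2 - indic_seq V (v :: b) e.1) = 0)
    /\ (\sum_(e <- edges y r) d e * (indic_seq V (v :: b) e.2 - indic_seq V (v :: b) e.1)
       = d (last y a, v)).
  move=> rE Ur yr rr'; have yb : y \notin v :: b.
    by apply: contraNN yr; rewrite rE mem_cat => ->; rewrite orbT.
  have ab w : w \in a -> w \notin v :: b.
    move: Ur; rewrite rE cat_uniq => /and3P[_ /hasPn H _] wa; apply/negP => /H /=.
    by rewrite wa.
  split.
    apply: big1_seq => e /andP[_ /mem_edges/andP[]]; rewrite inE => h1 h2.
    have N w : w \in r' -> w \notin v :: b.
      by move=> /rr'; apply: contraNN; rewrite rE mem_cat => ->; rewrite orbT.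
    have -> : indic_seq V (v :: b) e.2 = 0 by rewrite /indic_seq (negbTE (N _ h2)).
    suff -> : indic_seq V (v :: b) e.1 = 0 by rewrite subrr mulr0.
    rewrite /indic_seq; case/predU1P: h1 => [->|/N/negbTE -> //].
    by rewrite (negbTE yb).
  rewrite rE edges_cat big_cat big_cons /=.
  rewrite [X in X + _]big1_seq ?add0r; last first.
    move=> e /andP[_ /mem_edges/andP[]]; rewrite inE => h1 h2.
    rewrite /indic_seq (negbTE (ab _ h2)).
    by case/predU1P: h1 => [->|/ab/negbTE ->]; rewrite ?(negbTE yb) subrr mulr0.
  rewrite [X in _ + X]big1_seq ?addr0; last first.
    move=> e /andP[_ /mem_edges/andP[h1 h2]].
    by rewrite /indic_seq h1 inE h2 orbT subrr mulr0.
  have lv : last y a \notin v :: b.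
    by case: (lastP a) ab => [_|a' w ab] //=; rewrite last_rcons ab // mem_rcons mem_head.
  by rewrite /indic_seq mem_head (negbTE lv) subr0 mulr1.
move=> e; case: (boolP (e \in edges x p)) => ep.
  have [a [b [pE e1]]] := edgesP ep.
  have qp w : w \in q -> w \notin p by move=> wq; apply/negP => /pq; rewrite wq.
  have [t1 t2] := tail x p q a e.2 b pE Up xp qp.
  have := S (e.2 :: b); rewrite t1 t2 addr0 -e1 -surjective_pairing => ->.
  rewrite pE last_cat /= /indic_seq mem_last.
  suff /negbTE -> : x \notin e.2 :: b by rewrite subr0.
  by apply: contraNN xp; rewrite pE mem_cat => ->; rewrite orbT.
case: (boolP (e \in edges x q)) => eq; last first.
  by rewrite dE // mem_cat negb_or ep.
have [a [b [qE e1]]] := edgesP eq.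
have [t1 t2] := tail x q p a e.2 b qE Uq xq pq.
have := S (e.2 :: b); rewrite t1 t2 add0r -e1 -surjective_pairing => ->.
have qb w : w \notin q -> w \notin e.2 :: b.
  by apply: contraNN; rewrite qE mem_cat => ->; rewrite orbT.
rewrite /indic_seq (negbTE (qb _ xq)).
suff /negbTE -> : last x p \notin e.2 :: b by rewrite subrr.
apply: qb; case: (lastP p) pq => [_|p' w pq] //=.
by rewrite last_rcons pq // mem_rcons mem_head.
Qed.

(** * Durations and the recovery of walks from their digits *)

Section durations.
Context {R : realType}.
Implicit Types (x y z tau : R) (p q : seq R).

Definition cell m y : nat := Num.truncn (2 ^+ m * y).
Definition code (m : nat) (e : nat * nat) : nat := pickle (m, e).

Definition hits y z (i : nat) : bool :=
  if unpickle i is Some (m, e) then e == (cell m y, cell m z) else false.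

(* The factorial digit of [duration y z] at [code m e] tells whether [y] and [z]
   lie in the dyadic cells [e] of level [m]; hence the durations of finitely many
   distinct pairs can be told apart in their sum. *)
Definition duration y z : R := 1 + fact_series (hits y z).

Lemma hits_code m e y z : hits y z (code m e) = (e == (cell m y, cell m z)).
Proof. by rewrite /hits /code pickleK. Qed.

Lemma duration_ge1 y z : 1 <= duration y z.
Proof.
rewrite /duration lerDl; have := fact_series_ge (hits y z) 0 : _ <= _ :> R.
by rewrite /fact_sum big_ord0.
Qed.

(** The finitely many indices below [I] decode to finitely many levels. Facts about all late digits
    therefore hold uniformly over the cells of each high level. *)
Lemma code_large I : \forall m \near \oo, forall e, (I <= code m e)%N.
Proof.
pose lev i := if (unpickle i : option (nat * (nat * nat))) is Some (m, _) then m else 0%N.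
exists (\max_(i < I) lev i).+1 => // m /= Im e; rewrite leqNgt; apply/negP => cI.
move: Im; rewrite ltnNge => /negP; apply.
apply: leq_trans (leq_bigmax (Ordinal cI)).
by rewrite /lev /= /code pickleK.
Qed.

Lemma near_cells x y : 0 <= x -> 0 <= y -> x != y ->
  \forall m \near \oo, cell m x != cell m y.
Proof.
move=> x0 y0 xy; have d0 : 0 < `|x - y| by rewrite normr_gt0 subr_eq0.
have C : 2^-1 ^+ n @[n --> \oo] --> (0 : R).
  by apply: cvg_expr; rewrite gtr0_norm ?invr_gt0 // invf_lt1 // ltr1n.
near=> m; have m2 : 2^-1 ^+ m < `|x - y|.
  by near: m; exact: cvgr_lt C _ d0.
apply/eqP => E; move: m2; rewrite exprVn ltNge => /negP; apply.
have p2 : 0 < 2 ^+ m :> R by rewrite exprn_gt0.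
have /truncn_itv/andP[l1 u1] : 0 <= 2 ^+ m * x by rewrite mulr_ge0 // ltW.
have /truncn_itv/andP[l2 u2] : 0 <= 2 ^+ m * y by rewrite mulr_ge0 // ltW.
rewrite -(ler_pM2l p2) divff ?lt0r_neq0 // -[X in X * _](gtr0_norm p2) -normrM.
rewrite -/(cell m x) in l1 u1; rewrite -/(cell m y) in l2 u2.
rewrite E -natr1 in l1 u1; rewrite -natr1 in u2.
rewrite mulrBr ler_norml; apply/andP; split; lra.
Unshelve. all: by end_near. Qed.

Lemma uniq_cells p : (forall y, y \in p -> 0 <= y) -> uniq p ->
  \forall m \near \oo, uniq (map (cell m) p).
Proof.
elim: p => [|x p IH] p0 /=; first by move=> _; exact: nearW.
case/andP => xp up; have : \forall m \near \oo, cell m x \notin map (cell m) p.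
  have p0' y : y \in p -> 0 <= y by move=> yp; rewrite p0 // inE yp orbT.
  have x0 : 0 <= x by rewrite p0 // mem_head.
  elim: p xp p0' {IH up p0} => [|y p IH] xp p0'; first exact: nearW.
  move: xp; rewrite inE negb_or => /andP[xy xp].
  near=> m; rewrite inE negb_or; apply/andP; split; near: m.
    by apply: near_cells => //; rewrite p0' // mem_head.
  by apply: IH => // z zp; rewrite p0' // inE zp orbT.
move=> H; near=> m; apply/andP; split; near: m => //.
by apply: IH => // y yp; rewrite p0 // inE yp orbT.
Unshelve. all: by end_near. Qed.

Lemma cell_lt m y : 0 <= y < 1 -> (cell m y < 2 ^ m)%N.
Proof.
move=> /andP[y0 y1]; rewrite /cell truncn_lt_nat ?mulr_ge0 ?exprn_ge0 //.
by rewrite natrX gtr_pMr // exprn_gt0.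
Qed.

(** Duration between the lower corners of two cells, a substitute for an edge of which only the
    cells are known. *)
Definition approx m (e : nat * nat) : R :=
  duration (e.1%:R / 2 ^+ m) (e.2%:R / 2 ^+ m).

Lemma cell_cell k m y : (k <= m)%N -> 0 <= y ->
  cell k ((cell m y)%:R / 2 ^+ m) = cell k y.
Proof.
move=> km y0; have p2 j : 0 < 2 ^+ j :> R by rewrite exprn_gt0.
have ny j : 0 <= 2 ^+ j * y by rewrite mulr_ge0 // ltW.
have E : 2 ^+ m = 2 ^+ k * 2 ^+ (m - k) :> R by rewrite -exprD subnKC.
rewrite {1}/cell (_ : 2 ^+ k * _ = (cell m y)%:R / 2 ^+ (m - k)); last first.
  by rewrite E invfM mulrCA [2 ^+ k * _]mulrA divff ?mul1r // lt0r_neq0.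
have q0 : 0 <= (cell m y)%:R / 2 ^+ (m - k) :> R by rewrite divr_ge0 // ltW.
apply/eqP; rewrite (truncn_eq _ q0).
have /truncn_itv/andP[l u] := ny k.
rewrite ler_pdivlMr // ltr_pdivrMr // -!natrX -!natrM ler_nat ltr_nat.
rewrite truncn_ge_nat // truncn_lt_nat // !natrM !natrX E.
rewrite [2 ^+ k * _]mulrC -mulrA [_%:R * 2 ^+ _]mulrC [_.+1%:R * _]mulrC.
by rewrite ler_pM2l // ltr_pM2l // l.
Qed.

(** [duration] jumps at dyadic points, so continuity is of no avail. But a point and the lower
    corner of its cell of level [m] share their cells up to level [m], hence all digits coded at
    these levels, and only a tail of the series differs. *)
Lemma cvg_approx y z : 0 <= y -> 0 <= z ->
  approx m (cell m y, cell m z) @[m --> \oo] --> duration y z.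
Proof.
move=> y0 z0; apply/cvgrPdist_le => e e0.
have [I Ie] : exists I, 2 / (I.+1)`!%:R <= e :> R.
  have : 2 * n.+1%:R^-1 @[n --> \oo] --> (2 * 0 : R).
    by apply: cvgMr; exact: cvg_harmonic.
  rewrite mulr0 => /cvgr_le/(_ _ e0) [N _ NN]; exists N.
  apply: le_trans (NN N (leqnn _)); rewrite ler_pM2l // lef_pV2 ?posrE ?ltr0n ?fact_gt0 //.
  by rewrite ler_nat fact_geq.
pose lev i := if (unpickle i : option (nat * (nat * nat))) is Some (m, _) then m else 0%N.
exists (\max_(i < I) lev i)%N => // m /= Im; rewrite /approx /duration /=.
set y' := _ / _; set z' := _ / _.
have E i : (i < I)%N -> hits y z i = hits y' z' i.
  move=> iI; have : (lev i <= m)%N.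
    by apply: leq_trans Im; exact: (leq_bigmax (Ordinal iI)).
  rewrite /hits /lev; case: unpickle => // -[k [a b]] km.
  by rewrite /y' /z' !cell_cell.
have S : fact_sum (hits y z) I = fact_sum (hits y' z') I :> R.
  by apply: eq_bigr => i _; rewrite E.
have := fact_series_ge (hits y z) I : _ <= _ :> R.
have := fact_series_ge (hits y' z') I : _ <= _ :> R.
have := fact_series_le (hits y z) I : _ <= _ :> R.
have := fact_series_le (hits y' z') I : _ <= _ :> R.
rewrite S; move: (2 / _) Ie => a Ie *; rewrite ler_norml; apply/andP; split; lra.
Qed.

Definition walk_time x p : R := \sum_(e <- edges x p) duration e.1 e.2.

Lemma lacunary_walk_time x p : lacunary (walk_time x p) /\
  \forall i \near \oo, digit i (walk_time x p) =
    \sum_(e <- edges x p) (hits e.1 e.2 i : nat)%:R.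
Proof.
rewrite /walk_time; elim: (edges x p) => [|e E [lE dE]].
  rewrite big_nil; split.
    rewrite /lacunary; under eq_fun do rewrite /frac mulr0 floor0 subrr.
    exact: cvg_cst.
  by near=> i; rewrite big_nil /digit !mulr0 floor0 mulr0 subrr.
have [le de] := lacunary_fact_series (hits e.1 e.2) : lacunary (duration e.1 e.2) /\ _.
have [l d] := lacunaryD le lE; rewrite big_cons; split=> //.
near=> i; rewrite big_cons -(near dE i) // -de; last first.
  by near: i; exact: nbhs_infty_ge.
by near: i; exact: d.
Unshelve. all: by end_near. Qed.

(* The measurable trace of [tau] being the duration of a walk from [x] to [y]:
   the digits of level [m] form a unit flow between the cells of [x] and [y],
   and they approximate [tau]. *)
Definition balanced x tau y :=
  [/\ lacunary tau,
      \forall m \near \oo, forall A : seq nat,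
        \sum_(e <- grid (2 ^ m)) digit (code m e) tau *
          (indic_seq R A e.2 - indic_seq R A e.1) =
        indic_seq R A (cell m y) - indic_seq R A (cell m x) &
      \sum_(e <- grid (2 ^ m)) digit (code m e) tau * approx m e @[m --> \oo]
        --> tau].

Definition cell_edge m (e : R * R) := (cell m e.1, cell m e.2).

Lemma cell_edges m x p :
  map (cell_edge m) (edges x p) = edges (cell m x) (map (cell m) p).
Proof. by rewrite map_edges. Qed.

(** Edges of the walk that project to the same [e] are counted with multiplicity; the level has to
    be high enough for all its codes to lie beyond the last carry. *)
Lemma digit_walk_time x p : \forall m \near \oo, forall e,
  digit (code m e) (walk_time x p) =
  \sum_(f <- edges (cell m x) (map (cell m) p)) ((e == f) : nat)%:R.
Proof.
have [_ [N _ NE]] := lacunary_walk_time x p.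
near=> m => e; rewrite NE /=; last by move: e; near: m; exact: code_large.
rewrite -cell_edges big_map; apply: eq_bigr => f _; by rewrite hits_code.
Unshelve. all: by end_near. Qed.

Lemma sum_grid_delta n (F : nat * nat -> R) (E : seq (nat * nat)) :
  (forall e, e \in E -> e \in grid n) ->
  \sum_(e <- grid n) (\sum_(f <- E) ((e == f) : nat)%:R) * F e =
  \sum_(e <- E) F e.
Proof.
move=> Eg; under eq_bigr do rewrite mulr_suml.
rewrite exchange_big /= [LHS]big_seq [RHS]big_seq; apply: eq_bigr => f /Eg fg.
rewrite (bigD1_seq f) ?uniq_grid //= eqxx mul1r big1 ?addr0 // => e /negbTE ->.
by rewrite mul0r.
Qed.

Lemma edges_in_grid m x p : (forall y, y \in x :: p -> 0 <= y < 1) ->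
  forall e, e \in edges (cell m x) (map (cell m) p) -> e \in grid (2 ^ m).
Proof.
move=> p01 e /mem_edges/andP[]; rewrite mem_grid.
rewrite -(map_cons (cell m) x) => /mapP[y yp ->] /mapP[z zp ->].
by rewrite !cell_lt // p01 // inE zp orbT.
Qed.

Lemma cvg_walk_time x p : (forall y, y \in x :: p -> 0 <= y < 1) ->
  \sum_(e <- edges (cell m x) (map (cell m) p)) approx m e @[m --> \oo]
    --> walk_time x p.
Proof.
move=> p01; under eq_fun do rewrite -cell_edges big_map.
have : forall e, e \in edges x p -> 0 <= e.1 /\ 0 <= e.2.
  move=> e /mem_edges/andP[h1 h2]; have /andP[-> _] := p01 _ h1.
  by have /andP[-> _] : 0 <= e.2 < 1 by apply: p01; rewrite inE h2 orbT.
rewrite /walk_time; elim: (edges x p) => [|e E IH] E0.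
  rewrite big_nil [X in X @ _](_ : _ = fun=> 0); first exact: cvg_cst.
  by apply/funext => m; rewrite big_nil.
rewrite big_cons [X in X @ _](_ : _ = (fun m => approx m (cell_edge m e)) \+
    (fun m => \sum_(f <- E) approx m (cell_edge m f))); last first.
  by apply/funext => m; rewrite big_cons.
apply: cvgD; first by have [e1 e2] := E0 e (mem_head _ _); exact: cvg_approx.
by apply: IH => f fE; apply: E0; rewrite inE fE orbT.
Qed.

Lemma balanced_walk_time x p : (forall y, y \in x :: p -> 0 <= y < 1) ->
  balanced x (walk_time x p) (last x p).
Proof.
move=> p01; split; first by case: (lacunary_walk_time x p).
  near=> m => A; have D := near (digit_walk_time x p) m.
  under eq_bigr do rewrite D //.
  rewrite sum_grid_delta => [|e]; last by apply: (@edges_in_grid m x p).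
  by rewrite (sum_edges_telescope (indic_seq R A)) last_map.
apply: cvg_trans (cvg_walk_time p01); apply: near_eq_cvg; near=> m.
have D := near (digit_walk_time x p) m.
under [RHS]eq_bigr do rewrite D //.
by rewrite sum_grid_delta // => e; apply: (@edges_in_grid m x p).
Unshelve. all: by end_near. Qed.

(** At high levels the cells separate all vertices. Non-negative digits that add up to those of the
    two walks vanish off their edges, so [flow_on_walks] turns the digits of [tau] into the
    indicator of the edges of [p]. The last clause of [balanced] then rebuilds [tau] from these
    digits. *)
Lemma balanced_unique x p q tau tau' :
  uniq (x :: p ++ q) -> (forall y, y \in x :: p ++ q -> 0 <= y < 1) ->
  balanced x tau (last x p) -> lacunary tau' ->
  tau + tau' = walk_time x p + walk_time x q -> tau = walk_time x p.
Proof.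
move=> U v01 [lt ft ct] lt' tE.
have sub y : y \in x :: p -> 0 <= y < 1.
  by move=> yp; apply: v01; move: yp; rewrite !inE mem_cat => /predU1P[->|->]; rewrite ?eqxx ?orbT.
have [_ D1] := lacunaryD lt lt'.
have [lp dp] := lacunary_walk_time x p; have [lq dq] := lacunary_walk_time x q.
have [_ D2] := lacunaryD lp lq; rewrite tE in D1.
have [N _ NE] : \forall i \near \oo, digit i tau + digit i tau' =
    digit i (walk_time x p) + digit i (walk_time x q).
  by near=> i; rewrite -(near D1 i) // -(near D2 i).
have D : \forall m \near \oo, forall e, digit (code m e) tau =
    ((e \in edges (cell m x) (map (cell m) p)) : nat)%:R.
  near=> m.
  have Um : uniq (map (cell m) (x :: p ++ q)).
    by near: m; apply: uniq_cells => // y /v01/andP[].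
  have F := near ft m; have Dp := near (digit_walk_time x p) m.
  have Dq := near (digit_walk_time x q) m.
  have L : forall e, (N <= code m e)%N by near: m; exact: code_large.
  apply: (@flow_on_walks _ (2 ^ m) _ _ (map (cell m) q)).
  - by rewrite -map_cat.
  - rewrite -map_cat -(map_cons (cell m) x) => v /mapP[y yv ->].
    by apply: cell_lt; exact: (v01 _ yv).
  - by move=> e; exact: digit_ge0.
  - move=> e; rewrite mem_cat negb_or => /andP[ep eq].
    have := NE _ (L e); rewrite Dp // Dq //.
    rewrite big1_seq => [|f /andP[_ fp]]; last first.
      by case: eqP => // ef; rewrite ef fp in ep.
    rewrite big1_seq => [|f /andP[_ fq]]; last first.
      by case: eqP => // ef; rewrite ef fq in eq.
    have := digit_ge0 (code m e) tau; have := digit_ge0 (code m e) tau'; lra.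
  - by move=> A; rewrite last_map F.
apply: (cvg_unique _ ct) => //; apply: cvg_trans (cvg_walk_time sub).
apply: near_eq_cvg; near=> m; have Dm := near D m.
have Um : uniq (map (cell m) (x :: p)).
  near: m; apply: uniq_cells => [y /sub/andP[]//|].
  by move: U; rewrite -cat_cons cat_uniq => /andP[].
under [RHS]eq_bigr do rewrite Dm //.
rewrite [RHS](@sum_grid _ _ (edges (cell m x) (map (cell m) p))).
- by rewrite [LHS]big_seq [RHS]big_seq; apply: eq_bigr => e ->; rewrite mul1r.
- by apply: (@map_uniq _ _ snd); rewrite snd_edges; case/andP: Um.
- by move=> e; apply: (@edges_in_grid m x p).
- by move=> e /negbTE ->; rewrite mul0r.
Unshelve. all: by end_near. Qed.

End durations.

(** * Measurability of the balance relation *)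

Section measurable_sets.
Context d (T : measurableType d) {R : realType}.
Implicit Types (f g : T -> R).

Lemma measurable_set_lt f g : measurable_fun setT f -> measurable_fun setT g ->
  measurable [set x | f x < g x].
Proof.
move=> mf mg; have := measurable_fun_ltr mf mg.
by move=> /(_ measurableT [set true] I); rewrite setTI.
Qed.

Lemma measurable_set_le f g : measurable_fun setT f -> measurable_fun setT g ->
  measurable [set x | f x <= g x].
Proof.
move=> mf mg; have := measurable_fun_ler mf mg.
by move=> /(_ measurableT [set true] I); rewrite setTI.
Qed.

Lemma measurable_set_eq f g : measurable_fun setT f -> measurable_fun setT g ->
  measurable [set x | f x = g x].
Proof.
move=> mf mg; rewrite (_ : [set _ | _] = [set x | f x <= g x] `&` [set x | g x <= f x]).
  by apply: measurableI; exact: measurable_set_le.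
apply/seteqP; split => x /=; first by move=> ->.
by case=> h1 h2; apply: le_anti; rewrite h1.
Qed.

Lemma measurable_set_near (P : nat -> T -> Prop) :
  (forall n, measurable [set x | P n x]) ->
  measurable [set x | \forall n \near \oo, P n x].
Proof.
move=> mP; rewrite (_ : [set _ | _] =
  \bigcup_N \bigcap_(n in [set n | (N <= n)%N]) [set x | P n x]).
  by apply: bigcupT_measurable => N; apply: bigcap_measurableType.
by apply/seteqP; split => [x [N _ NP]|x [N _ NP]]; exists N.
Qed.

Lemma measurable_set_forall (I : countType) (P : I -> T -> Prop) :
  (forall i, measurable [set x | P i x]) ->
  measurable [set x | forall i, P i x].
Proof.
move=> mP; rewrite -[X in measurable X]setCK.
rewrite (_ : ~` [set x | forall i, P i x] = \bigcup_i ~` [set x | P i x]).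
  apply: measurableC; apply: countable_bigcupT_measurable => [|i].
    exact: countableP.
  exact: measurableC.
apply/seteqP; split => x /=; first by move/existsNP => [i Pi]; exists i.
by case=> i _ Pi H; exact: Pi.
Qed.

Lemma measurable_set_cvgn (u : nat -> T -> R) f :
  (forall n, measurable_fun setT (u n)) -> measurable_fun setT f ->
  measurable [set x | u n x @[n --> \oo] --> f x].
Proof.
move=> mu mf.
rewrite (_ : [set _ | _] = [set x | forall k : nat,
    \forall n \near \oo, `|f x - u n x| < k.+1%:R^-1]).
  apply: measurable_set_forall => k; apply: measurable_set_near => n.
  apply: measurable_set_lt; last exact: measurable_cst.
  by apply: measurableT_comp; [exact: normr_measurable|exact: measurable_funB].
apply/seteqP; split => x /=.
  by move=> /cvgrPdist_lt H k; apply: H; rewrite invr_gt0.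
move=> H; apply/cvgrPdist_lt => e e0.
have [k] := ltr_add_invr e0; rewrite add0r => ke.
by apply: filterS (H k) => n /lt_trans; apply.
Qed.

Lemma measurable_fun_sum_seq (I : Type) (s : seq I) (F : I -> T -> R) :
  (forall i, measurable_fun setT (F i)) ->
  measurable_fun setT (fun x => \sum_(i <- s) F i x).
Proof.
move=> mF; elim: s => [|i s IH].
  rewrite (_ : (fun _ => _) = cst 0); first exact: measurable_cst.
  by apply/funext => x; rewrite big_nil.
rewrite (_ : (fun _ => _) = F i \+ (fun x => \sum_(j <- s) F j x)).
  exact: measurable_funD.
by apply/funext => x; rewrite big_cons.
Qed.

Lemma measurable_floor f : measurable_fun setT f ->
  measurable_fun setT (fun x => (Num.floor (f x))%:~R : R).
Proof.
move=> mf; have mfl : measurable_fun [set: R] (fun x => (Num.floor x)%:~R : R).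
  apply: nondecreasing_measurable => // x y xy.
  by rewrite ler_int; exact: le_floor.
exact: measurableT_comp mfl mf.
Qed.

Lemma measurable_cell m f : measurable_fun setT f ->
  measurable_fun setT (fun x => cell m (f x)).
Proof.
move=> mf; apply: measurableT_comp measurable_truncn _.
by apply: measurable_funM => //; exact: measurable_cst.
Qed.

Lemma measurable_nat_comp (h : T -> nat) (c : nat -> R) :
  measurable_fun setT h -> measurable_fun setT (fun x => c (h x)).
Proof. by move=> mh; apply: (@measurableT_comp _ _ _ _ _ _ c). Qed.

Lemma measurable_duration f g : measurable_fun setT f -> measurable_fun setT g ->
  measurable_fun setT (fun x => duration (f x) (g x)).
Proof.
move=> mf mg; apply: measurable_funD; first exact: measurable_cst.
apply: (measurable_fun_cvg (h := fun n x => fact_sum (hits (f x) (g x)) n)).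
  move=> n; apply: measurable_fun_sum_seq => i.
  apply: measurable_funM; last exact: measurable_cst.
  rewrite /hits; case: unpickle => [[m e]|]; last exact: measurable_cst.
  rewrite (_ : (fun x => _) = fun x =>
      (((e.1 == cell m (f x)) : nat)%:R * ((e.2 == cell m (g x)) : nat)%:R) : R).
    apply: measurable_funM.
      apply: (measurable_nat_comp (fun c => ((e.1 == c) : nat)%:R)).
      exact: measurable_cell.
    apply: (measurable_nat_comp (fun c => ((e.2 == c) : nat)%:R)).
    exact: measurable_cell.
  apply/funext => x; rewrite [e]surjective_pairing xpair_eqE /=.
  by case: eqP; case: eqP; rewrite ?mulr1 ?mulr0.
by move=> x _; exact: cvg_fact_sum.
Qed.

Lemma measurable_digit i f : measurable_fun setT f ->
  measurable_fun setT (fun x => digit i (f x)).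
Proof.
move=> mf; have mc n : measurable_fun setT (fun x => n`!%:R * f x).
  by apply: measurable_funM => //; exact: measurable_cst.
apply: measurable_funB; first exact: measurable_floor.
by apply: measurable_funM; [exact: measurable_cst|exact: measurable_floor].
Qed.

Lemma measurable_balanced x0 f g :
  measurable_fun setT f -> measurable_fun setT g ->
  measurable [set x | balanced x0 (f x) (g x)].
Proof.
move=> mf mg; rewrite (_ : [set _ | _] =
    [set x | lacunary (f x)] `&`
    [set x | \forall m \near \oo, forall A : seq nat,
        \sum_(e <- grid (2 ^ m)) digit (code m e) (f x) *
          (indic_seq R A e.2 - indic_seq R A e.1) =
        indic_seq R A (cell m (g x)) - indic_seq R A (cell m x0)] `&`
    [set x | \sum_(e <- grid (2 ^ m)) digit (code m e) (f x) * approx m e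
         @[m --> \oo] --> f x]); last first.
  by apply/seteqP; split => x; [case|case=> -[]].
apply: measurableI; first apply: measurableI.
- apply: measurable_set_cvgn => [n|]; last exact: measurable_cst.
  have mc : measurable_fun setT (fun x => n`!%:R * f x).
    by apply: measurable_funM => //; exact: measurable_cst.
  by apply: measurable_funB => //; exact: measurable_floor.
- apply: measurable_set_near => m; apply: measurable_set_forall => A.
  apply: measurable_set_eq.
    apply: measurable_fun_sum_seq => e; apply: measurable_funM; last exact: measurable_cst.
    exact: measurable_digit.
  apply: measurable_funB; last exact: measurable_cst.
  apply: (measurable_nat_comp (indic_seq R A)); exact: measurable_cell.
- apply: measurable_set_cvgn => // m.
  apply: measurable_fun_sum_seq => e; apply: measurable_funM; last exact: measurable_cst.
  exact: measurable_digit.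
Qed.

End measurable_sets.

(** * The process *)

Lemma measurable_fun_pieces d d' (T : measurableType d) (T' : measurableType d')
    (F : T -> T') (Fk : nat -> T -> T') (A : nat -> set T) :
  (forall k, measurable (A k)) -> (forall x, exists k, A k x) ->
  (forall k, measurable_fun setT (Fk k)) ->
  (forall k x, A k x -> F x = Fk k x) -> measurable_fun setT F.
Proof.
move=> mA cA mF FE _ Y mY; rewrite setTI.
rewrite (_ : F @^-1` Y = \bigcup_k (A k `&` Fk k @^-1` Y)).
  apply: bigcupT_measurable => k; apply: measurableI => //.
  exact: measurable_preimageT.
apply/seteqP; split => [x Yx|x [k _ [Ax]]].
  by have [k Ax] := cA x; exists k => //; split => //; rewrite /preimage /= -(FE k).
by rewrite /preimage /= (FE k).
Qed.

(* Conversion must not unfold limits and choice. *)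
Opaque duration.

Section process.
Context {R : realType}.
Local Notation S := (state R).
Local Notation BS := (borel S).
Implicit Types (x y : S) (v : coins) (t s : R).

Definition gap x : R := duration (cur x) (nxt x).

Definition vertex x v (k : nat) : R :=
  match k with 0%N => cur x | 1%N => nxt x | j.+2 => draw j v end.

Definition cycle_length x v k : R := duration (vertex x v k) (vertex x v k.+1).

(** [jump_time x v 0] is the start of the cycle in progress at time 0, recovered from the phase; it
    is at most 0. *)
Fixpoint jump_time x v k : R :=
  if k is j.+1 then jump_time x v j + cycle_length x v j else - (phase x * gap x).

Definition position x v k t : S :=
  mk (vertex x v k, vertex x v k.+1, (t - jump_time x v k) / cycle_length x v k).

Definition in_cycle x v k t := jump_time x v k <= t < jump_time x v k.+1.

(** The default 0 is returned as such only before [jump_time x v 0], that is, at negative times. *)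
Definition cycle_number x v t : nat := xget 0%N [set k | in_cycle x v k t].

Definition process t (w : BS * coins) : S :=
  position w.1 w.2 (cycle_number w.1 w.2 t) t.

Lemma vertex_itv x v k : 0 <= vertex x v k < 1.
Proof. by case: k => [|[|k]] /=; [exact: cur_itv|exact: nxt_itv|exact: draw_itv]. Qed.

Lemma cycle_length_ge1 x v k : 1 <= cycle_length x v k.
Proof. exact: duration_ge1. Qed.

Lemma cycle_length_gt0 x v k : 0 < cycle_length x v k.
Proof. exact: lt_le_trans ltr01 (cycle_length_ge1 x v k). Qed.

(** Cycles last at least 1, so the jump times tend to infinity and the cycles cover all later
    times. *)
Lemma jump_time_le x v j k : (j <= k)%N -> jump_time x v j + (k - j)%:R <= jump_time x v k.
Proof.
move=> /subnK <-; elim: (k - j)%N => [|n IH]; first by rewrite addnK addr0.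
rewrite addnK in IH; rewrite addnK addSn /= -natr1 addrA lerD //.
exact: cycle_length_ge1.
Qed.

Lemma jump_time0_le x v : jump_time x v 0 <= 0.
Proof.
rewrite /= oppr_le0 mulr_ge0 //; first by case/andP: (phase_itv x).
exact: le_trans ler01 (duration_ge1 _ _).
Qed.

Lemma jump_time1 x v : jump_time x v 1 = (1 - phase x) * gap x.
Proof. by rewrite /= /cycle_length /= -/(gap x) mulrBl mul1r addrC. Qed.

Lemma jump_time1_gt0 x v : 0 < jump_time x v 1.
Proof.
rewrite jump_time1 mulr_gt0 ?subr_gt0 //; first by case/andP: (phase_itv x).
exact: lt_le_trans ltr01 (duration_ge1 _ _).
Qed.

Lemma in_cycle_uniq x v j k t : in_cycle x v j t -> in_cycle x v k t -> j = k.
Proof.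
have H i l : in_cycle x v i t -> in_cycle x v l t -> (i <= l)%N.
  move=> /andP[i1 _] /andP[_ l2]; rewrite leqNgt; apply/negP => li.
  have := jump_time_le x v li; have : 0 <= (i - l.+1)%:R :> R by [].
  by move: i1 l2; move: (_%:R) => n *; lra.
by move=> h1 h2; apply/eqP; rewrite eqn_leq !H.
Qed.

Lemma in_cycle_ex x v t : jump_time x v 0 <= t -> exists k, in_cycle x v k t.
Proof.
move=> t0; have P : exists k, t < jump_time x v k.+1.
  exists (Num.truncn (t - jump_time x v 0)).
  apply: lt_le_trans (jump_time_le x v (leq0n _)).
  rewrite -ltrBlDl; exact: truncnS_gt.
case: (ex_minnP P) => -[|k] tk km; first by exists 0%N; rewrite /in_cycle t0.
exists k.+1; rewrite /in_cycle tk andbT leNgt; apply/negP => /km.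
by rewrite ltnn.
Qed.

Lemma cycle_numberE x v k t : in_cycle x v k t -> cycle_number x v t = k.
Proof.
move=> kt; apply: (@in_cycle_uniq x v _ _ t) => //.
by apply: (@xgetPex _ 0%N [set k | in_cycle x v k t]); exists k.
Qed.

Lemma cycle_numberP x v t : 0 <= t -> in_cycle x v (cycle_number x v t) t.
Proof.
move=> t0; have /in_cycle_ex[k kt] := le_trans (jump_time0_le x v) t0.
by rewrite (cycle_numberE kt).
Qed.

Lemma processE x v k t : in_cycle x v k t -> process t (x, v) = position x v k t.
Proof. by move=> kt; rewrite /process /= (cycle_numberE kt). Qed.

Lemma val_position x v k t : in_cycle x v k t -> val (position x v k t) =
  (vertex x v k, vertex x v k.+1, (t - jump_time x v k) / cycle_length x v k).
Proof.
move=> /andP[h1 h2]; have l0 := cycle_length_gt0 x v k.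
have q0 : 0 <= (t - jump_time x v k) / cycle_length x v k.
  by rewrite divr_ge0 ?subr_ge0 // ltW.
rewrite mkK //; apply/and3P; split; [exact: vertex_itv|exact: vertex_itv|].
by rewrite /= q0 ltr_pdivrMr // mul1r ltrBlDl.
Qed.

Lemma cur_process x v k t : in_cycle x v k t -> cur (process t (x, v)) = vertex x v k.
Proof. by move=> kt; rewrite /cur (processE kt) val_position. Qed.

Lemma nxt_process x v k t : in_cycle x v k t -> nxt (process t (x, v)) = vertex x v k.+1.
Proof. by move=> kt; rewrite /nxt (processE kt) val_position. Qed.

Lemma phase_process x v k t : in_cycle x v k t ->
  phase (process t (x, v)) = (t - jump_time x v k) / cycle_length x v k.
Proof. by move=> kt; rewrite /phase (processE kt) val_position. Qed.

Lemma state_eq x y : cur x = cur y -> nxt x = nxt y -> phase x = phase y -> x = y.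
Proof.
rewrite /cur /nxt /phase; move=> h1 h2 h3; apply: val_inj.
by case: (val x) (val y) h1 h2 h3 => [[a b] c] [[a' b'] c'] /= -> -> ->.
Qed.

Lemma process0 x v : process 0 (x, v) = x.
Proof.
have c0 : in_cycle x v 0 0 by rewrite /in_cycle jump_time0_le jump_time1_gt0.
apply: state_eq; [exact: cur_process c0|exact: nxt_process c0|].
rewrite (phase_process c0) sub0r opprK mulfK // lt0r_neq0 //.
exact: lt_le_trans ltr01 (duration_ge1 _ _).
Qed.

Lemma vertex_shift x v k t j : in_cycle x v k t ->
  vertex (process t (x, v)) (iter k odd_coins v) j = vertex x v (k + j).
Proof.
move=> kt; case: j => [|[|j]] /=.
- by rewrite (cur_process kt) addn0.
- by rewrite (nxt_process kt) addn1.
- by rewrite draw_iter !addnS.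
Qed.

Lemma jump_time_shift x v k t j : in_cycle x v k t ->
  jump_time (process t (x, v)) (iter k odd_coins v) j = jump_time x v (k + j) - t.
Proof.
move=> kt; elim: j => [|j IH].
  rewrite /= (phase_process kt) /gap (cur_process kt) (nxt_process kt) addn0.
  rewrite -/(cycle_length x v k) divfK ?opprB //.
  by rewrite lt0r_neq0 // cycle_length_gt0.
by rewrite addnS /= IH /cycle_length !vertex_shift // addnS addrAC.
Qed.

Lemma process_shift x v k t s : in_cycle x v k t -> 0 <= s ->
  process (t + s) (x, v) = process s (process t (x, v), iter k odd_coins v).
Proof.
move=> kt s0; set y := process t (x, v); set u := iter k odd_coins v.
have js := cycle_numberP y u s0; set j := cycle_number y u s in js.
have kj : in_cycle x v (k + j) (t + s).
  move: js; rewrite /in_cycle !jump_time_shift // addnS.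
  by rewrite lerBlDr ltrBrDr [s + t]addrC.
apply: state_eq.
- apply: (etrans (cur_process kj)); apply/esym; apply: (etrans (cur_process js)).
  exact: vertex_shift.
- apply: (etrans (nxt_process kj)); apply/esym; apply: (etrans (nxt_process js)).
  by rewrite -addnS; exact: vertex_shift.
- apply: (etrans (phase_process kj)); apply/esym; apply: (etrans (phase_process js)).
  rewrite jump_time_shift // /cycle_length !(vertex_shift _ kt).
  by rewrite addnS opprB addrA [s + t]addrC.
Qed.

Lemma tdist_process x v k t s : in_cycle x v k t -> in_cycle x v k s ->
  tdist (process t (x, v)) (process s (x, v)) <= `|t - s|.
Proof.
move=> kt ks; rewrite /tdist !(cur_process kt, cur_process ks, nxt_process kt,
  nxt_process ks, phase_process kt, phase_process ks) !carcxx !add0r.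
apply: le_trans (carc_le _ _) _; rewrite -mulrBl opprB addrA subrK normrM.
rewrite ler_piMr // gtr0_norm ?invr_gt0 ?cycle_length_gt0 //.
by rewrite invf_le1 ?cycle_length_gt0 // cycle_length_ge1.
Qed.

Lemma cadlag_process_path w : cadlag (path_of process w).
Proof.
case: w => x v t t0; split=> [|tp].
  have kt := cycle_numberP x v t0; set k := cycle_number x v t in kt.
  have /andP[k1 k2] := kt.
  apply/cvg_tdistP => e e0; near=> s.
  have st : t < s by near: s; exact: nbhs_right_gt.
  have ks : in_cycle x v k s.
    rewrite /in_cycle (le_trans k1 (ltW st)) andTb.
    by near: s; exact: nbhs_right_lt.
  rewrite /path_of; apply: le_lt_trans (tdist_process kt ks) _.
  rewrite distrC gtr0_norm ?subr_gt0 // ltrBlDl.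
  by near: s; apply: nbhs_right_lt; rewrite ltrDl.
(* The cycle in progress just before [t]; at a jump time it is the one that ends there. *)
have [k [k1 k2]] : exists k, jump_time x v k < t /\ t <= jump_time x v k.+1.
  have /andP[] := cycle_numberP x v t0; set k := cycle_number x v t.
  rewrite le_eqVlt => /predU1P[E _|]; last by move=> h1 h2; exists k; split=> //; exact: ltW.
  case: k E => [|k] E.
    by have := jump_time0_le x v; rewrite E leNgt tp.
  exists k; rewrite -E; split=> //=; rewrite ltrDl; exact: cycle_length_gt0.
pose a := (t - jump_time x v k) / cycle_length x v k.
have l0 := cycle_length_gt0 x v k.
have a0 : 0 <= a by apply: divr_ge0; rewrite ?subr_ge0 ltW.
have a1 : a <= 1 by rewrite ler_pdivrMr // mul1r lerBlDl.
(* At a jump the phase tends to 1, which is the point 0 of the circle, while the vertices are still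
   the old ones. *)
pose l : S := mk (vertex x v k, vertex x v k.+1, if a < 1 then a else 0).
have vl : val l = (vertex x v k, vertex x v k.+1, if a < 1 then a else 0).
  rewrite mkK //; apply/and3P; split; [exact: vertex_itv|exact: vertex_itv|].
  by rewrite /=; case: ltrP => a1'; rewrite ?a0 ?lexx ?ltr01.
exists l; apply/cvg_tdistP => e e0; near=> s.
have st : s < t by near: s; exact: nbhs_left_lt.
have ks : in_cycle x v k s.
  rewrite /in_cycle (lt_le_trans st k2) andbT.
  by near: s; exact: nbhs_left_ge.
rewrite /path_of /tdist /cur /nxt /phase vl (processE ks) (val_position ks) /=.
rewrite !carcxx !add0r; set b := _ / _.
have b0 : 0 <= b < 1.
  by have := phase_itv (process s (x, v)); rewrite (phase_process ks).
have ab : a - b <= t - s.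
  rewrite /a /b -mulrBl opprB addrA subrK ler_pdivrMr //.
  have := cycle_length_ge1 x v k; have : 0 <= t - s by rewrite subr_ge0 ltW.
  by nra.
have ba : b <= a.
  by rewrite /a /b ler_pM2r ?invr_gt0 // lerD2r ltW.
have ts : t - s < e.
  rewrite ltrBlDl -ltrBlDr; near: s; apply: nbhs_left_gt.
  by rewrite ltrBlDr ltrDl.
case: (ltrP a 1) => a1'.
  by apply: le_lt_trans (carc_le _ _) _; rewrite ger0_norm ?subr_ge0 //; lra.
rewrite carcC; apply: le_lt_trans (carc_wrap b0) _; lra.
Unshelve. all: by end_near. Qed.

Section measurability.
Context d (T : measurableType d) (X : T -> BS) (V : T -> coins).
Hypotheses (mX : measurable_fun setT X) (mV : measurable_fun setT V).

Lemma measurable_vertex k : measurable_fun setT (fun z => vertex (X z) (V z) k).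
Proof.
case: k => [|[|k]] /=.
- exact: measurableT_comp measurable_cur mX.
- exact: measurableT_comp measurable_nxt mX.
- exact: measurableT_comp (measurable_draw k) mV.
Qed.

Lemma measurable_cycle_length k :
  measurable_fun setT (fun z => cycle_length (X z) (V z) k).
Proof. by apply: measurable_duration; exact: measurable_vertex. Qed.

Lemma measurable_jump_time k :
  measurable_fun setT (fun z => jump_time (X z) (V z) k).
Proof.
elim: k => [|k IH] /=; last by apply: measurable_funD => //; exact: measurable_cycle_length.
apply: measurable_funN; apply: measurable_funM.
  exact: measurableT_comp measurable_phase mX.
apply: measurable_duration.
  exact: measurableT_comp measurable_cur mX.
exact: measurableT_comp measurable_nxt mX.
Qed.

Context (t : T -> R).
Hypothesis mt : measurable_fun setT t.

Lemma measurable_in_cycle k : measurable [set z | in_cycle (X z) (V z) k (t z)].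
Proof.
rewrite (_ : [set _ | _] = [set z | jump_time (X z) (V z) k <= t z] `&`
                          [set z | t z < jump_time (X z) (V z) k.+1]).
  apply: measurableI.
    by apply: measurable_set_le => //; exact: measurable_jump_time.
  by apply: measurable_set_lt => //; exact: measurable_jump_time.
by apply/seteqP; split => z /andP.
Qed.

Lemma measurable_process : (forall z, 0 <= t z) ->
  measurable_fun setT (fun z => process (t z) (X z, V z) : BS).
Proof.
move=> t0; have cov z : exists k, in_cycle (X z) (V z) k (t z).
  by eexists; exact: cycle_numberP.
apply: measurable_fun_state.
- apply: (measurable_fun_pieces measurable_in_cycle cov measurable_vertex) => k z.
  exact: cur_process.
- apply: (measurable_fun_pieces measurable_in_cycle cov (fun k => measurable_vertex k.+1)) => k z.
  exact: nxt_process.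
- apply: (@measurable_fun_pieces _ _ _ _ _
    (fun k z => (t z - jump_time (X z) (V z) k) / cycle_length (X z) (V z) k)
    _ measurable_in_cycle cov) => [k|k z]; last exact: phase_process.
  apply: measurable_funM; first by apply: measurable_funB => //; exact: measurable_jump_time.
  (* Lengths are at least 1, so the inverse factors through the monotone function
     [- (Num.max 1 u)^-1], which is measurable. *)
  rewrite (_ : (fun z => _) =
      (fun u => - (Num.max 1 u)^-1) \o (fun z => cycle_length (X z) (V z) k) \; -%R).
    apply: measurable_funN; apply: measurableT_comp (measurable_cycle_length k).
    apply: nondecreasing_measurable => // a b ab; rewrite lerN2 lef_pV2 ?posrE.
    - by rewrite ge_max !le_max lexx ab orbT.
    - by rewrite lt_max ltr01.
    - by rewrite lt_max ltr01.
  apply/funext => z /=; rewrite opprK; congr (_^-1).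
  by apply/esym/max_r; exact: cycle_length_ge1.
Qed.

End measurability.

(** Sample points carry the initial state, so that one process serves all initial states;
    [path_law x] is the Dirac mass at [x] times the coin measure. *)
Definition path_law (x : BS) : {measure set (BS * coins) -> \bar R} :=
  image_measure (@coin_measure R) (pair1_measurable x).

Lemma path_lawE x A : path_law x A = coin_measure [set v | A (x, v)].
Proof. by []. Qed.

Let path_law_kernel (U : set (BS * coins)) : measurable U ->
  measurable_fun [set: BS] (path_law ^~ U).
Proof.
move=> mU; have := measurable_fun_xsection (@coin_measure R) mU.
apply: eq_measurable_fun => x _ /=; rewrite path_lawE; congr coin_measure.
by apply/seteqP; split => v /=; rewrite xsectionP.
Qed.

HB.instance Definition _ := isKernel.Build _ _ BS (BS * coins)%type R path_law path_law_kernel.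

Let path_lawT x : path_law x setT = 1%E.
Proof. by rewrite path_lawE coin_measureT. Qed.

HB.instance Definition _ := Kernel_isProbability.Build _ _ _ _ _ path_law path_lawT.

End process.

Opaque process.

(** * Stopping a right-continuous process *)

Section raw_filtration.
Context {R : realType} {d} {Om : measurableType d}.
Local Notation S := (state R).
Local Notation BS := (borel S).
Variable X : R -> Om -> S.

(** The sets that do not separate [w] from [w'] form a sigma-algebra, which contains the
    generators. *)
Lemma sigma_process_agree (O : Type) (Y : R -> O -> S) (I : set R) A (w w' : O) :
  sigma_process Y I A -> (forall s, I s -> Y s w = Y s w') -> A w <-> A w'.
Proof.
move=> sA ww'; suff : [set B | B w <-> B w'] A by [].
apply: sA; split; last first.
  move=> _ [s Is [B mB <-]]; rewrite /= /preimage /= (ww' _ Is) //.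
split => //= [B BP|F FP]; last by split=> -[n _ Fn]; exists n => //; apply/FP.
by split=> -[_ H]; split=> // Bw; apply: H; apply/BP.
Qed.

Lemma path_event_agree (B : set (R -> S)) p q :
  path_event B -> (forall s, 0 <= s -> p s = q s) -> B p <-> B q.
Proof.
move=> mB pq; apply: (sigma_process_agree mB) => s /=.
by rewrite in_itv /= andbT; exact: pq.
Qed.

Lemma sigma_process_sub (I J : set R) A : I `<=` J ->
  sigma_process X I A -> sigma_process X J A.
Proof.
move=> IJ; apply: sub_smallest2r; first exact: smallest_sigma_algebra.
by move=> D [s Is H]; exists s => //; exact: IJ.
Qed.

Lemma past_le s t A : s <= t -> past X s A -> past X t A.
Proof.
move=> st; apply: sigma_process_sub => u /=; rewrite !in_itv /= => /andP[-> us].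
exact: le_trans us st.
Qed.

Lemma past_future t A : past X t A -> future X 0 A.
Proof.
by apply: sigma_process_sub => u /=; rewrite !in_itv /= => /andP[-> _].
Qed.

Lemma past_state s t (D : set S) : 0 <= s <= t -> measurable (D : set BS) ->
  past X t [set w | D (X s w)].
Proof.
move=> st mD; apply: sub_sigma_algebra; exists s; first by rewrite /= in_itv.
by exists D => //; rewrite setTI.
Qed.

Lemma past_optional_lt T s t : optional_time X T -> 0 <= t -> s <= t ->
  past X t [set w | (T w < s%:E)%E].
Proof.
move=> [T0 mT] t0 st; have [s0|s0] := leP 0 s; first exact: past_le st (mT _ s0).
rewrite (_ : [set _ | _] = set0); first exact: sigma_algebra0.
rewrite -subset0 => w /= /(le_lt_trans (T0 w)).
by rewrite lte_fin ltNge (ltW s0).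
Qed.

Lemma optional_time_fin T w : optional_time X T -> (T w < +oo)%E ->
  exists2 r, 0 <= r & T w = r%:E.
Proof.
move=> [/(_ w) + _]; case: (T w) => [r|//|//]; rewrite lee_fin => r0 _.
by exists r.
Qed.

Lemma optional_time_lty T : optional_time X T ->
  [set w | (T w < +oo)%E] = \bigcup_n [set w | (T w < n%:R%:E)%E].
Proof.
move=> oT; apply/seteqP; split => w /=; last first.
  by case=> n _ /= /lt_trans; apply; exact: ltry.
move=> /(optional_time_fin oT)[r r0 Tw]; exists (Num.truncn r).+1 => //=.
by rewrite Tw lte_fin truncnS_gt.
Qed.

Section agreement.
Variables (T : Om -> \bar R) (w w' : Om) (b : R).
Hypotheses (oT : optional_time X T) (ww' : forall s, 0 <= s < b -> X s w = X s w').
Hypothesis (Tb : (T w < b%:E)%E).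

Lemma past_agree t A : t < b -> past X t A -> A w <-> A w'.
Proof.
move=> tb pA; apply: (sigma_process_agree pA) => s /=; rewrite in_itv /=.
by move=> /andP[s0 st]; apply: ww'; rewrite s0 (le_lt_trans st).
Qed.

(** Galmarino's test. For an optional time the paths must agree slightly beyond [T w], whence the
    bound [b] above it: for each [q < b] the event [T < q] belongs to a past on which the two paths
    coincide. *)
Lemma optional_time_agree : T w' = T w.
Proof.
have [r r0 Tw] := optional_time_fin oT (lt_trans Tb (ltry b)); move: (Tb); rewrite Tw lte_fin => rb.
pose t := (r + b) / 2; have [rt tb] : r < t /\ t < b by split; rewrite /t; lra.
have t0 : 0 <= t by exact: le_trans r0 (ltW rt).
have [h _] := past_agree tb (oT.2 _ t0).
have Tt : (T w' < t%:E)%E by apply: h; rewrite /= Tw lte_fin.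
have [r' r'0 Tw'] := optional_time_fin oT (lt_trans Tt (ltry t)).
rewrite Tw'; rewrite Tw' lte_fin in Tt.
have H q : 0 <= q -> q < b -> (r < q) <-> (r' < q).
  by move=> q0 qb; have /= := past_agree qb (oT.2 _ q0); rewrite Tw Tw' !lte_fin.
have [rr|rr|-> //] := ltgtP r' r.
  by have /H := rr => /(_ r0 rb); rewrite ltxx.
by have /H := rr => /(_ r'0 (lt_trans Tt tb)); rewrite ltxx.
Qed.

(** Cutting [A] by [T < t], with [t] strictly between [T w] and [b], gives an event of the past of
    [t]. *)
Lemma past_optional_agree A : past_optional X T A -> A w -> A w'.
Proof.
move=> [_ pA] Aw; have [r r0 Tw] := optional_time_fin oT (lt_trans Tb (ltry b)); move: (Tb); rewrite Tw lte_fin => rb.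
pose t := (r + b) / 2; have [rt tb] : r < t /\ t < b by split; rewrite /t; lra.
have t0 : 0 <= t by exact: le_trans r0 (ltW rt).
have [h _] := past_agree tb (pA _ t0).
by have [|//] := h; split=> //=; rewrite Tw lte_fin.
Qed.

End agreement.

Hypothesis cX : forall w, cadlag (path_of X w).

(** Closed approximations of an open set from inside: membership passes to limits without leaving
    [U]. *)
Let inner (U : set S) m : set S :=
  [set s | forall s', ~ U s' -> m.+1%:R^-1 <= tdist s s'].

Let measurable_inner U m : measurable (inner U m : set BS).
Proof.
rewrite -[X in measurable X]setCK; apply: measurableC; apply: sub_sigma_algebra.
apply/open_ballP => s /=; rewrite /inner /= => /existsNP[s' /not_implyP[Us']].
move=> /negP; rewrite -ltNge => ss'; exists (m.+1%:R^-1 - tdist s s').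
  by rewrite subr_gt0.
move=> t st /(_ _ Us'); apply/negP; rewrite -ltNge.
apply: le_lt_trans (tdist_triangle s t s') _.
by rewrite (tdist_sym t s) -ltrBrDr.
Qed.

Let right_near w r e : 0 <= r -> 0 < e ->
  exists2 e', 0 < e' & forall s, r < s < r + e' -> tdist (X r w) (X s w) < e.
Proof.
move=> r0 e0; have [/cvg_tdistP/(_ _ e0) + _] := cX w r0.
move=> [e' /= e'0 H]; exists e' => // s /andP[rs se].
by apply: H => //=; rewrite distrC gtr0_norm ?subr_gt0 // ltrBlDl.
Qed.

(** For an open set [U], right-continuity expresses the event by the states at countably many times
    before [t]; Borel sets follow since the good sets form a sigma-algebra. *)
Lemma past_stopped_state T t (D : set S) : optional_time X T ->
  measurable (D : set BS) -> 0 <= t ->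
  past X t ([set w | (T w < t%:E)%E] `&` [set w | D (X (fine (T w)) w)]).
Proof.
move=> oT mD t0.
pose G := \bigcup_(s in `[0, t]%classic) preimage_set_system setT (X s) <<s @open S >>.
pose Omt := g_sigma_algebraType G.
have pastE A : past X t A = measurable (A : set Omt) by [].
have mlt s : s <= t -> measurable ([set w | (T w < s%:E)%E] : set Omt).
  by move=> st; rewrite -pastE; exact: past_optional_lt.
have sU (U : set S) : open U -> past X t
    ([set w | (T w < t%:E)%E] `&` [set w | U (X (fine (T w)) w)]).
  move=> oU; rewrite pastE.
  (* If [q] is in []T, T + 1/(k+1)]] and below [t], then the state at [q] is in [inner U m]. The
     state at [T] is in [U] exactly when, for some [m] and [k], this holds for all rational [q]. *)
  pose Q m k (q : rat) : set Omt := if 0 <= (ratr q : R) < t then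
      ~` [set w | (T w < (ratr q)%:E)%E] `|`
      [set w | (T w < (ratr q - k.+1%:R^-1)%:E)%E] `|`
      [set w | inner U m (X (ratr q) w)] else setT.
  rewrite (_ : _ `&` _ = [set w | (T w < t%:E)%E] `&`
     \bigcup_m \bigcup_k \bigcap_(q in [set: rat]) Q m k q).
    apply: measurableI; first exact: mlt.
    apply: bigcupT_measurable => m; apply: bigcupT_measurable => k.
    rewrite -[X in measurable X]setCK setC_bigcap; apply: measurableC.
    apply: bigcupT_measurable_rat => q; apply: measurableC; rewrite /Q.
    case: ifP => [/andP[q0 qt]|_]; last exact: measurableT.
    apply: measurableU; first apply: measurableU.
    - by apply: measurableC; apply: mlt; exact: ltW.
    - by apply: mlt; rewrite lerBlDr ltW // ltr_wpDr.
    - rewrite -pastE; apply: past_state (measurable_inner U m).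
      by rewrite q0 ltW.
  apply/seteqP; split => w [/= Tt H]; split => //.
    have [r r0 Tw] := optional_time_fin oT (lt_trans Tt (ltry t)).
    move: Tt H; rewrite Tw lte_fin /= => rt Ur; move/open_ballP: oU => /(_ _ Ur)[e e0 eU].
    have [m] : exists m : nat, m.+1%:R^-1 < e / 2.
      have [m] : exists m : nat, 0 + m.+1%:R^-1 < e / 2.
        by apply: ltr_add_invr; rewrite divr_gt0.
      by rewrite add0r; exists m.
    move=> me; have [e' e'0 re'] := right_near w r0 (divr_gt0 e0 (ltr0n _ 2)).
    have [k] : exists k : nat, 0 + k.+1%:R^-1 < e' by exact: ltr_add_invr.
    rewrite add0r => ke'; exists m => //; exists k => // q _; rewrite /Q.
    case: ifP => // /andP[q0 qt]; rewrite /= Tw !lte_fin.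
    have [rq|] := ltP r (ratr q); last by move=> _; left; left.
    have [rk|rk] := ltP r (ratr q - k.+1%:R^-1); first by left; right.
    right => s' Us'.
    have h1 : tdist (X r w) (X (ratr q) w) < e / 2 by apply: re'; rewrite rq /=; move: rk ke'; move: (_^-1) => a; lra.
    have h2 : e <= tdist (X r w) s'.
      by rewrite leNgt; apply/negP => /eU.
    have := tdist_triangle (X (ratr q) w) (X r w) s'; move: me.
    by move: (_^-1) => a; lra.
  case: H => m _ [k _ H].
  have [r r0 Tw] := optional_time_fin oT (lt_trans Tt (ltry t)).
  move: Tt; rewrite Tw lte_fin /= => rt; apply: contrapT => nU.
  have k0 : 0 < k.+1%:R^-1 :> R by rewrite invr_gt0.
  have m0 : 0 < m.+1%:R^-1 :> R by rewrite invr_gt0.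
  have [e' e'0 re'] := right_near w r0 m0.
  have : r < Num.min t (Num.min (r + k.+1%:R^-1) (r + e')).
    by rewrite !lt_min rt !ltrDl k0.
  move=> /rat_in_itvoo[q]; rewrite in_itv /= !lt_min => /andP[rq /and3P[qt qk qe]].
  have q0 : 0 <= ratr q :> R by rewrite (le_trans r0) // ltW.
  have := H q I; rewrite /Q q0 qt /= Tw !lte_fin => -[[]|].
  - by rewrite rq.
  - by rewrite ltNge => /negP; apply; rewrite lerBlDr ltW.
  - move=> /(_ _ nU); rewrite leNgt => /negP; apply.
    by rewrite tdist_sym; apply: re'; rewrite rq.
suff : <<s @open S >> `<=` [set D | past X t
    ([set w | (T w < t%:E)%E] `&` [set w | D (X (fine (T w)) w)])] by exact.
apply: smallest_sub => //; split => /=.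
- rewrite (_ : _ `&` _ = set0); first by rewrite pastE; exact: measurable0.
  by apply/seteqP; split => w // [].
- move=> A; rewrite !pastE => mA.
  rewrite (_ : _ `&` _ = [set w | (T w < t%:E)%E] `\`
    ([set w | (T w < t%:E)%E] `&` [set w | A (X (fine (T w)) w)])).
    by apply: measurableD => //; exact: mlt.
  apply/seteqP; split => w /= [h1 h2].
    by split=> // -[_ h3]; case: h2.
  by split=> //; split=> // h3; apply: h2.
- move=> F mF; rewrite pastE.
  rewrite (_ : _ `&` _ = \bigcup_k ([set w | (T w < t%:E)%E] `&` [set w | F k (X (fine (T w)) w)])).
    by apply: bigcupT_measurable => k; rewrite -pastE.
  apply/seteqP; split => [w [h1 [k _ Fk]]|w [k _ [h1 h2]]]; first by exists k.
  by split=> //; exists k.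
Qed.

Lemma past_optional_stopped T (h : BS -> R) (Y : set R) : optional_time X T ->
  measurable_fun setT h -> measurable Y ->
  past_optional X T
    ((fun w => if (T w < +oo)%E then h (X (fine (T w)) w) else 0) @^-1` Y).
Proof.
move=> oT mh mY; set f := fun w => _.
have ft t : 0 <= t -> past X t (f @^-1` Y `&` [set w | (T w < t%:E)%E]).
  move=> t0; rewrite (_ : _ `&` _ = [set w | (T w < t%:E)%E] `&`
      [set w | (h @^-1` Y) (X (fine (T w)) w)]).
    by apply: past_stopped_state => //; exact: measurable_preimageT mh mY.
  apply/seteqP; split => w; rewrite /preimage /f /=.
    by move=> [+ Tt]; rewrite (lt_trans Tt (ltry t)).
  by move=> [Tt hY]; rewrite (lt_trans Tt (ltry t)).
split=> //.
pose G := \bigcup_(s in `[0, +oo[%classic) preimage_set_system setT (X s) <<s @open S >>.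
pose Omt := g_sigma_algebraType G.
have futE A : future X 0 A = measurable (A : set Omt) by [].
have TooE := optional_time_lty oT.
have mToo : measurable ([set w | (T w < +oo)%E] : set Omt).
  rewrite TooE; apply: bigcupT_measurable => n; rewrite -futE.
  by apply: (past_future (t := n%:R)); exact: oT.2.
rewrite futE (_ : _ @^-1` _ =
   (\bigcup_n (f @^-1` Y `&` [set w | (T w < n%:R%:E)%E])) `|`
   (if `[< Y 0 >] then ~` [set w | (T w < +oo)%E] else set0)).
  apply: measurableU.
    apply: bigcupT_measurable => n; rewrite -futE.
    by apply: (past_future (t := n%:R)); exact: ft.
  by case: ifP => _; [exact: measurableC|exact: measurable0].
rewrite -setI_bigcupr -TooE; apply/seteqP; split => w.
  move=> fY; have [Tw|Tw] := boolP (T w < +oo)%E; first by left.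
  right; move: fY; rewrite /preimage /f /= (negbTE Tw) => Y0.
  by rewrite asboolT //=; apply/negP.
case=> [[]//|]; case: asboolP => // Y0 /negP Tw.
by rewrite /preimage /f /= (negbTE Tw).
Qed.

Hypothesis mX : forall t, 0 <= t -> measurable_fun setT (X t : Om -> BS).

Lemma future_measurable A : future X 0 A -> measurable A.
Proof.
suff : future X 0 `<=` measurable by exact.
apply: smallest_sub; first exact: sigma_algebra_measurable.
move=> _ [s /= + [B mB <-]]; rewrite in_itv /= andbT => s0.
exact: mX.
Qed.

Lemma measurable_path_event (B : set (R -> S)) :
  path_event B -> measurable (path_of X @^-1` B).
Proof.
suff : path_event `<=` [set B | measurable (path_of X @^-1` B)] by exact.
apply: smallest_sub; first split.
- by rewrite /= preimage_set0; exact: measurable0.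
- by move=> A mA /=; rewrite setTD preimage_setC; exact: measurableC.
- by move=> F mF /=; rewrite preimage_bigcup; exact: bigcupT_measurable.
move=> _ [s /= + [D mD <-]]; rewrite in_itv /= andbT setTI => s0.
exact: measurable_preimageT (mX s0) mD.
Qed.

Lemma measurable_fine_optional T : optional_time X T ->
  measurable_fun setT (fine \o T : Om -> R) /\ measurable [set w | (T w < +oo)%E].
Proof.
move=> oT; have mlt t : measurable [set w | (T w < t%:E)%E].
  have [t0|t0] := leP 0 t.
    by apply: future_measurable; exact: (past_future (oT.2 _ t0)).
  rewrite (_ : [set _ | _] = set0); first exact: measurable0.
  rewrite -subset0 => w /= /(le_lt_trans (oT.1 w)).
  by rewrite lte_fin ltNge (ltW t0).
have TooE := optional_time_lty oT.
have mToo : measurable [set w | (T w < +oo)%E].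
  by rewrite TooE; apply: bigcupT_measurable.
split=> //; apply: (measurability _ (RGenInftyO.measurableE R)).
move=> _ [_ [x ->] <-]; rewrite setTI.
(* [fine] sends [+oo] to 0, so infinite times count as soon as [0 < x]. *)
rewrite (_ : _ @^-1` _ = [set w | (T w < x%:E)%E] `|`
    (if 0 < x then ~` [set w | (T w < +oo)%E] else set0)).
  apply: measurableU => //; case: ifP => _; [exact: measurableC|exact: measurable0].
suff H w : (fine (T w) < x) <-> ([set w | (T w < x%:E)%E] `|`
    (if 0 < x then ~` [set w | (T w < +oo)%E] else set0)) w.
  by apply/seteqP; split => w; rewrite /preimage /= in_itv /=; case: (H w).
have [Tw|Tw] := boolP (T w < +oo)%E.
  have [r r0 TwE] := optional_time_fin oT Tw; split.
    by rewrite TwE /= => rx; left; rewrite /= TwE lte_fin.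
  by case=> [|]; [rewrite /= TwE lte_fin|case: ifP => // _ []].
have TwE : T w = +oo%E by apply/eqP; rewrite -leye_eq leNgt.
split; first by rewrite TwE /= => x0; right; rewrite x0; apply/negP.
by case=> [|]; [rewrite /= TwE|rewrite TwE; case: ifP].
Qed.

End raw_filtration.

(** * Strong Markov property *)

Section strong_markov_process.
Context {R : realType}.
Local Notation S := (state R).
Local Notation BS := (borel S).
Local Notation mu := (@coin_measure R).
Implicit Types (x y : S) (u v : coins) (t s : R).

Lemma vertex_splice x v w k j : (j <= k.+1)%N ->
  vertex x (splice k v w) j = vertex x v j.
Proof. by case: j => [|[|j]] // jk; rewrite [LHS]draw_splice; have -> : (j < k)%N by []. Qed.

Lemma jump_time_splice x v w k j : (j <= k.+1)%N ->
  jump_time x (splice k v w) j = jump_time x v j.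
Proof.
elim: j => [//|j IH jk]; have jk' := ltnW jk.
by congr (_ + duration _ _); [exact: IH|exact: vertex_splice|exact: vertex_splice].
Qed.

Lemma in_cycle_lt x v j k s : in_cycle x v j s -> s < jump_time x v k.+1 -> (j <= k)%N.
Proof.
move=> /andP[js _] sk; rewrite leqNgt; apply/negP => /(jump_time_le x v).
have : 0 <= (j - k.+1)%:R :> R by [].
by move: (_%:R) => n; lra.
Qed.

(** The first two vertices come from the initial state, so vertices and jump times up to [k.+1] are
    functions of the first [k] blocks. *)
Lemma process_splice x v w k s : 0 <= s < jump_time x v k.+1 ->
  process s (x, splice k v w) = process s (x, v).
Proof.
move=> /andP[s0 sk]; have js := cycle_numberP x v s0.
set j := cycle_number x v s in js; have jk := in_cycle_lt js sk.
have js' : in_cycle x (splice k v w) j s.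
  by rewrite /in_cycle !jump_time_splice // ltnW.
rewrite (processE js) (processE js') /position /cycle_length.
by rewrite !vertex_splice ?jump_time_splice // ltnW.
Qed.

Lemma cadlag_process_process : cadlag_process (@process R).
Proof.
split=> [t t0|w]; last exact: cadlag_process_path.
have := measurable_process (@measurable_fst _ _ BS coins)
  (@measurable_snd _ _ BS coins) (measurable_cst t) (fun=> t0).
by apply: eq_measurable_fun => -[x v] _.
Qed.

Lemma path_law_fin y (A : set (BS * coins)) : measurable A ->
  path_law y A \is a fin_num.
Proof.
move=> mA; rewrite path_lawE; apply: fin_num_measure.
exact: (measurable_preimageT (f := fun v : coins => (y, v) : BS * coins)
  (pair1_measurable (y : BS)) mA).
Qed.

Section optional.
Variables (T : BS * coins -> \bar R).
Hypothesis oT : optional_time (@process R) T.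

Let mX := cadlag_process_process.1.

Let tau z : R := fine (T z).

Let tau_ge0 w : 0 <= tau w.
Proof. by rewrite /tau fine_ge0 //; exact: oT.1. Qed.

Let measurable_tau : measurable_fun setT tau.
Proof. exact: (measurable_fine_optional mX oT).1. Qed.

Let stopped z : BS := process (tau z) z.

Let measurable_stopped : measurable_fun setT stopped.
Proof.
have := measurable_process (@measurable_fst _ _ BS coins)
  (@measurable_snd _ _ BS coins) measurable_tau tau_ge0.
by apply: eq_measurable_fun => -[x v] _.
Qed.

(** The number of blocks used up by time [T] is random; sorting by the cycle that contains [T] makes
    it a constant [k]. *)
Let piece (C : set (BS * coins)) x k : set coins :=
  [set v | [/\ C (x, v), (T (x, v) < +oo)%E & in_cycle x v k (tau (x, v))]].

Let measurable_pair x : measurable_fun setT (fun v : coins => (x, v) : BS * coins).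
Proof. exact: pair1_measurable. Qed.

Let measurable_piece C x k : measurable C -> measurable (piece C x k).
Proof.
move=> mC; rewrite (_ : piece C x k = (pair x @^-1` C) `&`
  (pair x @^-1` [set w | (T w < +oo)%E]) `&` [set v | in_cycle x v k (tau (x, v))]).
  apply: measurableI; first apply: measurableI.
  - exact: measurable_preimageT (measurable_pair x) mC.
  - apply: measurable_preimageT (measurable_pair x) _.
    exact: (measurable_fine_optional mX oT).2.
  - apply: (measurable_in_cycle (X := fun=> x) (V := id)).
    + exact: (measurable_cst (x : BS)).
    + exact: measurable_id.
    + exact: measurableT_comp measurable_tau (measurable_pair x).
by apply/seteqP; split => v [] //= [].
Qed.

(** Changing the coins after block [k] does not alter the path before the end of cycle [k], which
    comes strictly after [T]; Galmarino's test applies with that end as [b]. *)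
Let piece_splice C x k v w : past_optional (@process R) T C ->
  piece C x k v ->
  [/\ piece C x k (splice k v w), tau (x, splice k v w) = tau (x, v) &
      stopped (x, splice k v w) = stopped (x, v)].
Proof.
move=> pC [Cv Tv kv].
have [r r0 TE] := optional_time_fin oT Tv.
have tE : tau (x, v) = r by rewrite /tau TE.
have /andP[k1 k2] := kv; rewrite tE in k1 k2.
have agr s : 0 <= s < jump_time x v k.+1 ->
  process s (x, v) = process s (x, splice k v w).
  by move=> /(process_splice w) ->.
have Tb : (T (x, v) < (jump_time x v k.+1)%:E)%E by rewrite TE lte_fin.
have TE' := optional_time_agree oT agr Tb.
have tE' : tau (x, splice k v w) = tau (x, v) by rewrite /tau TE'.
split; [|exact: tE'|].
  split; [exact: (past_optional_agree oT agr Tb pC)|by rewrite TE'|].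
  rewrite tE' /in_cycle !jump_time_splice; [exact: kv|exact: leqnn|exact: leqnSn].
rewrite /stopped tE'; apply: process_splice.
by rewrite tau_ge0 tE.
Qed.

Let piece_splice_iff C x k v w : past_optional (@process R) T C ->
  piece C x k (splice k v w) <-> piece C x k v.
Proof.
move=> pC; split=> [H|/(piece_splice w pC)[]//].
(* Splicing the original tail back in restores [v]. *)
have := piece_splice (iter k odd_coins v) pC H.
suff -> : splice k (splice k v w) (iter k odd_coins v) = v by case.
elim: k v {H} => // k IH v; rewrite /= even_interleave odd_interleave.
by rewrite -iterS iterSr IH interleaveK.
Qed.

Lemma shift_by_process x v k s : (T (x, v) < +oo)%E -> in_cycle x v k (tau (x, v)) ->
  0 <= s -> shift_by (fine \o T) (@process R) (x, v) s =
            process s (stopped (x, v), iter k odd_coins v).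
Proof. by move=> _ kv s0; rewrite /shift_by /=; exact: process_shift. Qed.

(** With the first [k] blocks frozen, the piece and the state at [T] are fixed, and the fresh coins
    drive the process started there. *)
Let markov_piece C x k (B : set (R -> S)) : past_optional (@process R) T C ->
  path_event B ->
  mu (piece C x k `&` [set v | B (path_of (@process R) (stopped (x, v), iter k odd_coins v))])
  = (\int[mu]_(v in piece C x k) path_law (stopped (x, v)) (path_of (@process R) @^-1` B))%E.
Proof.
move=> pC pB; have mC : measurable C by exact: (future_measurable mX pC.1).
have mB := measurable_path_event mX pB.
have mst : measurable_fun setT (fun v : coins => stopped (x, v)).
  exact: measurableT_comp measurable_stopped (measurable_pair x).
rewrite (coin_measure_splice k); last first.
  apply: measurableI; first exact: measurable_piece.
  apply: (measurable_preimageT (f := fun v : coins => (stopped (x, v), iter k odd_coins v)) _ mB).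
  by apply/measurable_fun_pairP; split => //; exact: measurable_iter_odd.
rewrite [RHS]integral_mkcond; apply: eq_integral => v _.
rewrite /patch; case: ifPn => [/set_mem pv|/negP nv].
  rewrite path_lawE; congr (mu _); apply/seteqP; split => w /=.
    by case=> _; rewrite iter_odd_splice; have [_ _ ->] := piece_splice w pC pv.
  have [pw _ sE] := piece_splice w pC pv.
  by move=> Bw; split; [exact: pw|rewrite sE iter_odd_splice].
rewrite (_ : [set _ | _] = set0) ?measure0 // -subset0 => w [/piece_splice_iff pv _].
by apply: nv; apply/mem_set; exact: pv.
Qed.

Lemma strong_markov_integral C x (B : set (R -> S)) : past_optional (@process R) T C ->
  path_event B ->
  (\int[path_law x]_(w in C) (if (T w < +oo)%E
      then fine (path_law (stopped w) (path_of (@process R) @^-1` B)) else 0)%:E =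
   path_law x (([set w | (T w < +oo)%E] `&` shift_by (fine \o T) (@process R) @^-1` B) `&` C))%E.
Proof.
move=> pC pB; have mC : measurable C by exact: (future_measurable mX pC.1).
have mB := measurable_path_event mX pB.
pose f z : R := if (T z < +oo)%E
  then fine (path_law (stopped z) (path_of (@process R) @^-1` B)) else 0.
transitivity (\int[path_law x]_(w in C) (f w)%:E)%E; first by [].
have mh : measurable_fun [set: BS] (fun y => fine (path_law y (path_of (@process R) @^-1` B))).
  apply: measurableT_comp (measurable_kernel (@path_law R) _ mB).
  exact: fine_measurable.
have mf : measurable_fun setT f.
  move=> _ Y mY; rewrite setTI.
  have := past_optional_stopped (@cadlag_process_path R) oT mh mY.
  by move=> [/(future_measurable mX) + _].
have f0 z : 0 <= f z by rewrite /f; case: ifP => // _; rewrite fine_ge0.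
have mCx : measurable (pair x @^-1` C).
  exact: measurable_preimageT (measurable_pair x) mC.
rewrite (ge0_integral_pushforward (measurable_pair x) mu mC); last 2 first.
- by apply/measurable_EFinP; exact: measurable_funTS.
- by move=> w _; rewrite lee_fin.
have piece_cover : \bigcup_k piece C x k = pair x @^-1` (C `&` [set w | (T w < +oo)%E]).
  apply/seteqP; split => [v [k _ []] //|v [Cv Tv]].
  by exists (cycle_number x v (tau (x, v))) => //; split => //; exact: cycle_numberP.
have piece_triv : trivIset setT (piece C x).
  apply/trivIsetP => i j _ _ ij; rewrite -subset0 => v [[_ _ iv] [_ _ jv]].
  by move/eqP: ij; apply; exact: in_cycle_uniq iv jv.
have mpiece k : measurable (piece C x k) by exact: measurable_piece.
have mfx : measurable_fun setT (fun v : coins => (f (x, v))%:E).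
  by apply/measurable_EFinP; exact: measurableT_comp mf (measurable_pair x).
transitivity (\int[mu]_(v in \bigcup_k piece C x k) (f (x, v))%:E)%E.
  rewrite [LHS]integral_mkcond [RHS]integral_mkcond; apply: eq_integral => v _.
  rewrite /patch; case: ifPn => [/set_mem Cv|/negP nC]; case: ifPn => [/set_mem|/negP nU] //.
    rewrite /f /=; case: ifP => // Tv; case: nU; apply/mem_set.
    by rewrite piece_cover.
  by rewrite piece_cover => -[Cv _]; case: nC; apply/mem_set.
rewrite ge0_integral_bigcup //; [|exact: measurable_funTS|by move=> v _; rewrite lee_fin].
rewrite path_lawE.
rewrite (_ : [set v | _] = \bigcup_k (piece C x k `&`
    [set v | B (path_of (@process R) (stopped (x, v), iter k odd_coins v))])).
  rewrite measure_bigcup //=; last 2 first.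
  - move=> k _; apply: measurableI; first exact: mpiece.
    apply: (measurable_preimageT (f := fun v : coins => (stopped (x, v), iter k odd_coins v)) _ mB).
    apply/measurable_fun_pairP; split; last exact: measurable_iter_odd.
    exact: measurableT_comp measurable_stopped (measurable_pair x).
  - exact: trivIset_setIr.
  rewrite [RHS](eq_eseriesl (Q := xpredT)); last by move=> k; exact: in_setT.
  apply: eq_eseriesr => k _; rewrite (markov_piece _ _ pC pB); apply: eq_integral => v.
  move=> /set_mem[_ Tv _]; rewrite /f Tv fineK; first by [].
  exact: (path_law_fin _ mB).
apply/seteqP; split => v /=.
  move=> [[Tv Bv] Cv]; exists (cycle_number x v (tau (x, v))); first exact: I.
  have kv := cycle_numberP x v (tau_ge0 (x, v)); split; first by split.
  rewrite /=.
  apply: (iffLR (path_event_agree pB _)) Bv => s s0.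
  exact: (shift_by_process Tv kv).
move=> [k _ [[Cv Tv kv] Bv]]; split; last exact: Cv.
split; first exact: Tv.
apply: (iffRL (path_event_agree pB _)) Bv => s s0.
exact: (shift_by_process Tv kv).
Qed.

End optional.

Lemma fine_path_law y (A : set (BS * coins)) : measurable A ->
  0 <= fine (path_law y A) <= 1.
Proof.
move=> mA; apply/andP; split; first by rewrite fine_ge0.
rewrite -lee_fin (fineK (path_law_fin y mA)) path_lawE; apply: probability_le1.
exact: (measurable_preimageT (f := fun v : coins => (y, v) : BS * coins)
  (pair1_measurable (y : BS)) mA).
Qed.

Lemma strong_markov_process : strong_markov (@path_law R) (@process R).
Proof.
split; first exact: cadlag_process_process.
  move=> x; rewrite path_lawE (_ : [set _ | _] = setT) ?coin_measureT //.
  by apply/seteqP; split => // v _ /=; exact: process0.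
move=> x T B oT pB; have mB := measurable_path_event cadlag_process_process.1 pB.
have mh : measurable_fun [set: BS] (fun y => fine (path_law y (path_of (@process R) @^-1` B))).
  apply: measurableT_comp (measurable_kernel (@path_law R) _ mB).
  exact: fine_measurable.
split.
- move=> Y mY; exact: (past_optional_stopped (@cadlag_process_path R) oT mh mY).
- apply: (@measurable_bounded_integrable _ _ _ (path_law x)) => //.
  + by rewrite path_lawE coin_measureT ltry.
  + move=> _ Y mY; rewrite setTI.
    have := past_optional_stopped (@cadlag_process_path R) oT mh mY.
    by move=> [/(future_measurable cadlag_process_process.1) + _].
  + exists 1; split; first exact: num_real.
    move=> M M1 w _; apply: le_trans (ltW M1); rewrite /mkset.
    case: ifP => _; last by rewrite normr0 ler01.
    by have /andP[h0 h1] := fine_path_law (process (fine (T w)) w) mB; rewrite ger0_norm.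
- by move=> C pC; exact: strong_markov_integral.
Qed.

End strong_markov_process.

(** * Harris recurrence *)

Section harris.
Context {R : realType}.
Local Notation S := (state R).
Local Notation BS := (borel S).
Local Notation mu := (@coin_measure R).
Local Notation leb := (@lebesgue_measure R).
Implicit Types (x y : S) (u v w : nat -> bool) (t s : R).

Lemma coin_measure_draw_law k (K : set R) : measurable K ->
  mu [set v | K (draw k v)] = leb (K `&` `[0, 1[).
Proof.
move=> mK.
have mr : measurable ((@real_of_coins R) @^-1` K : set coins).
  exact: measurable_preimageT measurable_real_of_coins mK.
transitivity (mu (@real_of_coins R @^-1` K)).
  have me := measurable_preimageT measurable_even_coins mr.
  by rewrite -(coin_measure_even mr) -(coin_measure_iter_odd k me).
rewrite /coin_measure /pushforward /mrestr; congr (leb _).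
apply/seteqP; split => r [Kr r01]; split=> //; move: Kr; rewrite /preimage /=.
  by rewrite real_of_binary_digit // -in_itv.
by rewrite real_of_binary_digit // -in_itv.
Qed.

(** The image of Lebesgue measure under [a + g * t], scaled by [g], gives intervals their length,
    hence is Lebesgue measure. *)
Lemma lebesgue_measure_affine (a g : R) (K : set R) : 0 < g -> measurable K ->
  leb [set t | K ((t - a) / g)] = (g%:E * leb K)%E.
Proof.
move=> g0 mK; pose h (t : R) : R := a + g * t.
have mh : measurable_fun [set: measurableTypeR R]
    (h : measurableTypeR R -> measurableTypeR R).
  apply: measurable_funD; first exact: measurable_cst.
  by apply: measurable_funM; first exact: measurable_cst.
pose m : {measure set (measurableTypeR R) -> \bar R} :=
  mscale (NngNum (ltW g0)) (image_measure leb mh).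
have mE A : m A = (g%:E * leb (h @^-1` A))%E by [].
have E A : measurable A -> leb A = m A.
  apply: (lebesgue_measure_unique (mu := m)) => _ [[b c] _ <-].
  rewrite mE (_ : _ @^-1` _ = [set` `]((b - a) / g)%R, ((c - a) / g)%R]]); last first.
    apply/seteqP; split => t; rewrite /preimage /h /= !in_itv /= ltr_pdivrMr // ler_pdivlMr //;
    by rewrite ltrBlDl lerBrDl ![t * _]mulrC.
  rewrite !lebesgue_measure_itv /= !lte_fin ltr_pM2r ?invr_gt0 // ltrD2r.
  case: ifPn => bc; last by rewrite mule0.
  by rewrite -!EFinB -EFinM; congr (_%:E); field; rewrite lt0r_neq0.
have mk : measurable_fun [set: R] (fun t : R => (t - a) / g).
  by apply: measurable_funM => //; apply: measurable_funB.
rewrite E ?mE; last exact: measurable_preimageT mk mK.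
congr (_ * leb _)%E; apply/seteqP; split => t.
  by rewrite /preimage /h /= addrC addKr mulrAC divff ?mul1r ?lt0r_neq0.
by rewrite /preimage /h /= addrC addKr mulrAC divff ?mul1r ?lt0r_neq0.
Qed.

Definition fresh_state v : BS := mk (draw 0 v, draw 1 v, draw 2 v).

Let val_fresh_state v : val (fresh_state v) = (draw 0 v, draw 1 v, draw 2 v).
Proof. by rewrite mkK // /box !draw_itv. Qed.

Lemma measurable_fresh_state : measurable_fun [set: coins] fresh_state.
Proof.
apply: measurable_fun_state; rewrite /cur /nxt /phase.
- by apply: eq_measurable_fun (measurable_draw 0) => v _; rewrite val_fresh_state.
- by apply: eq_measurable_fun (measurable_draw 1) => v _; rewrite val_fresh_state.
- by apply: eq_measurable_fun (measurable_draw 2) => v _; rewrite val_fresh_state.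
Qed.

Definition fresh_law : set BS -> \bar R := image_measure mu measurable_fresh_state.

Let fresh_law0 : fresh_law set0 = 0%E.
Proof. exact: measure0. Qed.

Let fresh_law_ge0 A : (0 <= fresh_law A)%E.
Proof. exact: measure_ge0. Qed.

Let fresh_law_additive : semi_sigma_additive fresh_law.
Proof. exact: measure_semi_sigma_additive. Qed.

HB.instance Definition _ := isMeasure.Build _ _ _ fresh_law
  fresh_law0 fresh_law_ge0 fresh_law_additive.

Let fresh_lawT : fresh_law setT = 1%E.
Proof. exact: coin_measureT. Qed.

HB.instance Definition _ := Measure_isProbability.Build _ _ _ fresh_law fresh_lawT.

Lemma coin_measure_past_future n (D E : set coins) : measurable D -> measurable E ->
  (forall v w, D (splice n v w) <-> D v) ->
  mu (D `&` iter n odd_coins @^-1` E) = (mu D * mu E)%E.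
Proof.
move=> mD mE inv; have mEn : measurable (iter n odd_coins @^-1` E : set coins).
  exact: measurable_preimageT (measurable_iter_odd n) mE.
rewrite (coin_measure_splice n); last exact: measurableI.
transitivity (\int[mu]_(v in D) mu E)%E; last first.
  by rewrite integral_cst // muleC.
rewrite [RHS]integral_mkcond; apply: eq_integral => v _.
rewrite /patch; case: ifPn => [/set_mem Dv|/negP nD].
  congr (mu _); apply/seteqP; split => w /=; rewrite iter_odd_splice; first by case.
  by move=> Ew; split=> //; apply/inv.
rewrite (_ : [set _ | _] = set0) ?measure0 // -subset0 => w [/inv Dv _].
by apply: nD; apply/mem_set.
Qed.

(** [D] looks at the first [n] blocks only, so its shifts by multiples of [n] are independent, and
    the first [j] of them all fail with probability [mu N ^ j]. The same null event, shifted by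
    every [m], yields recurrence beyond every [m]. *)
Lemma recurrent_coins n (D : set coins) : measurable D -> (0 < n)%N ->
  (forall v w, D (splice n v w) <-> D v) -> (0 < mu D)%E ->
  {ae mu, forall v, forall m, exists k, (m <= k)%N /\ D (iter k odd_coins v)}.
Proof.
move=> mD n0 inv D0; pose N := ~` D : set coins.
have mN : measurable N by exact: measurableC.
have invN v w : N (splice n v w) <-> N v.
  by have [h1 h2] := inv v w; split=> h ?; apply: h; [exact: h2|exact: h1].
pose E j := [set v | forall i, (i < j)%N -> N (iter (i * n) odd_coins v)].
have ES j : E j.+1 = N `&` iter n odd_coins @^-1` E j.
  apply/seteqP; split => v /=.
    move=> Ev; split; first exact: (Ev 0%N).
    by move=> i ij; rewrite -iterD -mulSnr; exact: Ev.
  by move=> [N0 Ev] [|i] // ij; rewrite mulSnr iterD; exact: Ev.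
have mE j : measurable (E j : set coins).
  elim: j => [|j IH]; first by rewrite (_ : E 0%N = setT) //; apply/seteqP; split.
  rewrite ES; apply: measurableI => //.
  exact: measurable_preimageT (measurable_iter_odd n) IH.
have muE j : mu (E j) = ((fine (mu N)) ^+ j)%:E.
  elim: j => [|j IH].
    by rewrite (_ : E 0%N = setT) ?coin_measureT //; apply/seteqP; split.
  rewrite ES coin_measure_past_future // IH exprS EFinM fineK //.
  exact: fin_num_measure.
pose F := \bigcap_j E j.
have mF : measurable (F : set coins) by exact: bigcap_measurableType.
have F0 : mu F = 0%E.
  have N1 : `|fine (mu N)| < 1.
    rewrite ger0_norm ?fine_ge0 // -lte_fin fineK ?fin_num_measure //.
    by rewrite /N probability_setC // lteBlDr ?fin_num_measure // lteDl.
  apply/eqP; rewrite eq_le measure_ge0 andbT.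
  have c : ((fine (mu N)) ^+ j)%:E @[j --> \oo] --> 0%:E.
    by apply: cvg_EFin; [exact: nearW|exact: cvg_expr].
  suff : (mu F <= lim (((fine (mu N)) ^+ j)%:E @[j --> \oo]))%E by rewrite (cvg_lim _ c).
  apply: lime_ge; first by apply/cvg_ex; eexists; exact: c.
  by apply: nearW => j; rewrite -muE; apply: le_measure; rewrite ?inE //; exact: bigcap_inf.
exists (\bigcup_m iter m odd_coins @^-1` F); split.
- apply: bigcupT_measurable => m; exact: measurable_preimageT (measurable_iter_odd m) mF.
- apply/eqP; rewrite -measure_le0; apply: le_trans (measure_sigma_subadditive _ _ _ _) _.
  + move=> m; exact: measurable_preimageT (measurable_iter_odd m) mF.
  + apply: bigcupT_measurable => m; exact: measurable_preimageT (measurable_iter_odd m) mF.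
  + exact: subset_refl.
  + by rewrite eseries0 // => m _ _; exact: etrans (coin_measure_iter_odd m mF) F0.
- move=> v /= /existsNP[m Hm]; exists m => // j _ i ij Dv.
  apply: Hm; exists (i * n + m)%N; split; first exact: leq_addl.
  by rewrite iterD.
Qed.

Lemma nneseries_infinitely_often (h : nat -> \bar R) (e : R) : 0 < e ->
  (forall k, (0 <= h k)%E) -> (forall m, exists k, (m <= k)%N /\ (e%:E <= h k)%E) ->
  (\sum_(0 <= k <oo) h k = +oo)%E.
Proof.
move=> e0 h0 io.
have sums n : exists M, ((n%:R * e)%:E <= \sum_(0 <= k < M) h k)%E.
  elim: n => [|n [M IH]]; first by exists 0%N; rewrite big_geq // mul0r.
  have [k [Mk ek]] := io M; exists k.+1.
  rewrite (big_cat_nat (n := M)) //=; last exact: leq_trans Mk (leqnSn k).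
  rewrite big_nat_recr //= -natr1 mulrDl mul1r EFinD leeD //.
  by apply: le_trans ek _; rewrite leeDr // sume_ge0.
apply/eqyP => A A0; have [M HM] := sums (Num.truncn (A / e)).+1.
apply: (@le_trans _ _ (\sum_(0 <= k < M) h k)%E); last first.
  by apply: nneseries_lim_ge => k _ _.
apply: le_trans HM; rewrite lee_fin -ler_pdivrMr // ltW //.
exact: truncnS_gt.
Qed.

Let slice (A : set BS) u := mu [set w | A (fresh_state (splice 2 u w))].

(** The phase crosses [[0, 1[] at constant speed, so the time spent in [A] is the cycle length times
    the measure of a section of [A], which [slice] computes with a third uniform draw. From cycle 2
    on both vertices are draws. *)
Lemma visit_time x v k (A : set BS) : measurable A ->
  leb [set t | in_cycle x v k.+2 t /\ A (process t (x, v))] =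
  ((cycle_length x v k.+2)%:E * slice A (iter k odd_coins v))%E.
Proof.
move=> mA; pose wrap (r : R) := if (0 <= r) && (r < 1) then r else 0.
pose F r : BS := mk (draw k v, draw k.+1 v, wrap r).
have wrap_itv r : 0 <= wrap r < 1.
  by rewrite /wrap; case: ifP => // _; rewrite lexx ltr01.
have vF r : val (F r) = (draw k v, draw k.+1 v, wrap r).
  by rewrite mkK // /box /= !draw_itv wrap_itv.
have mF : measurable_fun [set: R] F.
  apply: measurable_fun_state; rewrite /cur /nxt /phase.
  - by apply: eq_measurable_fun (measurable_cst (draw k v)) => r _; rewrite vF.
  - by apply: eq_measurable_fun (measurable_cst (draw k.+1 v)) => r _; rewrite vF.
  - apply: eq_measurable_fun (_ : measurable_fun setT wrap) => [r _|]; first by rewrite vF.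
    apply: measurable_fun_if => //.
    by apply: measurable_and; apply: measurable_fun_ler || apply: measurable_fun_ltr.
have mK : measurable (F @^-1` A) by exact: measurable_preimageT mF mA.
have l0 := cycle_length_gt0 x v k.+2.
rewrite (_ : slice A _ = leb (F @^-1` A `&` `[0, 1[)); last first.
  rewrite -(coin_measure_draw_law 0 mK) /slice; congr (mu _); apply/seteqP.
  have E w : fresh_state (splice 2 (iter k odd_coins v) w) = F (draw 0 w).
    rewrite /fresh_state /F !draw_splice /= !draw_iter addn0 addn1.
    by rewrite /wrap draw_itv.
  by split => w; rewrite /preimage /= E.
rewrite -(lebesgue_measure_affine (jump_time x v k.+2)) //; last exact: measurableI.
congr (leb _); apply/seteqP; split => t /=.
  move=> [kt At].
  have r01 : 0 <= (t - jump_time x v k.+2) / cycle_length x v k.+2 < 1.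
    by have := phase_itv (process t (x, v)); rewrite (phase_process kt).
  split; last by rewrite in_itv.
  by move: At; rewrite (processE kt) /position /preimage /F /wrap /= r01.
rewrite in_itv /= => -[At r01]; have kt : in_cycle x v k.+2 t.
  move: r01; rewrite /in_cycle ler_pdivlMr // mul0r subr_ge0 ltr_pdivrMr // mul1r.
  by rewrite ltrBlDl.
split=> //; rewrite (processE kt) /position.
by move: At; rewrite /preimage /F /wrap /= r01.
Qed.

Lemma harris_process : harris_recurrent (@path_law R) (@process R).
Proof.
exists fresh_law; split; first by apply/eqP => E0; have := fresh_lawT; rewrite E0 => /eqP; rewrite eq_sym onee_eq0.
move=> A mA A0 x.
have mS : measurable (fresh_state @^-1` A : set coins)
  by exact: measurable_preimageT measurable_fresh_state mA.
have mslice : measurable_fun [set: coins] (slice A : coins -> \bar R).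
  pose D : set (coins * coins) := [set z | A (fresh_state (splice 2 z.1 z.2))].
  have mD : measurable D.
    have msp := measurable_splice 2 (@measurable_fst _ _ coins coins) measurable_snd.
    exact: (measurable_preimageT msp mS).
  apply: eq_measurable_fun (measurable_fun_xsection mu mD) => u _.
  by rewrite /slice /=; congr (mu _); apply/seteqP; split => w /=; rewrite xsectionP.
have slice0 u : (0 <= slice A u)%E by exact: measure_ge0.
pose D (n : nat) : set coins := [set u | ((n.+1%:R^-1)%:E <= slice A u)%E].
have mD n : measurable (D n).
  rewrite -[X in measurable X]setTI; exact: emeasurable_fun_c_infty.
(* Otherwise [slice A] would vanish almost everywhere, although its integral is [fresh_law A]. *)
have [n Dn] : exists n, (0 < mu (D n))%E.
  apply: contrapT => nD'; have : (0 < fresh_law A)%E := A0; apply/negP; rewrite -leNgt.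
  have nD m : mu (D m) = 0%E.
    by apply/eqP; rewrite -measure_le0 leNgt; apply/negP => Dm; apply: nD'; exists m.
  have -> : fresh_law A = (\int[mu]_u slice A u)%E by exact: coin_measure_splice.
  rewrite (ge0_ae_eq_integral (g := cst 0%E)) ?integral0 //.
  exists (\bigcup_n D n); split.
  - exact: bigcupT_measurable.
  - apply/eqP; rewrite -measure_le0; apply: le_trans (measure_sigma_subadditive _ _ _ _) _.
    + exact: mD.
    + exact: bigcupT_measurable.
    + exact: subset_refl.
    + by rewrite eseries0 // => m _ _; exact: nD.
  - move=> u /= /not_implyP[_ u0].
    have u0' : (0 < slice A u)%E.
      by rewrite lt_neqAle slice0 andbT eq_sym; apply/eqP.
    have [r r0 ru] : exists2 r : R, 0 < r & (r%:E <= slice A u)%E.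
      case: (slice A u) u0' => [r|_|//]; last by exists 1; rewrite ?leey.
      by rewrite lte_fin => r0; exists r.
    exists (Num.truncn r^-1) => //; apply: le_trans ru; rewrite lee_fin.
    by rewrite invf_ple ?posrE // ltW // truncnS_gt.
(* [slice A] depends on the two vertices of a cycle, hence on two blocks. *)
have rec : {ae mu, forall v, forall m, exists k, (m <= k)%N /\ D n (iter k odd_coins v)}.
  apply: (@recurrent_coins 2) => // v w.
  rewrite /D /= (_ : slice A (splice 2 v w) = slice A v) // /slice; congr (mu _).
  have Ez z : fresh_state (splice 2 (splice 2 v w) z) = fresh_state (splice 2 v z).
    by rewrite /fresh_state !draw_splice.
  by apply/seteqP; split => z; rewrite /= Ez.
have [N [mN N0 NP]] := rec; exists (setT `*` N); split.
- exact: measurableX.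
- rewrite path_lawE -N0; congr (mu _); apply/seteqP; split => v /=; [by case|by split].
case=> y v /= nI; split=> //; apply: NP => /= io; apply: nI.
pose E k := [set t | in_cycle y v k.+2 t /\ A (process t (y, v))].
(* Times are clamped at 0 because [measurable_process] concerns non-negative times. *)
pose U := [set t | A (process (Num.max 0 t) (y, v))].
have mU : measurable U.
  have mt : measurable_fun [set: R] (fun t : R => Num.max 0 t).
    by apply: measurable_maxr.
  have mp := @measurable_process R _ R (fun=> y) (fun=> v) (measurable_cst (y : BS))
    (measurable_cst (v : coins)) _ mt (fun t => ltac:(by rewrite le_max lexx)).
  exact: (measurable_preimageT mp mA).
have E0 k t : E k t -> 0 <= t.
  move=> [/andP[kt _] _]; apply: le_trans kt; apply: le_trans (ltW (jump_time1_gt0 y v)) _.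
  by have := @jump_time_le R y v 1 k.+2 isT; apply: le_trans; rewrite lerDl.
have EU k : E k `<=` U `&` `[0, +oo[%classic.
  move=> t kt; have t0 := E0 k t kt; split; last by rewrite /= in_itv /= t0.
  by rewrite /U /= max_r //; case: kt.
have mE k : measurable (E k).
  rewrite (_ : E k = U `&` [set t | in_cycle y v k.+2 t]).
    apply: measurableI => //.
    exact: (measurable_in_cycle (measurable_cst (y : BS)) (measurable_cst (v : coins))
      (@measurable_id _ R setT)).
  apply/seteqP; split => t; first by move=> kt; have [? _] := EU k t kt; split=> //; case: kt.
  move=> [Ut kt]; split=> //; move: Ut; rewrite /U /= max_r //.
  move: kt => /andP[kt _]; apply: le_trans kt; apply: le_trans (ltW (jump_time1_gt0 y v)) _.
  by have := @jump_time_le R y v 1 k.+2 isT; apply: le_trans; rewrite lerDl.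
transitivity (\int[leb]_(t in `[0%R, +oo[) (\1_U t)%:E)%E.
  apply: eq_integral.
  move=> t /set_mem; rewrite /= in_itv /= andbT => t0.
  rewrite !indicE; have -> // : (t \in U) = (process t (y, v) \in A).
  by apply/idP/idP => /set_mem h; apply/mem_set; move: h; rewrite /U /= max_r.
rewrite integral_indic //; apply/eqP; rewrite -leye_eq.
apply: (@le_trans _ _ (leb (\bigcup_k E k))); last first.
  apply: le_measure; rewrite ?inE; [exact: bigcupT_measurable|exact: measurableI|].
  by move=> t [k _]; exact: EU.
rewrite measure_bigcup //=; last 2 first.
- by move=> k _; exact: mE.
- apply/trivIsetP => i j _ _ ij; rewrite -subset0 => t [[it _] [jt _]].
  by move/eqP: ij; apply; have [] := in_cycle_uniq it jt.
rewrite (eq_eseriesl (Q := xpredT)); last by move=> k; exact: in_setT.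
rewrite (@nneseries_infinitely_often (fun k => leb (E k)) n.+1%:R^-1) ?invr_gt0 //.
(* A cycle lasts at least 1, so a cycle with [slice] at least [1/(n+1)] spends at least that much
   time in [A]. *)
move=> m; have [k [mk Dk]] := io m; exists k; split=> //.
rewrite visit_time //; apply: le_trans Dk _; apply: lee_pemull; first exact: slice0.
by rewrite lee_fin; exact: cycle_length_ge1.
Qed.

End harris.

(** * Absence of regeneration times *)

Section random_time.
Context {R : realType} {d} {Om : measurableType d}.
Local Notation S := (state R).
Local Notation BS := (borel S).
Variables (X : R -> Om -> S) (T : Om -> R).
Hypothesis cX : cadlag_process X.
Hypotheses (mT : measurable_fun setT T) (T0 : forall w, 0 <= T w).

Lemma tdist_dist (s t u : S) : `|tdist s t - tdist s u| <= tdist t u.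
Proof.
rewrite ler_norml; have := tdist_triangle t s u; have := tdist_triangle u s t.
by rewrite (tdist_sym u t) => *; apply/andP; split; lra.
Qed.

(** [T] is approximated by the next multiple of [1/(n+1)] strictly after it; the approximations have
    countably many values, and right-continuity gives the limit. *)
Lemma measurable_random_time : measurable_fun setT (fun w => X (T w) w : BS).
Proof.
apply: measurable_fun_tdist => s.
pose Tn (n : nat) w := Num.truncn (T w * n.+1%:R).
pose tn (n k : nat) : R := k.+1%:R / n.+1%:R.
apply: (measurable_fun_cvg (h := fun n w => tdist s (X (tn n (Tn n w)) w))).
  move=> n; have mTn : measurable_fun setT (Tn n).
    by apply: measurableT_comp measurable_truncn _; apply: measurable_funM.
  apply: (@measurable_fun_pieces _ _ _ _ _
    (fun k w => tdist s (X (tn n k) w)) (fun k => [set w | Tn n w = k])).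
  - move=> k; exact: (measurable_preimageT (A := [set k]) mTn).
  - by move=> w; exists (Tn n w).
  - move=> k; apply: measurableT_comp (measurable_tdist s) _.
    by apply: cX.1; rewrite divr_ge0.
  - by move=> k w /= ->.
move=> w _; apply/cvgrPdist_lt => e e0.
have [/cvg_tdistP/(_ _ e0) + _] := cX.2 w _ (T0 w).
move=> [e' /= e'0 H].
have [N Ne] : exists N : nat, 0 + N.+1%:R^-1 < e' by exact: ltr_add_invr.
near=> n; apply: le_lt_trans (tdist_dist _ _ _) _.
have n0 : 0 < n.+1%:R :> R by [].
have Tn0 : 0 <= T w * n.+1%:R by rewrite mulr_ge0.
have /andP[l u] := truncn_itv Tn0.
have lt1 : T w < tn n (Tn n w) by rewrite /tn ltr_pdivlMr.
have lt2 : tn n (Tn n w) <= T w + n.+1%:R^-1.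
  by rewrite /tn ler_pdivrMr // mulrDl mulVf ?lt0r_neq0 // -natr1 lerD2r.
apply: H => //=; rewrite distrC gtr0_norm ?subr_gt0 //.
apply: le_lt_trans Ne; rewrite add0r lerBlDl; apply: le_trans lt2 _.
rewrite lerD2l lef_pV2 ?posrE // ler_nat ltnS.
by near: n; exact: nbhs_infty_ge.
Unshelve. all: by end_near. Qed.

End random_time.

(** * Decoupling of independent variables *)

Section independence.
Context {R : realType}.
Local Open Scope ereal_scope.

Lemma null_sections d1 d2 (T1 : measurableType d1) (T2 : measurableType d2)
    (m1 : probability T1 R) (m2 : probability T2 R) (N : set (T1 * T2)) :
  measurable N -> (m1 \x m2) N = 0 ->
  {ae m1, forall x, m2 (xsection N x) = 0} /\
  {ae m2, forall y, m1 (ysection N y) = 0}.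
Proof.
move=> mN N0; split.
  have mf := measurable_fun_xsection m2 mN.
  apply: filterS ((iffLR (ae_eq_integral_abs m1 measurableT mf)) _).
    by move=> x; apply.
  by rewrite -[RHS]N0; apply: eq_integral => x _; rewrite gee0_abs.
have mf := measurable_fun_ysection m1 mN.
apply: filterS ((iffLR (ae_eq_integral_abs m2 measurableT mf)) _).
  by move=> x; apply.
rewrite -[RHS]N0 (product_measure_unique (m' := m1 \x^ m2)) //; last first.
  by move=> A B mA mB; exact: product_measure2E.
by apply: eq_integral => x _; rewrite gee0_abs.
Qed.

Context d (Om : measurableType d) (Q : probability Om R).

Lemma ae_distribution d' (T : measurableType d') (f : {mfun Om >-> T}) (P : T -> Prop) :
  {ae distribution Q f, forall x, P x} -> {ae Q, forall w, P (f w)}.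
Proof.
move=> [N [mN N0 PN]]; exists (f @^-1` N); split => //.
  exact: measurable_preimageT.
by move=> w /PN.
Qed.

(** The law of [(X, Y)] is a product in which the law of [Y] may be read as that of [Y']. Fubini's
    theorem, in both orders, then spreads the almost sure relation over two separate sample points,
    without building an independent copy. *)
Lemma ae_indep d1 d2 (T1 : measurableType d1) (T2 : measurableType d2)
    (X : Om -> T1) (Y Y' : Om -> T2) (K : set (T1 * T2)) :
  measurable_fun setT X -> measurable_fun setT Y -> measurable_fun setT Y' ->
  (forall A B, measurable A -> measurable B ->
     Q (Y @^-1` B `&` X @^-1` A) = Q (Y @^-1` B) * Q (X @^-1` A)) ->
  (forall B, measurable B -> Q (Y @^-1` B) = Q (Y' @^-1` B)) ->
  measurable K -> {ae Q, forall w, K (X w, Y w)} ->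
  {ae Q, forall w, {ae Q, forall w', K (X w, Y' w')}} /\
  {ae Q, forall w', {ae Q, forall w, K (X w, Y' w')}}.
Proof.
move=> mX mY mY' ind law mK aeK.
pose fX : {mfun Om >-> T1} := mfun_Sub (mem_set mX).
pose fY : {mfun Om >-> T2} := mfun_Sub (mem_set mY').
have mXY : measurable_fun setT (fun w => (X w, Y w)) by exact/measurable_fun_pairP.
pose fXY : {mfun Om >-> (T1 * T2)%type} := mfun_Sub (mem_set mXY).
have N0 : (distribution Q fX \x distribution Q fY) (~` K) = 0.
  rewrite (product_measure_unique (m' := distribution Q fXY)) //; last 2 first.
  - move=> A B mA mB.
    transitivity (Q (Y @^-1` B `&` X @^-1` A)).
      by congr (Q _); apply/seteqP; split => w [].
    by rewrite ind // muleC; congr (_ * _); exact: law.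
  - exact: measurableC.
  have [N [mN N0 KN]] := aeK; apply/eqP; rewrite -measure_le0 -N0.
  apply: (@le_measure _ _ _ Q); rewrite ?inE //.
  exact: (measurable_preimageT mXY (measurableC mK)).
have [h1 h2] := null_sections (measurableC mK) N0.
split.
  apply: filterS (ae_distribution h1) => w.
  move=> H; exists (Y' @^-1` xsection (~` K) (X w)); split.
  - exact: (measurable_preimageT mY' (measurable_xsection _ (measurableC mK))).
  - exact: H.
  - by move=> w' /= nK; rewrite /preimage /= /xsection /= in_setE.
apply: filterS (ae_distribution h2) => w'.
move=> H; exists (X @^-1` ysection (~` K) (Y' w')); split.
- exact: (measurable_preimageT mX (measurable_ysection _ (measurableC mK))).
- exact: H.
- by move=> w /= nK; rewrite /preimage /= /ysection /= in_setE.
Qed.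

End independence.

Section measurable_walks.
Context d (T : measurableType d) {R : realType} {I : Type} (F : I -> T -> R).
Hypothesis mF : forall i, measurable_fun setT (F i).
Implicit Type s : seq I.

Lemma measurable_set_notin s g : measurable_fun setT g ->
  measurable [set x | g x \notin [seq F i x | i <- s]].
Proof.
move=> mg; elim: s => [|i s IH] /=.
  by rewrite (_ : [set _ | _] = setT) //; apply/seteqP; split.
rewrite (_ : [set _ | _] = ~` [set x | g x = F i x] `&`
    [set x | g x \notin [seq F i x | i <- s]]).
  by apply: measurableI => //; apply: measurableC; exact: measurable_set_eq.
apply/seteqP; split => x /=; rewrite inE negb_or; first by move=> /andP[/eqP].
by move=> [/eqP h1 h2]; exact/andP.
Qed.

Lemma measurable_set_uniq s : measurable [set x | uniq [seq F i x | i <- s]].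
Proof.
elim: s => [|i s IH] /=.
  by rewrite (_ : [set _ | _] = setT) //; apply/seteqP; split.
rewrite (_ : [set _ | _] = [set x | F i x \notin [seq F i x | i <- s]] `&`
    [set x | uniq [seq F i x | i <- s]]).
  by apply: measurableI => //; exact: measurable_set_notin.
by apply/seteqP; split => x /andP.
Qed.

Lemma measurable_walk_time s g : measurable_fun setT g ->
  measurable_fun setT (fun x => walk_time (g x) [seq F i x | i <- s]).
Proof.
elim: s g => [|i s IH] g mg.
  apply: eq_measurable_fun (measurable_cst (0 : R)) => x _.
  by rewrite /walk_time big_nil.
apply: eq_measurable_fun (measurable_funD (measurable_duration mg (mF i)) (IH _ (mF i))).
by move=> x _; rewrite /walk_time /= big_cons.
Qed.

Lemma measurable_last s g : measurable_fun setT g ->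
  measurable_fun setT (fun x => last (g x) [seq F i x | i <- s]).
Proof. by elim: s g => //= i s IH g mg; exact: IH. Qed.

End measurable_walks.

Lemma measurable_set_exists d (T : measurableType d) (I : countType) (P : I -> T -> Prop) :
  (forall i, measurable [set x | P i x]) -> measurable [set x | exists i, P i x].
Proof.
move=> mP; rewrite (_ : [set _ | _] = \bigcup_i [set x | P i x]).
  by apply: countable_bigcupT_measurable => //; exact: countableP.
by apply/seteqP; split => x [i]; exists i.
Qed.

(** * Countable description of paths *)

Section recorded_paths.
Context {R : realType}.
Local Notation S := (state R).
Local Notation BS := (borel S).
Implicit Types (x y : S) (p : R -> S) (t s : R).

Definition residual y : R := (1 - phase y) * gap y.

Definition next_jump p t := t + residual (p t).

Definition same_cycle p s t := [/\ next_jump p s = next_jump p t,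
  cur (p s) = cur (p t) & nxt (p s) = nxt (p t)].

(** Cycles last at least 1, so integer times miss none of the vertices drawn. *)
Definition recorded p (i : nat) := nxt (p i%:R).

(** Vertices are named by the integer times that record them, so that the existence of a walk is a
    countable union. The walk starts at [nxt x]: the unfinished first cycle is removed by
    [residual x]. *)
Definition recorded_walk x p t (I : seq nat) :=
  let q := map (recorded p) I in
  [/\ uniq (nxt x :: q), last (nxt x) q = nxt (p t) &
      walk_time (nxt x) q = next_jump p t - residual x].

(** At most one jump occurs in []j, j+1]], since cycles last at least 1. Rational times make this a
    path event; right-continuity will supply the other times. *)
Definition sampled_cycles p := forall (j : nat) (q : rat),
  j%:R <= (ratr q : R) -> (ratr q : R) < j.+1%:R ->
  same_cycle p (ratr q) j%:R \/ same_cycle p (ratr q) j.+1%:R.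

Definition skeleton x p := sampled_cycles p /\
  forall i : nat, exists I, recorded_walk x p i%:R I.

Let G := \bigcup_(s in `[0, +oo[%classic)
  preimage_set_system setT (fun p : R -> S => p s) <<s @open S >>.
Let PT := g_sigma_algebraType G.

Let path_eventE (B : set PT) : path_event B = measurable B.
Proof. by []. Qed.

Let measurable_eval t : 0 <= t -> measurable_fun [set: PT] (fun p : PT => p t : BS).
Proof.
move=> t0 _ Y mY; rewrite setTI -path_eventE; apply: sub_sigma_algebra.
by exists t; [rewrite /= in_itv /= t0|exists Y => //; rewrite setTI].
Qed.

Lemma measurable_residual : measurable_fun [set: BS] (residual : BS -> R).
Proof.
apply: measurable_funM.
  by apply: measurable_funB; [exact: measurable_cst|exact: measurable_phase].
exact: measurable_duration measurable_cur measurable_nxt.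
Qed.

Let measurable_nxt_at t : 0 <= t -> measurable_fun [set: PT] (fun p : PT => nxt (p t)).
Proof. by move=> t0; exact: measurableT_comp measurable_nxt (measurable_eval t0). Qed.

Let measurable_next_jump t : 0 <= t ->
  measurable_fun [set: PT] (fun p : PT => next_jump p t).
Proof.
move=> t0; apply: measurable_funD; first exact: measurable_cst.
exact: measurableT_comp measurable_residual (measurable_eval t0).
Qed.

Let measurable_same_cycle s t : 0 <= s -> 0 <= t ->
  measurable [set p : PT | same_cycle p s t].
Proof.
move=> s0 t0; rewrite (_ : [set _ | _] = [set p : PT | next_jump p s = next_jump p t] `&`
    [set p : PT | cur (p s) = cur (p t)] `&` [set p : PT | nxt (p s) = nxt (p t)]).
  apply: measurableI; first apply: measurableI.
  - by apply: measurable_set_eq; exact: measurable_next_jump.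
  - by apply: measurable_set_eq; apply: measurableT_comp measurable_cur _;
      exact: measurable_eval.
  - by apply: measurable_set_eq; exact: measurable_nxt_at.
by apply/seteqP; split => p /=; [case|case=> -[]].
Qed.

Lemma path_event_skeleton x : path_event (skeleton x).
Proof.
rewrite path_eventE; apply: measurableI.
  apply: measurable_set_forall => j; apply: measurable_set_forall => q.
  case: (lerP j%:R (ratr q : R)) => jq; last first.
    by rewrite (_ : [set _ | _] = setT) //; apply/seteqP; split.
  case: (ltrP (ratr q : R) j.+1%:R) => qj; last first.
    by rewrite (_ : [set _ | _] = setT) //; apply/seteqP; split.
  have q0 : 0 <= ratr q :> R by exact: le_trans jq.
  rewrite (_ : [set _ | _] = [set p : PT | same_cycle p (ratr q) j%:R] `|`
      [set p : PT | same_cycle p (ratr q) j.+1%:R]).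
    by apply: measurableU; exact: measurable_same_cycle.
  by apply/seteqP; split => p /= h; [exact: h|].
apply: measurable_set_forall => i; apply: measurable_set_exists => I.
have mz (k : nat) : measurable_fun [set: PT] (fun p : PT => recorded p k).
  exact: measurable_nxt_at.
rewrite (_ : [set _ | _] = [set p : PT | nxt x \notin [seq recorded p k | k <- I]] `&`
   [set p : PT | uniq [seq recorded p k | k <- I]] `&`
   [set p : PT | last (nxt x) [seq recorded p k | k <- I] = nxt (p i%:R)] `&`
   [set p : PT | walk_time (nxt x) [seq recorded p k | k <- I] =
                 next_jump p i%:R - residual x]).
  apply: measurableI; [apply: measurableI; [apply: measurableI|]|].
  - exact: (measurable_set_notin (F := fun k (p : PT) => recorded p k) mz I (measurable_cst _)).
  - exact: (measurable_set_uniq (F := fun k (p : PT) => recorded p k) mz I).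
  - apply: measurable_set_eq; last exact: measurable_nxt_at.
    exact: (measurable_last (F := fun k (p : PT) => recorded p k) mz I (measurable_cst _)).
  - apply: measurable_set_eq.
      exact: (measurable_walk_time (F := fun k (p : PT) => recorded p k) mz I (measurable_cst _)).
    by apply: measurable_funB; [exact: measurable_next_jump|exact: measurable_cst].
apply/seteqP; split => p /=; first by case=> /andP[].
by move=> [[[h1 h2] h3] h4]; split=> //; rewrite /= h1.
Qed.

Lemma path_event_avoids (c : R) : path_event [set p : R -> S | forall i, recorded p i <> c].
Proof.
rewrite path_eventE; apply: measurable_set_forall => i; apply: measurableC.
by apply: measurable_set_eq; [exact: measurable_nxt_at|exact: measurable_cst].
Qed.

End recorded_paths.

(** * Walks read off from a path *)

Section skeleton_walks.
Context {R : realType}.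
Local Notation S := (state R).
Local Notation BS := (borel S).
Implicit Types (x y : S) (p : R -> S) (v : coins) (t s : R).

Let carc_small (a b : R) : 0 <= a < 1 -> 0 <= b < 1 ->
  (forall e, 0 < e -> carc a b <= e) -> a = b.
Proof.
move=> a01 b01 H; apply: carc_eq0 => //; apply/eqP.
rewrite eq_le carc_ge0 // andbT; apply/ler_addgt0Pr => e e0.
by rewrite add0r; exact: H.
Qed.

(** Right-continuity in the circle metric fixes the vertices at [t] at once; the phase needs care,
    as its limit is only determined modulo 1. *)
Lemma same_cycle_right_limit p t s : cadlag p -> 0 <= t ->
  (forall e, 0 < e -> exists q, t < q < t + e /\ same_cycle p q s) ->
  same_cycle p t s.
Proof.
move=> cp t0 H.
have near_t e : 0 < e ->
    exists q, [/\ t < q < t + e, same_cycle p q s & tdist (p t) (p q) <= e].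
  move=> e0; have [/cvg_tdistP/(_ _ e0) + _] := cp _ t0.
  move=> [e' /= e'0 He']; have [|q [/andP[tq qt] sq]] := H (Num.min e e').
    by rewrite lt_min e0.
  have [qe qe'] : q < t + e /\ q < t + e'.
    by apply/andP; rewrite -!ltrBlDl -lt_min ltrBlDl.
  exists q; split=> //; first by rewrite tq.
  by apply/ltW/He' => //=; rewrite distrC gtr0_norm ?subr_gt0 // ltrBlDl.
have c0 (u w : S) : 0 <= carc (cur u) (cur w) by apply: carc_ge0; exact: cur_itv.
have n0 (u w : S) : 0 <= carc (nxt u) (nxt w) by apply: carc_ge0; exact: nxt_itv.
have p0 (u w : S) : 0 <= carc (phase u) (phase w) by apply: carc_ge0; exact: phase_itv.
have Ec : cur (p t) = cur (p s).
  apply: carc_small; [exact: cur_itv|exact: cur_itv|move=> e /near_t[q [_ [_ <- _]]]].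
  apply: le_trans; rewrite /tdist; move: (n0 (p t) (p q)) (p0 (p t) (p q)); lra.
have En : nxt (p t) = nxt (p s).
  apply: carc_small; [exact: nxt_itv|exact: nxt_itv|move=> e /near_t[q [_ [_ _ <-]]]].
  apply: le_trans; rewrite /tdist; move: (c0 (p t) (p q)) (p0 (p t) (p q)); lra.
pose g := gap (p s); have g1 : 1 <= g by exact: duration_ge1.
have g0 : g != 0 by rewrite lt0r_neq0 // (lt_le_trans ltr01).
(* The phase that puts the next jump after [t] at [next_jump p s]. Phases at later times [q] of the
   cycle exceed it strictly, but by at most [q - t], whence it lies in [[0, 1[]. *)
pose th := 1 - (next_jump p s - t) / g.
have phase_near q : t < q -> same_cycle p q s -> 0 < phase (p q) - th <= q - t.
  move=> tq [J C N]; rewrite /th -J /next_jump /residual /gap C N -/(gap (p s)) -/g.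
  rewrite (_ : _ - _ = (q - t) / g); last by field.
  by rewrite divr_gt0 ?subr_gt0 ?(lt_le_trans ltr01) // ler_pdivrMr ?(lt_le_trans ltr01) // ler_peMr // subr_ge0 ltW.
have th01 : 0 <= th < 1.
  apply/andP; split.
    apply/ler_addgt0Pr => e /near_t[q [/andP[tq qe] sq _]].
    have /andP[_] := phase_near q tq sq.
    by have /andP[] := phase_itv (p q); lra.
  have [q [/andP[tq _] sq _]] := near_t 1 ltr01.
  have /andP[+ _] := phase_near q tq sq.
  by have /andP[] := phase_itv (p q); lra.
have Ep : phase (p t) = th.
  apply: carc_small; [exact: phase_itv|exact: th01|move=> e e0].
  have [|q [/andP[tq qe] sq te]] := near_t (e / 2); first by rewrite divr_gt0.
  apply: le_trans (carc_triangle (b := phase (p q)) _ _ _) _; [exact: phase_itv|exact: phase_itv|exact: th01|].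
  have /andP[h1 h2] := phase_near q tq sq.
  have := carc_le (phase (p q)) th; rewrite gtr0_norm //.
  move: te; rewrite /tdist; move: (c0 (p t) (p q)) (n0 (p t) (p q)); lra.
split=> //; rewrite {1}/next_jump /residual Ep /gap Ec En -/(gap (p s)) -/g /th.
by field.
Qed.

Lemma skeleton_walk x p t : cadlag p -> skeleton x p -> 0 <= t ->
  exists I, recorded_walk x p t I.
Proof.
move=> cp [sp wp] t0; pose j := Num.truncn t; have /andP[jt tj] := truncn_itv t0.
have [n tn] : exists n : nat, same_cycle p t n%:R.
  (* Either rational times arbitrarily close after [t] belong to the cycle of [j], or all rational
     times shortly after [t] belong to that of [j.+1]. *)
  have [H|/existsNP[e1 /not_implyP[e10 H1]]] := pselect (forall e, 0 < e ->
      exists q, t < q < t + e /\ same_cycle p q j%:R).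
    by exists j; exact: same_cycle_right_limit.
  exists j.+1; apply: same_cycle_right_limit => // e e0.
  have : t < Num.min j.+1%:R (Num.min (t + e1) (t + e)).
    by rewrite !lt_min tj !ltrDl e10.
  move=> /rat_in_itvoo[q]; rewrite in_itv /= !lt_min => /andP[tq /and3P[qj q1 qe]].
  have [|sq|sq] := sp j q _ qj; first exact: le_trans jt (ltW tq).
    by exfalso; apply: H1; exists (ratr q); rewrite tq q1.
  by exists (ratr q); rewrite tq qe.
have [I [uI lI wI]] := wp n; exists I.
by case: tn => J _ N; split=> //; rewrite ?N ?J.
Qed.

Lemma next_jump_process x v k t : in_cycle x v k t ->
  next_jump (path_of process (x, v)) t = jump_time x v k.+1.
Proof.
move=> kt; rewrite /next_jump /residual /path_of (phase_process kt) /gap.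
rewrite (cur_process kt) (nxt_process kt) /= -/(cycle_length x v k).
by field; rewrite lt0r_neq0 // cycle_length_gt0.
Qed.

Lemma same_cycle_process x v k s t : in_cycle x v k s -> in_cycle x v k t ->
  same_cycle (path_of process (x, v)) s t.
Proof.
move=> ks kt; split; first by rewrite !(@next_jump_process x v k).
  by rewrite /path_of (cur_process ks) (cur_process kt).
by rewrite /path_of (nxt_process ks) (nxt_process kt).
Qed.

Lemma sampled_cycles_process x v : sampled_cycles (path_of process (x, v)).
Proof.
move=> j q jq qj; have jk := cycle_numberP x v (ler0n R j).
set k := cycle_number x v j%:R in jk; have /andP[k1 k2] := jk.
have [qk|kq] := ltP (ratr q) (jump_time x v k.+1).
  by left; apply: (@same_cycle_process x v k) jk; rewrite /in_cycle qk (le_trans k1 jq).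
have k3 := cycle_length_ge1 x v k.+1.
have k4 : jump_time x v k.+2 = jump_time x v k.+1 + cycle_length x v k.+1 by [].
rewrite -natr1 in qj *; right; apply: (@same_cycle_process x v k.+1).
  by rewrite /in_cycle kq k4; lra.
by rewrite /in_cycle k4; apply/andP; split; lra.
Qed.

Lemma walk_time_rcons (x y : R) q :
  walk_time x (rcons q y) = walk_time x q + duration (last x q) y.
Proof.
rewrite /walk_time -cats1 edges_cat big_cat big_cons big_nil /=.
by rewrite addr0.
Qed.

Definition draws v k : seq R := [seq draw l v | l <- iota 0 k].

Lemma draws_walk x v k :
  last (nxt x) (draws v k) = vertex x v k.+1 /\
  walk_time (nxt x) (draws v k) = jump_time x v k.+1 - residual x.
Proof.
elim: k => [|k [IHl IHw]].
  by split=> //; rewrite /walk_time big_nil jump_time1 subrr.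
have -> : draws v k.+1 = rcons (draws v k) (draw k v).
  by rewrite /draws -addn1 iotaD map_cat cats1.
split; first by rewrite last_rcons.
rewrite walk_time_rcons IHl IHw addrAC; congr (_ - _).
Qed.

Let nat_between (a : R) : 0 <= a -> exists n : nat, a <= n%:R < a + 1.
Proof.
move=> a0; have /andP[l u] := truncn_itv a0.
have [na|na] := eqVneq (Num.truncn a)%:R a.
  by exists (Num.truncn a); rewrite na lexx ltrDl ltr01.
exists (Num.truncn a).+1; rewrite (ltW u) -natr1 ltrD2r lt_neqAle na l.
by [].
Qed.

Lemma cycle_contains_nat x v k : exists n : nat, in_cycle x v k.+1 n%:R.
Proof.
have J0 : 0 <= jump_time x v k.+1.
  apply: le_trans (ltW (jump_time1_gt0 x v)) _.
  by have := @jump_time_le R x v 1 k.+1 isT; apply: le_trans; rewrite lerDl.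
have [n /andP[n1 n2]] := nat_between J0; exists n; rewrite /in_cycle n1 /=.
by apply: lt_le_trans n2 _; rewrite lerD2l cycle_length_ge1.
Qed.

Lemma skeleton_process x v :
  (forall j k, (j < k)%N -> draw j v <> draw k v :> R) ->
  (forall k, draw k v <> nxt x) -> skeleton x (path_of process (x, v)).
Proof.
move=> dv dx; split=> [|i]; first exact: sampled_cycles_process.
have [f fP] := choice (fun k => cycle_contains_nat x v k).
have ik := cycle_numberP x v (ler0n R i).
set k := cycle_number x v i%:R in ik; exists [seq f l | l <- iota 0 k].
have E : [seq recorded (path_of process (x, v)) n | n <- [seq f l | l <- iota 0 k]] =
         draws v k.
  rewrite -map_comp; apply: eq_map => l.
  by rewrite /= /recorded /path_of (nxt_process (fP l)).
have [lE wE] := draws_walk x v k.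
rewrite /recorded_walk E; split.
- rewrite /= map_inj_in_uniq ?iota_uniq ?andbT.
    by apply/mapP => -[l _ /esym]; exact: dx.
  move=> l m _ _ /= lm; apply/eqP; rewrite eqn_leq.
  by apply/andP; split; rewrite leqNgt; apply/negP => /dv; rewrite lm.
- by rewrite lE /path_of (nxt_process ik).
- by rewrite wE (next_jump_process ik).
Qed.

Lemma ae_draw_neq k (c : R) : {ae @coin_measure R, forall v : coins, draw k v <> c}.
Proof.
exists [set v | draw k v = c]; split.
- apply: measurable_set_eq; [exact: measurable_draw|exact: measurable_cst].
- exact: coin_measure_draw.
- by move=> v /= /contrapT.
Qed.

Lemma ae_draw_inj :
  {ae @coin_measure R, forall v : coins, forall j k, (j < k)%N -> draw j v <> draw k v :> R}.
Proof.
apply: ae_foralln => j; apply: ae_foralln => k.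
case: (ltnP j k) => jk; last exact: aeW.
exists [set v | draw j v = draw k v :> R]; split.
- by apply: measurable_set_eq; exact: measurable_draw.
- exact: coin_measure_draw_eq.
- by move=> v /= H; apply: contrapT => h; apply: H.
Qed.

Lemma ae_skeleton_process x :
  {ae @coin_measure R, forall v : coins, skeleton x (path_of process (x, v))}.
Proof.
have h := ae_foralln (fun k => ae_draw_neq k (nxt x)).
by apply: filterS (filterI ae_draw_inj h) => v [? ?]; exact: skeleton_process.
Qed.

Lemma ae_avoids_process x (c : R) : c <> nxt x ->
  {ae @coin_measure R, forall v : coins, forall i, recorded (path_of process (x, v)) i <> c}.
Proof.
move=> cx; apply: filterS (ae_foralln (fun k => ae_draw_neq k c)) => v dv i.
have ik := cycle_numberP x v (ler0n R i).
rewrite /recorded /path_of (nxt_process ik).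
by case: (cycle_number x v i%:R) => [|k] /=; [exact/nesym|exact: dv].
Qed.

End skeleton_walks.

(** * Exchange of two regeneration times *)

Section no_regeneration.
Context {R : realType}.
Local Notation S := (state R).
Local Notation BS := (borel S).
Local Notation mu := (@coin_measure R).

Lemma ae_ex d (Om : measurableType d) (Q : probability Om R) (P : Om -> Prop) :
  {ae Q, forall w, P w} -> exists w, P w.
Proof.
move=> [N [mN N0 PN]]; apply: contrapT => nP.
have : Q setT = 0%E.
  apply/eqP; rewrite -measure_le0 -N0; apply: le_measure; rewrite ?inE //.
  by move=> w _; apply: PN => /= Pw; apply: nP; exists w.
by rewrite probability_setT => /eqP; rewrite onee_eq0.
Qed.

(* Exchanging the times [t] and [t'] between the two paths preserves the sum of
   the two walk times. *)
Lemma exchanged_walks x (p p' : R -> S) t t' I I' :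
  recorded_walk x p t I -> recorded_walk x p' t' I' ->
  (forall i j, recorded p' i <> nxt x -> recorded p j <> recorded p' i) ->
  balanced (nxt x) (t' + residual (p t) - residual x) (nxt (p t)) ->
  lacunary (t + residual (p' t') - residual x) -> t' = t.
Proof.
move=> [u l w] [u' l' w'] dis bal lac.
set q := map _ I in u l w; set q' := map _ I' in u' l' w'.
have U : uniq (nxt x :: q ++ q').
  have /andP[xq' uq'] : (nxt x \notin q') && uniq q' := u'.
  rewrite -cat_cons cat_uniq u uq' andbT /=.
  apply/hasPn => y yq'; rewrite inE negb_or.
  have yx : y != nxt x by apply: contraNneq xq' => <-.
  rewrite yx; apply/mapP => -[j _ yj]; move/mapP: yq' => [i _ yi].
  by apply: (dis i j); rewrite -?yi -?yj //; exact/eqP.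
have v01 y : y \in nxt x :: q ++ q' -> 0 <= y < 1.
  rewrite inE mem_cat => /orP[/eqP ->|/orP[]/mapP[i _ ->]]; exact: nxt_itv.
have := balanced_unique U v01 _ lac; rewrite l => /(_ _ bal); rewrite w w'.
by rewrite /next_jump => H; have := H (ltac:(ring)) => ?; lra.
Qed.

Lemma not_wide_sense_regenerative x :
  ~ wide_sense_regenerative (@path_law R) (@process R) x.
Proof.
move=> [d [Om [Q [X [T [[cX law] stop inc ind same]]]]]].
have mT n : measurable_fun setT (T n) by case: (stop n).
have T0 n w : 0 <= T n w by case: (stop n).
pose s n w : BS := X (T n w) w.
have ms n : measurable_fun setT (s n) by exact: measurable_random_time.
(* The only bridge from the explicit process to its copy on the unknown probability space. *)
have law_ae B : path_event B ->
    {ae mu, forall v : coins, B (path_of (@process R) (x, v))} ->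
    {ae Q, forall w, B (path_of X w)}.
  move=> pB [N [mN N0 BN]]; have mB := measurable_path_event cX.1 pB.
  have mB' := measurable_path_event (@cadlag_process_process R).1 pB.
  have mBx : measurable [set v : coins | B (path_of (@process R) (x, v))].
    exact: (measurable_preimageT (f := fun v : coins => (x, v) : BS * coins)
      (pair1_measurable (x : BS)) mB').
  exists (~` (path_of X @^-1` B)); split => //; first exact: measurableC.
  rewrite probability_setC // law // path_lawE -probability_setC //.
  apply/eqP; rewrite -measure_le0 -N0; apply: le_measure; rewrite ?inE //.
  exact: measurableC.
have start D : measurable (D : set BS) -> path_event [set p : R -> S | D (p 0)].
  move=> mD; apply: sub_sigma_algebra; exists 0; first by rewrite /= in_itv /= lexx.
  by exists D => //; rewrite setTI.
have startE n D : shift_by (T n) X @^-1` [set p : R -> S | D (p 0)] = s n @^-1` D.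
  by apply/seteqP; split => w; rewrite /preimage /= /shift_by addr0.
have walks : {ae Q, forall w, forall n, exists I, recorded_walk x (path_of X w) (T n w) I}.
  apply: filterS (law_ae _ (path_event_skeleton x) (ae_skeleton_process x)) => w sw n.
  exact: skeleton_walk (cX.2 w) sw (T0 n w).
have avoids c : c <> nxt x -> {ae Q, forall w, forall i, recorded (path_of X w) i <> c}.
  move=> cx; exact: law_ae (path_event_avoids c) (ae_avoids_process cx).
(* What remains of the existence of a walk once the path is forgotten: a measurable relation between
   a time and the state at that time. *)
pose K : set (R * BS) := [set z |
  balanced (nxt x) (z.1 + residual z.2 - residual x) (nxt z.2)].
have mK : measurable K.
  apply: measurable_balanced.
    apply: measurable_funB; last exact: measurable_cst.
    apply: measurable_funD; first exact: measurable_fst.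
    exact: measurableT_comp measurable_residual measurable_snd.
  exact: measurableT_comp measurable_nxt measurable_snd.
have aeK n : {ae Q, forall w, K (T n w, s n w)}.
  apply: filterS walks => w /(_ n)[I [uI lI wI]]; rewrite /K /=.
  have := @balanced_walk_time R (nxt x) (map (recorded (path_of X w)) I).
  rewrite lI wI; apply=> y; rewrite inE => /predU1P[->|/mapP[i _ ->]]; exact: nxt_itv.
have indep n A B : measurable A -> measurable B ->
    Q (s n @^-1` B `&` T n @^-1` A) = (Q (s n @^-1` B) * Q (T n @^-1` A))%E.
  by move=> mA mB; rewrite -startE; apply: ind => //; exact: start.
have same_s m n B : measurable B -> Q (s m @^-1` B) = Q (s n @^-1` B).
  by move=> mB; rewrite -!startE; apply: same; exact: start.
(* For almost all [w'] and then almost all [w], [K] relates [T 1 w'] to [s 0 w], and [T 0 w] to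
   [s 1 w']: the two orders of Fubini's theorem let [w'] be chosen first in both. *)
have [h1 _] := ae_indep (mT 1) (ms 1) (ms 0) (indep 1) (same_s 1 0) mK (aeK 1).
have [_ h2] := ae_indep (mT 0) (ms 0) (ms 1) (indep 0) (same_s 0 1) mK (aeK 0).
have TT : {ae Q, forall w', {ae Q, forall w, T 1 w' = T 0 w}}.
  apply: filterS (filterI walks (filterI h1 h2)) => w' [/(_ 1%N)[I' wI'] [k1 k2]].
  (* For fixed [w'] its recorded vertices are countably many constants, and a second path almost
     surely avoids each of them other than [nxt x]. *)
  have dis : {ae Q, forall w, forall i, recorded (path_of X w') i <> nxt x ->
      forall j, recorded (path_of X w) j <> recorded (path_of X w') i}.
    apply: ae_foralln => i.
    have [->|ix] := pselect (recorded (path_of X w') i = nxt x); first exact: aeW.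
    by apply: filterS (avoids _ ix) => w + _.
  apply: filterS (filterI walks (filterI dis (filterI k1 k2))).
  move=> w [/(_ 0%N)[I wI] [dw [b1 [l2 _ _]]]].
  by apply: (exchanged_walks wI wI') => // i j ix; exact: dw.
have [w' Tc] := ae_ex TT; pose c := T 1 w'.
have T1c : {ae Q, forall w, T 1 w = c}.
  apply: filterS TT => w1 H; have [w [h3 h4]] := ae_ex (filterI Tc H).
  by rewrite h4 -h3.
have [w [h3 h4]] := ae_ex (filterI Tc T1c).
by have := inc 0 w; rewrite h4 -h3 ltxx.
Qed.

End no_regeneration.

Theorem theorem1 (R : realType) :
  exists S : pmetricType R,
    compact [set: S] /\ separable S /\
    exists (d : measure_display) (Omega : measurableType d)
           (P : R.-pker (borel S) ~> Omega) (X : R -> Omega -> S),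
      [/\ strong_markov P X,
          harris_recurrent P X &
          forall x : S, ~ wide_sense_regenerative P X x].
Proof.
exists (state R); split; first exact: compact_state.
split; first exact: separable_state.
exists _, (borel (state R) * coins)%type, (@path_law R), (@process R); split.
- exact: strong_markov_process.
- exact: harris_process.
- exact: not_wide_sense_regenerative.
Qed.
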